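(* Let $n\geq1$ be an integer and $\mu$ a finite non-negative Borel measure on $\mathbb T$. Then for every $f\in\mathcal O(\mathbb D)$ and every $0\le r<1$, $$D_{\mu,n}(f_r)\le\frac{4^{n-1}(2-r)r^{2n}}{(1+r)^{2n-2}}D_{\mu,n}(f),$$ where $f_r(z)=f(rz)$.
   Context: $\mathbb D$ open unit disc, $\mathbb T$ unit circle, $dA$ normalized area measure on $\mathbb D$, $\mathcal O(\mathbb D)$ holomorphic functions on $\mathbb D$. $P_\mu(z)=\int_{\mathbb T}\frac{1-|z|^2}{|z-\zeta|^2}d\mu(\zeta)$ and $D_{\mu,n}(f)=\frac{1}{n!(n-1)!}\int_{\mathbb D}|f^{(n)}(z)|^2P_\mu(z)(1-|z|^2)^{n-1}dA(z)\in[0,\infty]$. *)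

(* Defs.v *)
From HB Require Import structures.
From mathcomp Require Import all_boot all_order all_algebra.
From mathcomp Require Import all_classical all_reals all_analysis.
From mathcomp.real_closed Require Import complex.
Set Implicit Arguments. Unset Strict Implicit. Unset Printing Implicit Defensive.
Import Order.TTheory GRing.Theory Num.Theory.
Import numFieldNormedType.Exports.
Local Open Scope ring_scope.
Local Open Scope complex_scope.

Section Defs.
Variable R : realType.

Definition cabs2 (z : R[i]) : R := (complex.Re z) ^+ 2 + (complex.Im z) ^+ 2.

Definition toC (p : R * R) : R[i] := p.1 +i* p.2.

Definition unit_disc : set R[i] := [set z | cabs2 z < 1].
Definition unit_disc2 : set (R * R) := [set p | p.1 ^+ 2 + p.2 ^+ 2 < 1].

Definition expi (t : R) : R[i] := cos t +i* sin t.

Definition holomorphic_on_disc (f : R[i] -> R[i]) : Prop :=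
  forall z, unit_disc z -> derivable (f : R[i]^o -> R[i]^o) z 1.

(* Poisson integral P_mu(z) of a measure on T; T is parametrized by
   t in [0, 2pi) via t |-> e^{it}, mu a Borel measure on R restricted there *)
Definition poisson (mu : {measure set R -> \bar R}) (z : R[i]) : \bar R :=
  (\int[mu]_(t in `[0%R, (2 * pi)%R[) ((1 - cabs2 z) / cabs2 (z - expi t))%:E)%E.

(* D_{mu,n}(f) = 1/(n!(n-1)!) int_D |f^(n)|^2 P_mu (1-|z|^2)^(n-1) dA,
   with dA = (1/pi) d(Lebesgue on R^2) *)
Definition Dmun (mu : {measure set R -> \bar R}) (n : nat) (f : R[i] -> R[i]) : \bar R :=
  (((n`! * (n.-1)`!)%:R)^-1 %:E *
   ((pi^-1)%:E *
    \int[(@lebesgue_measure R \x @lebesgue_measure R)]_(p in unit_disc2)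
       ((cabs2 (derive1n n (f : R[i]^o -> R[i]^o) (toC p)))%:E * poisson mu (toC p) *
        ((1 - cabs2 (toC p)) ^+ n.-1)%:E)))%E.
End Defs.

(* Main.v *)
Require Import Defs.
From HB Require Import structures.
From mathcomp Require Import all_boot all_order all_algebra.
From mathcomp Require Import all_classical all_reals all_analysis.
From mathcomp.real_closed Require Import complex.
From mathcomp Require Import ring lra.
Import Order.TTheory GRing.Theory Num.Theory.
Import numFieldNormedType.Exports.
Import ComplexField.Normc.
Import measurable_realfun.

Set Implicit Arguments.
Unset Strict Implicit.
Unset Printing Implicit Defensive.

Local Open Scope classical_set_scope.
Local Open Scope ring_scope.

(* Write g for the n-th derivative of f. By Tonelli's theorem it suffices to bound, for each point
   zeta of the circle, the integral of |g(r z)|^2 (1 - |z|^2)^n / |z - zeta|^2 over the disc. Put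
   h(z) = g(z) / (1 - conj(zeta) z), with Taylor coefficients s_k. The integrand is then
   |k(z)|^2 (1 - |z|^2)^n with k(z) = (1 - r conj(zeta) z) / (1 - conj(zeta) z) h(r z), and the
   coefficients of k are
     t_m = r^m s_m + (1 - r) sum_{k < m} r^k conj(zeta)^(m - k) s_k.
   The weights r^m and (1 - r) r^k, k < m, add up to 1, so |t_m|^2 is at most the same combination
   of the |s_k|^2. By Parseval's identity on circles and the recursion for the moments of the
   weights |z|^(2k) (1 - |z|^2)^n, summing over m costs a factor
   r^k (1 + (1 - r) (k + 1) / n) <= 2 - r. This gives D_{mu,n}(f_r) <= (2 - r) r^(2n) D_{mu,n}(f),
   and (4 / (1 + r)^2)^(n - 1) >= 1.

   Pointwise complex differentiability yields the power series through Goursat's theorem in the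
   coordinate log w, where circles become segments: circle means of holomorphic functions do not
   depend on the radius. Polar coordinates in the plane are replaced by averaging over rotations,
   which preserve Lebesgue measure because they are products of shears. *)

(** * The modulus and complex differentiability *)

(** The factor (1 - r conj(zeta) z) / (1 - conj(zeta) z) appears because dilation moves the argument
    of g but not that of the kernel 1 / |z - zeta|^2. It is unbounded near zeta, so no pointwise
    comparison of the integrands is possible. Its Taylor coefficients, however, are 1 followed by (1
    - r) conj(zeta)^j, and the small factor 1 - r balanced against the decay r^k is what gives
    weights of total mass 1; convexity of the square then does the rest. In the sum over m, the tail
    |z|^(2(k+1)) / (1 - |z|^2) costs one power of the weight, and the moment recursion restores it
    at the price (k + 1) / n. The resulting factor is largest at k = 0, n = 1, where it equals 2 -
    r. Since D_{mu,n}(f) may be infinite, integrals are compared as nonnegative extended reals and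
    never subtracted there. *)

Section ComplexModulus.
Variable R : realType.
Implicit Types z w : R[i].

Lemma normcE_sqrt z : normc z = Num.sqrt (cabs2 z).
Proof. by case: z. Qed.

Lemma normc_ge0 z : 0 <= normc z.
Proof. by case: z => a b; exact: sqrtr_ge0. Qed.

Lemma cabs2_ge0 z : 0 <= cabs2 z.
Proof. by rewrite addr_ge0 ?sqr_ge0. Qed.

Lemma cabs2E z : cabs2 z = normc z ^+ 2.
Proof. by rewrite normcE_sqrt sqr_sqrtr// cabs2_ge0. Qed.

Lemma norm_normc z : `|z| = (normc z)%:C%C.
Proof. by rewrite normc_def normcE_sqrt. Qed.

Lemma normc_eq0 z : (normc z == 0) = (z == 0).
Proof.
apply/eqP/eqP => [/eq0_normc //|->]; exact: normc0.
Qed.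

Lemma normc_gt0 z : (0 < normc z) = (z != 0).
Proof. by rewrite lt0r normc_eq0 normc_ge0 andbT. Qed.

Lemma normcB z w : normc (z - w) = normc (w - z).
Proof. by rewrite -normcN opprB. Qed.

Lemma normcX z n : normc (z ^+ n) = normc z ^+ n.
Proof. by elim: n => [|n IH]; rewrite ?expr0 ?normc1// !exprS normcM IH. Qed.

Lemma normcC (x : R) : normc x%:C%C = `|x|.
Proof. by rewrite /= expr0n /= addr0 sqrtr_sqr. Qed.

Lemma normc_conj z : normc (conjc z) = normc z.
Proof. by case: z => a b /=; rewrite sqrrN. Qed.

Lemma abs_Re_le z : `|complex.Re z| <= normc z.
Proof.
by rewrite -sqrtr_sqr normcE_sqrt ler_wsqrtr// lerDl sqr_ge0.
Qed.

Lemma abs_Im_le z : `|complex.Im z| <= normc z.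
Proof.
by rewrite -sqrtr_sqr normcE_sqrt ler_wsqrtr// lerDr sqr_ge0.
Qed.

Lemma normc_le_abs z : normc z <= `|complex.Re z| + `|complex.Im z|.
Proof.
rewrite -(@ler_pXn2r _ 2)// ?nnegrE ?normc_ge0 ?addr_ge0// -cabs2E /cabs2.
rewrite -[complex.Re z ^+ 2]real_normK ?num_real// -[complex.Im z ^+ 2]real_normK ?num_real//.
rewrite sqrrD -addrA lerD2l lerDr mulrn_wge0// mulr_ge0//.
Qed.

Lemma ler_normcB z w : normc z - normc w <= normc (z - w).
Proof. by rewrite lerBlDr -{1}(subrK w z) le_normcD. Qed.

Lemma cabs2M z w : cabs2 (z * w) = cabs2 z * cabs2 w.
Proof. by rewrite !cabs2E normcM exprMn. Qed.

Lemma cabs2_expi (t : R) : cabs2 (expi t) = 1.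
Proof. by rewrite /cabs2 /= cos2Dsin2. Qed.

Lemma normc_expi (t : R) : normc (expi t) = 1.
Proof. by rewrite normcE_sqrt cabs2_expi sqrtr1. Qed.

Lemma expiD (s t : R) : expi (s + t) = expi s * expi t.
Proof. by rewrite /expi cosD sinD; simpc; congr (_ +i* _)%C; rewrite [RHS]addrC. Qed.

Lemma expi0 : expi (0 : R) = 1.
Proof. by rewrite /expi cos0 sin0. Qed.

Lemma expi_neq0 (t : R) : expi t != 0.
Proof. by rewrite -normc_eq0 normc_expi oner_eq0. Qed.

Lemma unit_discE z : unit_disc z <-> normc z < 1.
Proof.
by rewrite /unit_disc /= cabs2E expr_lt1 ?normc_ge0.
Qed.

(* The modulus is [normc] because the norm of [R[i]] takes its values in [R[i]]. *)
Definition cdiff (f : R[i] -> R[i]) (z d : R[i]) :=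
  forall e : R, 0 < e -> exists2 dl : R, 0 < dl &
    forall h, normc h < dl -> normc (f (z + h) - f z - d * h) <= e * normc h.

Definition cdiffx f z := exists d, cdiff f z d.

Definition ccont (f : R[i] -> R[i]) z :=
  forall e : R, 0 < e -> exists2 dl : R, 0 < dl &
    forall w, normc (w - z) < dl -> normc (f w - f z) <= e.

(** Bridge to the library derivative over the field [R[i]]: differentiation rules are imported
    through it, while estimates are made with real epsilons. *)
Lemma is_derive_cdiff (f : R[i]^o -> R[i]^o) (z d : R[i]) :
  is_derive (z : R[i]^o) (1 : R[i]^o) f (d : R[i]^o) <-> cdiff f z d.
Proof.
split=> [[df <-] e e0|df].
  move: df; rewrite /derivable /derive => /cvgrPdist_le.
  have eC : (0 : R[i]) < e%:C%C by rewrite ltcR.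
  move=> /(_ _ eC); rewrite near_withinE => /nbhs_ballP[r /= r0 Hr].
  (* A radius in [R[i]] that is positive for the complex order is a real number. *)
  have [rI rR] : complex.Im r = 0 /\ 0 < complex.Re r.
    by move: r0; rewrite ltcE => /andP[/eqP -> ->].
  exists (complex.Re r) => // h hr.
  have [->|h0] := eqVneq h 0; first by rewrite addr0 subrr mulr0 subr0 normc0 mulr0.
  have := Hr h; rewrite /ball /= sub0r normrN.
  have -> : (`|h| < r).
    by rewrite norm_normc ltcE rI /= eqxx.
  move=> /(_ isT h0).
  rewrite norm_normc lecR => H.
  have nh0 : 0 < normc h by rewrite normc_gt0.
  rewrite -ler_pdivrMr// -normcV -normcM.
  apply: le_trans H; rewrite normcB le_eqVlt; apply/orP; left; apply/eqP; congr normc.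
  set L := lim _.
  rewrite -![_ *: _]/(_ * _) mulr1 [h + z]addrC !mulrBl mulfK//.
  by rewrite !(mulrC h^-1) mulrBl.
have cv : h^-1 *: ((f \o shift z) (h *: (1 : R[i]^o)) - f z) @[h --> (0 : R[i]^o)^'] --> (d : R[i]^o).
  apply/cvgrPdist_le => e.
  move=> e0; have [eI eR] : complex.Im e = 0 /\ 0 < complex.Re e.
    by move: e0; rewrite ltcE => /andP[/eqP -> ->].
  have [r r0 H] := df _ eR.
  rewrite near_withinE; apply/nbhs_ballP; exists (r%:C%C); first by rewrite /= ltcR.
  move=> h; rewrite /ball /= sub0r normrN norm_normc ltcR => hr h0.
  have {H} := H _ hr.
  have nh0 : 0 < normc h by rewrite normc_gt0.
  rewrite -ler_pdivrMr// -normcV -normcM => H.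
  have -> : e = (complex.Re e)%:C%C by case: (e) eI => a b /= ->.
  rewrite norm_normc lecR; apply: le_trans H; rewrite normcB le_eqVlt.
  apply/orP; left; apply/eqP; congr normc.
  rewrite -![_ *: _]/(_ * _) mulr1 [h + z]addrC !mulrBl mulfK//.
  by rewrite !(mulrC h^-1) mulrBl.
split; first by apply/cvg_ex; exists d.
exact: cvg_lim cv.
Qed.

Lemma derivable_cdiff (f : R[i]^o -> R[i]^o) (z : R[i]) :
  derivable f z 1 -> cdiff f z ('D_1 f z).
Proof. by move=> /derivableP /is_derive_cdiff. Qed.

Lemma cdiff_derive1 (f : R[i]^o -> R[i]^o) (z d : R[i]) :
  cdiff f z d -> f^`()%classic z = d.
Proof. by move=> /is_derive_cdiff [_ <-]; rewrite derive1E. Qed.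

Lemma cdiffM f g z a b : cdiff f z a -> cdiff g z b ->
  cdiff (fun w => f w * g w) z (f z * b + g z * a).
Proof.
move=> /(is_derive_cdiff f) Hf /(is_derive_cdiff g) Hg.
by apply/is_derive_cdiff; have := is_deriveM Hf Hg.
Qed.

Lemma cdiffD f g z a b : cdiff f z a -> cdiff g z b ->
  cdiff (fun w => f w + g w) z (a + b).
Proof.
move=> /(is_derive_cdiff f) Hf /(is_derive_cdiff g) Hg.
by apply/is_derive_cdiff; have := is_deriveD Hf Hg.
Qed.

Lemma cdiffV f z a : f z != 0 -> cdiff f z a ->
  cdiff (fun w => (f w)^-1) z (- (f z) ^- 2 * a).
Proof.
move=> f0 /(is_derive_cdiff f) [df <-].
apply/is_derive_cdiff; split; first exact: derivableV.
by rewrite deriveV.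
Qed.

Lemma cdiff_cst c z : cdiff (fun=> c) z 0.
Proof. by apply/is_derive_cdiff; exact: is_derive_cst. Qed.

Lemma cdiff_id z : cdiff id z 1.
Proof. by apply/is_derive_cdiff; exact: is_derive_id. Qed.

Lemma cdiff_lip f z d : cdiff f z d ->
  exists2 dl : R, 0 < dl & forall h, normc h < dl ->
    normc (f (z + h) - f z) <= (normc d + 1) * normc h.
Proof.
move=> /(_ 1 ltr01)[dl dl0 H]; exists dl => // h hd.
have := H h hd; rewrite mul1r => {}H.
rewrite -(subrK (d * h) (f (z + h) - f z)).
apply: le_trans (le_normcD _ _) _.
by rewrite normcM mulrDl mul1r addrC lerD2l.
Qed.

Lemma cdiff_ccont f z d : cdiff f z d -> ccont f z.
Proof.
move=> /cdiff_lip[dl dl0 H] e e0.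
have d0 : 0 < normc d + 1 by rewrite ltr_wpDl// normc_ge0.
exists (Num.min dl (e / (normc d + 1))).
  by rewrite lt_min dl0 divr_gt0.
move=> w; rewrite lt_min => /andP[w1 w2].
have := H _ w1; rewrite (addrC z) subrK => /le_trans; apply.
by rewrite -ler_pdivlMl// mulrC ltW.
Qed.

(** The error splits into that of [g], over a displacement of at most [(normc a + 1) * normc h], and
    [b] times that of [f]. The [+ 1] keeps the divisors positive when a derivative vanishes. *)
Lemma cdiff_comp f g z a b : cdiff f z a -> cdiff g (f z) b ->
  cdiff (g \o f) z (b * a).
Proof.
move=> Hf Hg e e0.
have [d1 d10 H1] := cdiff_lip Hf.
have a0 : 0 < normc a + 1 by rewrite ltr_wpDl// normc_ge0.
have b0 : 0 < normc b + 1 by rewrite ltr_wpDl// normc_ge0.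
have e1 : 0 < e / 2 / (normc a + 1) by rewrite !divr_gt0.
have e2 : 0 < e / 2 / (normc b + 1) by rewrite !divr_gt0.
have [d2 d20 H2] := Hg _ e1.
have [d3 d30 H3] := Hf _ e2.
exists (Num.min d1 (Num.min d3 (d2 / (normc a + 1)))).
  by rewrite !lt_min d10 d30 divr_gt0.
move=> h; rewrite !lt_min => /and3P[h1 h3 h2].
have K1 := H1 _ h1.
have K2 : normc (f (z + h) - f z) < d2.
  by apply: le_lt_trans K1 _; rewrite -ltr_pdivlMl// mulrC.
have {}K2 := H2 _ K2; rewrite (addrC (f z)) subrK in K2.
have K3 := H3 _ h3.
rewrite /= (_ : _ - _ - _ = (g (f (z + h)) - g (f z) - b * (f (z + h) - f z))
  + b * (f (z + h) - f z - a * h)); last by ring.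
apply: le_trans (le_normcD _ _) _; rewrite normcM.
rewrite [e]splitr mulrDl lerD//.
  apply: le_trans K2 _; apply: le_trans (ler_wpM2l _ K1) _; first exact: ltW.
  by rewrite mulrA divfK// gt_eqF.
apply: le_trans (ler_wpM2l _ K3) _; first exact: normc_ge0.
rewrite mulrA ler_wpM2r ?normc_ge0//.
rewrite mulrCA ler_piMr ?divr_ge0 ?ltW//.
by rewrite ltr_pdivrMr// mul1r ltrDl.
Qed.

End ComplexModulus.

Arguments normc : simpl never.

(** * Goursat's theorem on rectangles *)

Section IntervalIntegral.
Variable R : realType.
Implicit Types (f g : R -> R) (a b c d : R).

Definition iint f a b : R := \int[@lebesgue_measure R]_(x in `[a, b]) f x.

Lemma within_itv_integrable f a b : {within `[a, b], continuous f} ->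
  (@lebesgue_measure R).-integrable `[a, b] (EFin \o f).
Proof. by move=> cf; apply: continuous_compact_integrable => //; exact: segment_compact. Qed.

Lemma eq_iint f g a b : (forall x, a <= x <= b -> f x = g x) -> iint f a b = iint g a b.
Proof. by move=> fg; apply: eq_Rintegral => x; rewrite inE /= in_itv /=; exact: fg. Qed.

Lemma iint_cst k a b : a <= b -> iint (fun=> k) a b = k * (b - a).
Proof.
move=> ab; rewrite /iint Rintegral_cst//=; congr (_ * _).
rewrite lebesgue_measure_itv/= lte_fin; case: ltgtP ab => //= -> _.
by rewrite subrr.
Qed.

Lemma iint_split f a b c : a <= b <= c -> {within `[a, c], continuous f} ->
  iint f a c = iint f a b + iint f b c.
Proof.
move=> /andP[ab bc] cf.
have := @Rintegral_itvB R f (BLeft a) (BRight c) b (within_itv_integrable cf).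
rewrite !bnd_simp => /(_ ab bc) /eqP; rewrite subr_eq => /eqP.
rewrite /iint => ->; rewrite addrC; congr (_ + _).
rewrite Rintegral_itv_obnd_cbnd//.
apply: (integrableS _ _ _ (within_itv_integrable cf)) => //.
by apply: subset_itv => //; rewrite bnd_simp.
Qed.

Lemma iintB f g a b : {within `[a, b], continuous f} -> {within `[a, b], continuous g} ->
  iint (fun x => f x - g x) a b = iint f a b - iint g a b.
Proof. by move=> cf cg; rewrite /iint RintegralB//; exact: within_itv_integrable. Qed.

Lemma iintD f g a b : {within `[a, b], continuous f} -> {within `[a, b], continuous g} ->
  iint (fun x => f x + g x) a b = iint f a b + iint g a b.
Proof. by move=> cf cg; rewrite /iint RintegralD//; exact: within_itv_integrable. Qed.

Lemma iintZ k f a b : {within `[a, b], continuous f} ->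
  iint (fun x => k * f x) a b = k * iint f a b.
Proof. by move=> cf; rewrite /iint RintegralZl//; exact: within_itv_integrable. Qed.

Lemma iint_le f g a b : {within `[a, b], continuous f} -> {within `[a, b], continuous g} ->
  (forall x, a <= x <= b -> f x <= g x) -> iint f a b <= iint g a b.
Proof.
move=> cf cg fg; apply: le_Rintegral => //; try exact: within_itv_integrable.
Qed.

Lemma within_cst k a b : {within `[a, b], continuous (fun=> k : R)}.
Proof. by apply: continuous_subspaceT => x; exact: cvg_cst. Qed.

(** Replaces an integrand by a constant up to a uniform error; it serves both the linearisation in
    Goursat's theorem and the bounds on means. *)
Lemma iint_near f a b k M : a <= b -> {within `[a, b], continuous f} ->
  (forall x, a <= x <= b -> `|f x - k| <= M) ->
  `|iint f a b - k * (b - a)| <= M * (b - a).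
Proof.
move=> ab cf H.
rewrite ler_norml; apply/andP; split.
- rewrite lerBrDl -mulNr -mulrDl -iint_cst//.
  apply: iint_le => // [|x /H]; first exact: within_cst.
  by rewrite ler_norml => /andP[]; lra.
- rewrite lerBlDr -mulrDl -iint_cst//.
  apply: iint_le => // [|x /H]; first exact: within_cst.
  by rewrite ler_norml => /andP[]; lra.
Qed.

End IntervalIntegral.

(** * Bisection of rectangles *)

Section Bisection.
Variable R : realType.

Lemma nested_intervals (a b : nat -> R) :
  (forall n, a n <= a n.+1) -> (forall n, b n.+1 <= b n) -> (forall n, a n <= b n) ->
  exists x, forall n, a n <= x <= b n.
Proof.
move=> ha hb hab.
have ma : {homo a : m n / (m <= n)%N >-> m <= n} by apply: homo_leq => //; exact: le_trans.
have mb : {homo b : m n / (m <= n)%N >-> n <= m}.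
  by apply: homo_leq => // x y z xy yz; exact: le_trans yz xy.
have ub n : ubound (range a) (b n).
  move=> _ [m _ <-]; case: (leqP m n) => mn.
    exact: le_trans (ma _ _ mn) (hab n).
  exact: le_trans (hab m) (mb _ _ (ltnW mn)).
exists (sup (range a)) => n; apply/andP; split.
  by apply: ub_le_sup; [exists (b 0%N)|exists n].
by apply: ge_sup => //; exists (a 0%N), 0%N.
Qed.

Definition lhalf (I : R * R) := (I.1, (I.1 + I.2) / 2).
Definition rhalf (I : R * R) := ((I.1 + I.2) / 2, I.2).
Definition subitv (I J : R * R) := [/\ J.1 <= I.1, I.1 <= I.2 & I.2 <= J.2].

Variable Phi : R * R -> R * R -> R.
Variables I0 J0 : R * R.
Hypotheses (hI0 : I0.1 <= I0.2) (hJ0 : J0.1 <= J0.2).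
Hypothesis Phi_split1 : forall I J, subitv I I0 -> subitv J J0 ->
  Phi I J = Phi (lhalf I) J + Phi (rhalf I) J.
Hypothesis Phi_split2 : forall I J, subitv I I0 -> subitv J J0 ->
  Phi I J = Phi I (lhalf J) + Phi I (rhalf J).
Hypothesis Phi_local : forall x y, I0.1 <= x <= I0.2 -> J0.1 <= y <= J0.2 ->
  forall e, 0 < e -> exists2 dl, 0 < dl & forall I J, subitv I I0 -> subitv J J0 ->
    I.1 <= x <= I.2 -> J.1 <= y <= J.2 -> I.2 - I.1 < dl -> J.2 - J.1 < dl ->
    `|Phi I J| <= e * (I.2 - I.1 + (J.2 - J.1)) ^+ 2.

(** A round halves the rectangle once in each direction, each time keeping a half with at least half
    of [|Phi|]; a quarter of it survives while both sides are halved. *)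
Let step1 (s : (R * R) * (R * R)) :=
  if `|Phi s.1 s.2| <= 2 * `|Phi (lhalf s.1) s.2| then (lhalf s.1, s.2) else (rhalf s.1, s.2).
Let step2 (s : (R * R) * (R * R)) :=
  if `|Phi s.1 s.2| <= 2 * `|Phi s.1 (lhalf s.2)| then (s.1, lhalf s.2) else (s.1, rhalf s.2).
Let seqr n := iter n (step2 \o step1) (I0, J0).

Lemma half_dichotomy (u v w : R) : u = v + w -> ~~ (`|u| <= 2 * `|v|) -> `|u| <= 2 * `|w|.
Proof. by move=> ->; rewrite -ltNge => ?; have := ler_normD v w; lra. Qed.

Let step1P s : subitv s.1 I0 -> subitv s.2 J0 ->
  [/\ subitv (step1 s).1 s.1, (step1 s).2 = s.2,
      (step1 s).1.2 - (step1 s).1.1 = (s.1.2 - s.1.1) / 2 &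
      `|Phi s.1 s.2| <= 2 * `|Phi (step1 s).1 (step1 s).2| ].
Proof.
move=> h1 h2; have [? ? ?] := h1; rewrite /step1; case: ifPn => H; split => //=; try lra.
- by split => //=; lra.
- by split => //=; lra.
- exact: half_dichotomy (Phi_split1 h1 h2) H.
Qed.

Let step2P s : subitv s.1 I0 -> subitv s.2 J0 ->
  [/\ subitv (step2 s).2 s.2, (step2 s).1 = s.1,
      (step2 s).2.2 - (step2 s).2.1 = (s.2.2 - s.2.1) / 2 &
      `|Phi s.1 s.2| <= 2 * `|Phi (step2 s).1 (step2 s).2| ].
Proof.
move=> h1 h2; have [? ? ?] := h2; rewrite /step2; case: ifPn => H; split => //=; try lra.
- by split => //=; lra.
- by split => //=; lra.
- exact: half_dichotomy (Phi_split2 h1 h2) H.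
Qed.

Lemma subitv_trans I J K : subitv I J -> subitv J K -> subitv I K.
Proof. by case=> ? ? ? [? ? ?]; split; lra. Qed.

Let seqrP n : subitv (seqr n).1 I0 /\ subitv (seqr n).2 J0.
Proof.
elim: n => [|n [h1 h2]]; first by split; split.
rewrite /seqr iterS -/(seqr n) /=.
have [k1 k2 _ _] := step1P h1 h2.
have h1' : subitv (step1 (seqr n)).1 I0 := subitv_trans k1 h1.
have h2' : subitv (step1 (seqr n)).2 J0 by rewrite k2.
have [k3 k4 _ _] := step2P h1' h2'.
split; first by rewrite k4.
exact: subitv_trans k3 h2'.
Qed.

Let seqrS n : [/\ subitv (seqr n.+1).1 (seqr n).1, subitv (seqr n.+1).2 (seqr n).2,
  (seqr n.+1).1.2 - (seqr n.+1).1.1 = ((seqr n).1.2 - (seqr n).1.1) / 2,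
  (seqr n.+1).2.2 - (seqr n.+1).2.1 = ((seqr n).2.2 - (seqr n).2.1) / 2 &
  `|Phi (seqr n).1 (seqr n).2| <= 4 * `|Phi (seqr n.+1).1 (seqr n.+1).2| ].
Proof.
have [h1 h2] := seqrP n.
rewrite /seqr iterS -/(seqr n) /=.
have [k1 k2 k3 k4] := step1P h1 h2.
have h1' : subitv (step1 (seqr n)).1 I0 := subitv_trans k1 h1.
have h2' : subitv (step1 (seqr n)).2 J0 by rewrite k2.
have [l1 l2 l3 l4] := step2P h1' h2'.
split.
- by rewrite l2.
- by rewrite -k2.
- by rewrite l2.
- by rewrite l3 k2.
- by apply: le_trans k4 _; lra.
Qed.

(** After n rounds [|Phi|] has lost at most a factor 4^n, while the local bound is quadratic in the
    side lengths and shrinks by exactly 4^n; letting e be arbitrary forces zero. *)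
Lemma bisection_eq0 : Phi I0 J0 = 0.
Proof.
have [x Hx] : exists x, forall n, (seqr n).1.1 <= x <= (seqr n).1.2.
  apply: nested_intervals => n.
  - by have [[]] := seqrS n.
  - by have [[]] := seqrS n.
  - by have [[]] := seqrP n.
have [y Hy] : exists y, forall n, (seqr n).2.1 <= y <= (seqr n).2.2.
  apply: nested_intervals => n.
  - by have [_ []] := seqrS n.
  - by have [_ []] := seqrS n.
  - by have [_ []] := seqrP n.
pose L := I0.2 - I0.1 + (J0.2 - J0.1).
have len1 n : (seqr n).1.2 - (seqr n).1.1 = (I0.2 - I0.1) / 2 ^+ n.
  elim: n => [|n IH]; first by rewrite expr0 divr1.
  by have [_ _ -> _ _] := seqrS n; rewrite IH exprSr invfM mulrA.
have len2 n : (seqr n).2.2 - (seqr n).2.1 = (J0.2 - J0.1) / 2 ^+ n.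
  elim: n => [|n IH]; first by rewrite expr0 divr1.
  by have [_ _ _ -> _] := seqrS n; rewrite IH exprSr invfM mulrA.
have grow n : `|Phi I0 J0| <= 4 ^+ n * `|Phi (seqr n).1 (seqr n).2|.
  elim: n => [|n IH]; first by rewrite expr0 mul1r.
  apply: le_trans IH _; rewrite exprSr -mulrA ler_wpM2l ?exprn_ge0//.
  by have [] := seqrS n.
have dI0 : 0 <= I0.2 - I0.1 by rewrite subr_ge0.
have dJ0 : 0 <= J0.2 - J0.1 by rewrite subr_ge0.
have L0 : 0 <= L by rewrite addr_ge0.
apply/eqP; rewrite -normr_le0; apply/ler_addgt0Pl => e e0; rewrite addr0.
(* With [L] the half-perimeter, the final estimate is e L^2 / (L^2 + 1) <= e; the [+ 1] covers a
   degenerate rectangle. *)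
have eL : 0 < e / (L ^+ 2 + 1) by rewrite divr_gt0// ltr_wpDl ?exprn_ge0.
have [dl dl0 H] := Phi_local (Hx 0%N) (Hy 0%N) eL.
have [n Hn] : exists n, L / 2 ^+ n < dl.
  have /cvgrPdist_lt /(_ _ dl0) [n _ /(_ n (leqnn n))] :
      (L * (2^-1) ^+ n) @[n --> \oo] --> (L * 0 : R).
    by apply: cvgM; [exact: cvg_cst|apply: cvg_expr; rewrite ger0_norm//; lra].
  rewrite mulr0 sub0r normrN ger0_norm ?mulr_ge0 ?exprn_ge0 ?invr_ge0//= exprVn.
  by exists n.
apply: le_trans (grow n) _.
have p2 : 0 < (2 : R) ^+ n by rewrite exprn_gt0.
have [s1 s2] := seqrP n.
have := H _ _ s1 s2 (Hx n) (Hy n).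
rewrite len1 len2 -mulrDl -/L.
have l1 : (I0.2 - I0.1) / 2 ^+ n < dl.
  by apply: le_lt_trans Hn; rewrite ler_pM2r ?invr_gt0// lerDl.
have l2 : (J0.2 - J0.1) / 2 ^+ n < dl.
  by apply: le_lt_trans Hn; rewrite ler_pM2r ?invr_gt0// lerDr.
move=> /(_ l1 l2) K.
apply: le_trans (ler_wpM2l _ K) _; first by rewrite exprn_ge0.
rewrite expr_div_n -exprM mulnC exprM (_ : 2 ^+ 2 = 4 :> R); last by lra.
have -> : 4 ^+ n * (e / (L ^+ 2 + 1) * (L ^+ 2 / 4 ^+ n)) = e * (L ^+ 2 / (L ^+ 2 + 1)).
  by field; rewrite !gt_eqF// ltr_wpDl ?exprn_ge0.
rewrite ler_piMr ?(ltW e0)// ler_pdivrMr ?mul1r ?lerDl//.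
by rewrite ltr_wpDl ?exprn_ge0.
Qed.

End Bisection.

(** * Closed differential forms on a rectangle *)

Section Goursat.
Variable R : realType.
Implicit Types P Q : R -> R -> R.

Definition ldiff P (x0 y0 p1 p2 : R) := forall e : R, 0 < e ->
  exists2 dl : R, 0 < dl & forall x y, `|x - x0| < dl -> `|y - y0| < dl ->
    `|P x y - P x0 y0 - p1 * (x - x0) - p2 * (y - y0)| <= e * (`|x - x0| + `|y - y0|).

Lemma ldiff_cont1 P x0 y0 p1 p2 : ldiff P x0 y0 p1 p2 ->
  {for x0, continuous (fun x => P x y0)}.
Proof.
move=> /(_ 1 ltr01)[dl dl0 H]; apply/cvgrPdist_le => e e0.
have p0 : 0 < `|p1| + 1 by rewrite ltr_wpDl.
near=> x.
have xd : `|x - x0| < dl.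
  by rewrite distrC; near: x; apply/nbhs_ballP; exists dl.
have := H x y0 xd; rewrite subrr normr0 => /(_ dl0).
rewrite mulr0 subr0 mul1r addr0 => K; rewrite distrC.
have -> : P x y0 - P x0 y0 = (P x y0 - P x0 y0 - p1 * (x - x0)) + p1 * (x - x0) by lra.
apply: le_trans (ler_normD _ _) _; rewrite normrM.
apply: (@le_trans _ _ ((`|p1| + 1) * `|x - x0|)); first by lra.
rewrite -ler_pdivlMl// mulrC ltW//.
by rewrite distrC; near: x; apply/nbhs_ballP; exists (e / (`|p1| + 1)) => //=; rewrite divr_gt0.
Unshelve. all: end_near. Qed.

Lemma ldiff_swap P x0 y0 p1 p2 : ldiff P x0 y0 p1 p2 -> ldiff (fun y x => P x y) y0 x0 p2 p1.
Proof.
move=> H e /H[dl dl0 K]; exists dl => // x y xd yd.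
by have := K y x yd xd; rewrite [in leRHS]addrC -!addrA [X in _ + (_ + X)]addrC.
Qed.

Lemma itv_dist (u v z x : R) : u <= z <= v -> u <= x <= v -> `|z - x| <= v - u.
Proof. by move=> /andP[? ?] /andP[? ?]; rewrite ler_norml; apply/andP; split; lra. Qed.

(** The common [p2] makes P dx + Q dy closed at each point. Only pointwise differentiability is
    known, so bisection takes the place of Green's formula. *)
Lemma goursat P Q (a b c d : R) : a <= b -> c <= d ->
  (forall x y, a <= x <= b -> c <= y <= d ->
     exists p1 p2 q2, ldiff P x y p1 p2 /\ ldiff Q x y p2 q2) ->
  iint (fun x => P x c) a b - iint (fun x => P x d) a b +
  (iint (Q b) c d - iint (Q a) c d) = 0.
Proof.
move=> ab cd H.
(* The counterclockwise boundary integral of P dx + Q dy over I x J. *)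
pose Phi (I J : R * R) :=
  iint (fun x => P x J.1) I.1 I.2 - iint (fun x => P x J.2) I.1 I.2 +
  (iint (Q I.2) J.1 J.2 - iint (Q I.1) J.1 J.2).
have within_of (f : R -> R) (u v : R) :
    (forall x, u <= x <= v -> {for x, continuous f}) -> {within `[u, v], continuous f}.
  by move=> K; apply: continuous_in_subspaceT => x; rewrite inE /= in_itv /=; exact: K.
have cP y u v : c <= y <= d -> a <= u -> v <= b -> {within `[u, v], continuous (fun x => P x y)}.
  move=> hy hu hv; apply: within_of => x /andP[ux xv].
  have hx : a <= x <= b by rewrite (le_trans hu ux) (le_trans xv hv).
  by have [p1 [p2 [q2 [/ldiff_cont1]]]] := H x y hx hy.
have cQ x u v : a <= x <= b -> c <= u -> v <= d -> {within `[u, v], continuous (Q x)}.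
  move=> hx hu hv; apply: within_of => y /andP[uy yv].
  have hy : c <= y <= d by rewrite (le_trans hu uy) (le_trans yv hv).
  by have [p1 [p2 [q2 [_ /ldiff_swap/ldiff_cont1]]]] := H x y hx hy.
apply: (@bisection_eq0 R Phi (a, b) (c, d)) => //.
- move=> [u v] [s t] [/= h1 h2 h3] [/= k1 k2 k3]; rewrite /Phi /=.
  rewrite (@iint_split _ (fun x => P x s) u ((u + v) / 2) v); last 2 first.
  + by apply/andP; split; lra.
  + by apply: cP => //; lra.
  rewrite (@iint_split _ (fun x => P x t) u ((u + v) / 2) v); last 2 first.
  + by apply/andP; split; lra.
  + by apply: cP => //; lra.
  by ring.
- move=> [u v] [s t] [/= h1 h2 h3] [/= k1 k2 k3]; rewrite /Phi /=.
  rewrite (@iint_split _ (Q v) s ((s + t) / 2) t); last 2 first.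
  + by apply/andP; split; lra.
  + by apply: cQ => //; lra.
  rewrite (@iint_split _ (Q u) s ((s + t) / 2) t); last 2 first.
  + by apply/andP; split; lra.
  + by apply: cQ => //; lra.
  by ring.
move=> x y hx hy e e0.
have [p1 [p2 [q2 [HP HQ]]]] := H x y hx hy.
have e4 : 0 < e / 2 by lra.
have [d1 d10 K1] := HP _ e4.
have [d2 d20 K2] := HQ _ e4.
exists (Num.min d1 d2); first by rewrite lt_min d10.
move=> [u v] [s t] [/= h1 h2 h3] [/= k1 k2 k3] /andP[ux xv] /andP[sy yt].
rewrite !lt_min => /andP[uv1 uv2] /andP[st1 st2].
set L := v - u + (t - s).
have dx z : u <= z <= v -> `|z - x| <= v - u by move=> hz; apply: itv_dist => //; rewrite ux.
have dy z : s <= z <= t -> `|z - y| <= t - s by move=> hz; apply: itv_dist => //; rewrite sy.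
have us : u <= u <= v by rewrite lexx.
have vs : u <= v <= v by rewrite lexx andbT.
have ss : s <= s <= t by rewrite lexx.
have ts : s <= t <= t by rewrite lexx andbT.
have B1 z w : u <= z <= v -> s <= w <= t ->
    `|P z w - P x y - p1 * (z - x) - p2 * (w - y)| <= e / 2 * L.
  move=> hz hw; have := K1 z w (le_lt_trans (dx _ hz) uv1) (le_lt_trans (dy _ hw) st1).
  by move=> /le_trans; apply; rewrite ler_pM2l// lerD ?dx ?dy.
have B2 z w : u <= z <= v -> s <= w <= t ->
    `|Q z w - Q x y - p2 * (z - x) - q2 * (w - y)| <= e / 2 * L.
  move=> hz hw; have := K2 z w (le_lt_trans (dx _ hz) uv2) (le_lt_trans (dy _ hw) st2).
  by move=> /le_trans; apply; rewrite ler_pM2l// lerD ?dx ?dy.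
rewrite /Phi /=.
have hs : c <= s <= d by rewrite k1 (le_trans k2 k3).
have ht : c <= t <= d by rewrite (le_trans k1 k2) k3.
have hu : a <= u <= b by rewrite h1 (le_trans h2 h3).
have hv : a <= v <= b by rewrite (le_trans h1 h2) h3.
have cP1 := cP s u v hs h1 h3.
have cP2 := cP t u v ht h1 h3.
have cQ1 := cQ u s t hu k1 k3.
have cQ2 := cQ v s t hv k1 k3.
rewrite -iintB// -iintB//.
have cPB : {within `[u, v], continuous (fun z => P z s - P z t)}.
  by move=> z; apply: cvgB; [exact: cP1|exact: cP2].
have cQB : {within `[s, t], continuous (fun z => Q v z - Q u z)}.
  by move=> z; apply: cvgB; [exact: cQ2|exact: cQ1].
(* Between the bottom and top sides the terms in [p1] cancel and [p2 * (s - t)] remains; the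
   vertical sides give the opposite multiple of [p2]. Only the linearisation errors survive. *)
have I1 : `|iint (fun z => P z s - P z t) u v - p2 * (s - t) * (v - u)| <= e * L * (v - u).
  apply: iint_near => // z hz.
  rewrite [e]splitr mulrDl; apply: le_trans (lerD (B1 z s hz ss) (B1 z t hz ts)).
  by apply: le_trans (ler_normB _ _); rewrite le_eqVlt; apply/orP; left; apply/eqP; congr `|_|; ring.
have I2 : `|iint (fun z => Q v z - Q u z) s t - p2 * (v - u) * (t - s)| <= e * L * (t - s).
  apply: iint_near => // z hz.
  rewrite [e]splitr mulrDl; apply: le_trans (lerD (B2 v z vs hz) (B2 u z us hz)).
  by apply: le_trans (ler_normB _ _); rewrite le_eqVlt; apply/orP; left; apply/eqP; congr `|_|; ring.
move: I1 I2; set X := iint _ u v; set Y := iint _ s t => I1 I2.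
have -> : X + Y = (X - p2 * (s - t) * (v - u)) + (Y - p2 * (v - u) * (t - s)) by ring.
apply: le_trans (ler_normD _ _) _.
apply: le_trans (lerD I1 I2) _.
by rewrite -mulrDr -/L expr2 mulrA.
Qed.

End Goursat.

(** * Means over circles *)

Section CircleMean.
Variable R : realType.
Implicit Types (phi psi : R -> R[i]).

(** Phrased with [normc] so that it composes with [ccont]; [rccP] passes to real and imaginary
    parts, where the real theorems apply. *)
Definition rcc phi := forall t e : R, 0 < e -> exists2 dl : R, 0 < dl &
  forall s, `|s - t| < dl -> normc (phi s - phi t) <= e.

Lemma rccP phi : rcc phi <->
  continuous (fun t => complex.Re (phi t)) /\ continuous (fun t => complex.Im (phi t)).
Proof.
split=> [H|[H1 H2] t e e0].
  split=> t; apply/cvgrPdist_le => e e0; have [dl dl0 K] := H t e e0;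
    near=> s; have /K : `|s - t| < dl by
      rewrite distrC; near: s; apply/nbhs_ballP; exists dl.
    rewrite distrC; apply: le_trans.
    by apply: le_trans (abs_Re_le _); case: (phi s) (phi t) => a b [c d].
  rewrite distrC; apply: le_trans.
  by apply: le_trans (abs_Im_le _); case: (phi s) (phi t) => a b [c d].
have e2 : 0 < e / 2 by rewrite divr_gt0.
have /cvgrPdist_le /(_ _ e2) /nbhs_ballP [d1 /= d10 K1] := H1 t.
have /cvgrPdist_le /(_ _ e2) /nbhs_ballP [d2 /= d20 K2] := H2 t.
exists (Num.min d1 d2); first by rewrite lt_min d10.
move=> s; rewrite lt_min distrC => /andP[/K1 /= L1 /K2 /= L2].
apply: le_trans (normc_le_abs _) _; rewrite [e]splitr; apply: lerD.
  by rewrite distrC in L1; case: (phi s) (phi t) L1 => a b [c d].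
by rewrite distrC in L2; case: (phi s) (phi t) L2 => a b [c d].
Unshelve. all: end_near. Qed.

Lemma rcc_cst c : rcc (fun=> c).
Proof. by move=> t e e0; exists 1 => // s _; rewrite subrr normc0 ltW. Qed.

Lemma rccD phi psi : rcc phi -> rcc psi -> rcc (fun t => phi t + psi t).
Proof.
move=> /rccP[h1 h2] /rccP[k1 k2]; apply/rccP; split.
  have -> : (fun t => complex.Re (phi t + psi t)) =
            (fun t => complex.Re (phi t) + complex.Re (psi t)).
    by apply/funext => t; case: (phi t) (psi t) => a b [c d].
  by move=> t; apply: cvgD; [exact: h1|exact: k1].
have -> : (fun t => complex.Im (phi t + psi t)) =
          (fun t => complex.Im (phi t) + complex.Im (psi t)).
  by apply/funext => t; case: (phi t) (psi t) => a b [c d].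
by move=> t; apply: cvgD; [exact: h2|exact: k2].
Qed.

Lemma rccM phi psi : rcc phi -> rcc psi -> rcc (fun t => phi t * psi t).
Proof.
move=> /rccP[h1 h2] /rccP[k1 k2]; apply/rccP; split.
  have -> : (fun t => complex.Re (phi t * psi t)) = (fun t => complex.Re (phi t) *
      complex.Re (psi t) - complex.Im (phi t) * complex.Im (psi t)).
    by apply/funext => t; case: (phi t) (psi t) => a b [c d].
  by move=> t; apply: cvgB; apply: cvgM; [exact: h1|exact: k1|exact: h2|exact: k2].
have -> : (fun t => complex.Im (phi t * psi t)) = (fun t => complex.Re (phi t) *
      complex.Im (psi t) + complex.Im (phi t) * complex.Re (psi t)).
  by apply/funext => t; case: (phi t) (psi t) => a b [c d].
by move=> t; apply: cvgD; apply: cvgM; [exact: h1|exact: k2|exact: h2|exact: k1].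
Qed.

Lemma rccX phi n : rcc phi -> rcc (fun t => phi t ^+ n).
Proof.
move=> h; elim: n => [|n IH].
  by have := rcc_cst 1; congr rcc; apply/funext => t; rewrite expr0.
by have := rccM h IH; congr rcc; apply/funext => t; rewrite exprS.
Qed.

Lemma rcc_comp (f : R[i] -> R[i]) phi : (forall t, ccont f (phi t)) -> rcc phi ->
  rcc (f \o phi).
Proof.
move=> cf h t e e0; have [d1 d10 H1] := cf t e e0.
have d2 : 0 < d1 / 2 by rewrite divr_gt0.
have [dl dl0 H] := h t _ d2; exists dl => // s /H K.
by apply: H1; apply: le_lt_trans K _; rewrite ltr_pdivrMr// ltr_pMr// ltr1n.
Qed.

Lemma rccV phi : (forall t, phi t != 0) -> rcc phi -> rcc (fun t => (phi t)^-1).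
Proof.
move=> n0 h; apply: (rcc_comp (f := fun w => w^-1)) => // t.
by apply: cdiff_ccont; apply: cdiffV; [exact: n0|exact: cdiff_id].
Qed.

Lemma rcc_expi (k : R) : rcc (fun t => expi (k * t)).
Proof.
apply/rccP; split=> t; apply: continuous_comp.
- exact: mulrl_continuous.
- exact: continuous_cos.
- exact: mulrl_continuous.
- exact: continuous_sin.
Qed.

Lemma rcc_expi1 : rcc (fun t => expi t).
Proof. by have := rcc_expi 1; congr rcc; apply/funext => t; rewrite mul1r. Qed.

Lemma rcc_conj phi : rcc phi -> rcc (fun t => conjc (phi t)).
Proof.
move=> h t e e0; have [dl dl0 H] := h t e e0; exists dl => // s /H.
by rewrite -rmorphB normc_conj.
Qed.

Definition cmean phi : R[i] :=
  (((2 * pi)^-1 * iint (fun t => complex.Re (phi t)) 0 (2 * pi)) +i*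
   ((2 * pi)^-1 * iint (fun t => complex.Im (phi t)) 0 (2 * pi)))%C.

Arguments cmean : simpl never.

Lemma twopi_gt0 : 0 < 2 * pi :> R.
Proof. by rewrite mulr_gt0// pi_gt0. Qed.

Let twopi_ge0 : 0 <= 2 * pi :> R. Proof. exact/ltW/twopi_gt0. Qed.

Lemma eq_cmean phi psi : (forall t, 0 <= t <= 2 * pi -> phi t = psi t) -> cmean phi = cmean psi.
Proof.
by move=> H; congr ((_ * _) +i* (_ * _))%C; apply: eq_iint => t /H ->.
Qed.

Let rccRe phi : rcc phi -> {within `[0, 2 * pi], continuous (fun t => complex.Re (phi t))}.
Proof. by move=> /rccP[h _]; exact: continuous_subspaceT. Qed.

Let rccIm phi : rcc phi -> {within `[0, 2 * pi], continuous (fun t => complex.Im (phi t))}.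
Proof. by move=> /rccP[_ h]; exact: continuous_subspaceT. Qed.

Lemma cmeanD phi psi : rcc phi -> rcc psi ->
  cmean (fun t => phi t + psi t) = cmean phi + cmean psi.
Proof.
move=> h k; rewrite /cmean; apply/eqP; rewrite eq_complex /=; apply/andP; split; apply/eqP.
  rewrite -mulrDr -iintD; [|exact: rccRe|exact: rccRe].
  by congr (_ * _); apply: eq_iint => t _; case: (phi t) (psi t) => a b [c d].
rewrite -mulrDr -iintD; [|exact: rccIm|exact: rccIm].
by congr (_ * _); apply: eq_iint => t _; case: (phi t) (psi t) => a b [c d].
Qed.

Lemma cmeanZ c phi : rcc phi -> cmean (fun t => c * phi t) = c * cmean phi.
Proof.
case: c => a b h.
have wZ k f : {within `[0, 2 * pi], continuous f} ->
    {within `[(0 : R), 2 * pi], continuous (fun x => (k : R) * f x : R)}.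
  by move=> cf x; apply: cvgM; [exact: cvg_cst|exact: cf].
rewrite /cmean; apply/eqP; rewrite eq_complex /=; apply/andP; split; apply/eqP.
  rewrite !(mulrCA _ (2 * pi)^-1) -mulrBr -(iintZ a (rccRe h)) -(iintZ b (rccIm h)).
  rewrite -iintB; [|by apply: wZ; exact: rccRe|by apply: wZ; exact: rccIm].
  by congr (_ * _); apply: eq_iint => t _; case: (phi t).
rewrite !(mulrCA _ (2 * pi)^-1) -mulrDr -(iintZ a (rccIm h)) -(iintZ b (rccRe h)).
rewrite -iintD; [|by apply: wZ; exact: rccIm|by apply: wZ; exact: rccRe].
by congr (_ * _); apply: eq_iint => t _; case: (phi t).
Qed.

Lemma cmean_cst c : cmean (fun=> c) = c.
Proof.
rewrite /cmean !iint_cst// !subr0 !(mulrC _ (2 * pi)) !mulKf ?gt_eqF ?twopi_gt0//.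
by case: c.
Qed.

Lemma cmeanN phi : rcc phi -> cmean (fun t => - phi t) = - cmean phi.
Proof.
move=> h; rewrite -mulN1r -cmeanZ//; apply: eq_cmean => t _; by rewrite mulN1r.
Qed.

Lemma rccN phi : rcc phi -> rcc (fun t => - phi t).
Proof.
move=> h; have := rccM (rcc_cst (-1)) h; congr rcc; apply/funext => t; by rewrite mulN1r.
Qed.

Lemma rccB phi psi : rcc phi -> rcc psi -> rcc (fun t => phi t - psi t).
Proof. by move=> h k; exact: rccD h (rccN k). Qed.

Lemma cmeanB phi psi : rcc phi -> rcc psi ->
  cmean (fun t => phi t - psi t) = cmean phi - cmean psi.
Proof. by move=> h k; rewrite cmeanD ?cmeanN//; exact: rccN. Qed.

Lemma rcc_sum n (phi : nat -> R -> R[i]) : (forall k, rcc (phi k)) ->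
  rcc (fun t => \sum_(k < n) phi k t).
Proof.
move=> h; elim: n => [|n IH].
  by have := rcc_cst 0; congr rcc; apply/funext => t; rewrite big_ord0.
by have := rccD IH (h n); congr rcc; apply/funext => t; rewrite big_ord_recr.
Qed.

Lemma cmean_sum n (phi : nat -> R -> R[i]) : (forall k, rcc (phi k)) ->
  cmean (fun t => \sum_(k < n) phi k t) = \sum_(k < n) cmean (phi k).
Proof.
move=> h; elim: n => [|n IH].
  by rewrite big_ord0 -[RHS]cmean_cst; apply: eq_cmean => t _; rewrite big_ord0.
rewrite big_ord_recr /= -IH -cmeanD//; last exact: rcc_sum.
by apply: eq_cmean => t _; rewrite big_ord_recr.
Qed.

(** The factor 2 comes from bounding real and imaginary parts separately; it is harmless because the
    bound only feeds limits and constants of error terms. *)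
Lemma cmean_bound phi (M : R) : rcc phi -> (forall t, 0 <= t <= 2 * pi -> normc (phi t) <= M) ->
  normc (cmean phi) <= 2 * M.
Proof.
move=> h H; apply: le_trans (normc_le_abs _) _; rewrite mulrDl mul1r /cmean /=.
have tp := twopi_gt0.
apply: lerD; rewrite normrM gtr0_norm ?invr_gt0// ler_pdivrMl// [leRHS]mulrC.
  have := @iint_near R _ 0 (2 * pi) 0 M twopi_ge0 (rccRe h).
  rewrite mul0r !subr0; apply => t /H; apply: le_trans; rewrite subr0.
  exact: abs_Re_le.
have := @iint_near R _ 0 (2 * pi) 0 M twopi_ge0 (rccIm h).
rewrite mul0r !subr0; apply => t /H; apply: le_trans; rewrite subr0.
exact: abs_Im_le.
Qed.

Lemma rcc_bounded phi : rcc phi ->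
  exists2 M, 0 <= M & forall t, 0 <= t <= 2 * pi -> normc (phi t) <= M.
Proof.
move=> h.
have cn : continuous (fun t => normc (phi t)).
  move=> t; apply/cvgrPdist_le => e e0; have [dl dl0 K] := h t e e0.
  near=> s; have /K : `|s - t| < dl by
      rewrite distrC; near: s; apply/nbhs_ballP; exists dl.
  apply: le_trans; rewrite ler_norml; apply/andP; split.
    by have := ler_normcB (phi s) (phi t); lra.
  by have := ler_normcB (phi t) (phi s); rewrite normcB.
have [c _ Hc] := EVT_max twopi_ge0 (continuous_subspaceT cn).
exists (normc (phi c)); first exact: normc_ge0.
by move=> t ht; apply: Hc; rewrite in_itv.
Unshelve. all: end_near. Qed.

(** [k] is real, so that differences of natural numbers of either sign are covered at once; the
    primitives are sin(kt) / k and -cos(kt) / k. *)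
Lemma cmean_expi (k : R) : k != 0 -> expi (k * (2 * pi)) = 1 ->
  cmean (fun t => expi (k * t)) = 0.
Proof.
move=> k0 [c1 s1].
have dk (x : R) : is_derive x (1 : R) (fun t => k * t) k.
  by apply: is_derive_eq; rewrite -[_ *: _]/(_ * _) mulr1.
have cosI : iint (fun t => cos (k * t)) 0 (2 * pi) = 0.
  pose F t := k^-1 * sin (k * t).
  have dF (x : R) : is_derive x (1 : R) F (cos (k * x)).
    have := dk x => dkx.
    rewrite /F; apply: is_derive_eq.
    by rewrite -![_ *: _]/(_ * _) mulrC mulfK.
  rewrite /iint /Rintegral (@continuous_FTC2 R _ F) ?twopi_gt0//.
  - by rewrite /F mulr0 sin0 s1 !mulr0 -EFinB subrr.
  - apply: continuous_subspaceT => t; apply: continuous_comp; last exact: continuous_cos.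
    exact: mulrl_continuous.
  - split.
    + by move=> x _; have [] := dF x.
    + by apply: cvg_at_right_filter; apply: differentiable_continuous;
        apply/derivable1_diffP; have [] := dF 0.
    + by apply: cvg_at_left_filter; apply: differentiable_continuous;
        apply/derivable1_diffP; have [] := dF (2 * pi).
  - by move=> x _; rewrite derive1E; have [_ ->] := dF x.
have sinI : iint (fun t => sin (k * t)) 0 (2 * pi) = 0.
  pose F t := - k^-1 * cos (k * t).
  have dF (x : R) : is_derive x (1 : R) F (sin (k * x)).
    have := dk x => dkx.
    rewrite /F; apply: is_derive_eq.
    by rewrite -![_ *: _]/(_ * _) mulNr mulNr mulrN opprK mulrC mulfK.
  rewrite /iint /Rintegral (@continuous_FTC2 R _ F) ?twopi_gt0//.
  - by rewrite /F mulr0 cos0 c1 -EFinB subrr.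
  - apply: continuous_subspaceT => t; apply: continuous_comp; last exact: continuous_sin.
    exact: mulrl_continuous.
  - split.
    + by move=> x _; have [] := dF x.
    + by apply: cvg_at_right_filter; apply: differentiable_continuous;
        apply/derivable1_diffP; have [] := dF 0.
    + by apply: cvg_at_left_filter; apply: differentiable_continuous;
        apply/derivable1_diffP; have [] := dF (2 * pi).
  - by move=> x _; rewrite derive1E; have [_ ->] := dF x.
by rewrite /cmean /= cosI sinI !mulr0.
Qed.

Lemma expi_nat2pi (n : nat) : expi (n%:R * (2 * pi) : R) = 1.
Proof.
elim: n => [|n IH]; first by rewrite mul0r expi0.
rewrite -natr1 mulrDl mul1r expiD IH mul1r /expi.
have -> : 2 * pi = pi + pi :> R by lra.
by rewrite cosD sinD cospi sinpi !mulr0 !mul0r addr0 subr0 mulrNN mulr1.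
Qed.

Lemma expiV (t : R) : (expi t)^-1 = expi (- t).
Proof.
apply: (mulfI (expi_neq0 t)).
by rewrite mulfV ?expi_neq0// -expiD subrr expi0.
Qed.

Lemma conj_expi (t : R) : conjc (expi t) = expi (- t).
Proof. by rewrite /expi /= cosN sinN. Qed.

Lemma expiX (t : R) n : expi t ^+ n = expi (n%:R * t).
Proof.
elim: n => [|n IH]; first by rewrite expr0 mul0r expi0.
by rewrite exprS IH -expiD -natr1 mulrDl mul1r addrC.
Qed.

Lemma cmean_expi_orth (k l : nat) :
  cmean (fun t => expi t ^+ k * conjc (expi t ^+ l)) = (k == l)%:R.
Proof.
have E t : expi t ^+ k * conjc (expi t ^+ l) = expi ((k%:R - l%:R) * t) :> R[i].
  by rewrite !expiX conj_expi -expiD mulrBl.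
rewrite (eq_cmean (fun t _ => E t)).
have [->|kl] := eqVneq k l.
  by rewrite -[RHS]cmean_cst; apply: eq_cmean => t _; rewrite subrr mul0r expi0.
apply: cmean_expi; first by rewrite subr_eq0 eqr_nat.
by rewrite mulrBl expiD -expiV !expi_nat2pi invr1 mulr1.
Qed.

End CircleMean.

Arguments cmean : simpl never.

(** * Goursat's theorem in logarithmic coordinates *)

Section PolarGoursat.
Variable R : realType.
Implicit Types (q f : R[i] -> R[i]) (G : R -> R -> R[i]).

Lemma is_derive_approx (g : R -> R) (x d : R) : is_derive x (1 : R) g d ->
  forall e, 0 < e -> exists2 dl, 0 < dl &
    forall h, `|h| < dl -> `|g (x + h) - g x - d * h| <= e * `|h|.
Proof.
move=> [dg <-] e e0.
move: dg; rewrite /derivable /derive => /cvgrPdist_le /(_ _ e0).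
rewrite near_withinE => /nbhs_ballP[r /= r0 Hr].
exists r => // h hr.
have [->|h0] := eqVneq h 0; first by rewrite addr0 subrr mulr0 subr0 normr0 mulr0.
have := Hr h; rewrite /ball /= sub0r normrN => /(_ hr h0) H.
rewrite -ler_pdivrMr ?normr_gt0// -normfV -normrM.
apply: le_trans H; rewrite distrC le_eqVlt; apply/orP; left; apply/eqP; congr `|_|.
set L := lim _.
rewrite -![_ *: _]/(_ * _) mulr1 [h + x]addrC !mulrBl mulfK//.
by rewrite !(mulrC h^-1) mulrBl.
Qed.

Definition cexp (x y : R) : R[i] := (expR x)%:C%C * expi y.

Lemma cexpD x y s t : cexp (x + s) (y + t) = cexp x y * cexp s t.
Proof. by rewrite /cexp expRD expiD rmorphM /= mulrACA. Qed.

Lemma normc_cexp x y : normc (cexp x y) = expR x.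
Proof. by rewrite /cexp normcM normc_expi mulr1 normcC ger0_norm// expR_ge0. Qed.

Lemma cexp_ln rho y : 0 < rho -> cexp (ln rho) y = rho%:C%C * expi y.
Proof. by move=> r0; rewrite /cexp lnK. Qed.

(** Real differentiability in two variables whose linear part is multiplication by [d]. The
    Cauchy-Riemann equations are thereby built in; [cldiff_Re] and [cldiff_Im] read them off. *)
Definition cldiff G (x0 y0 : R) (d : R[i]) := forall e : R, 0 < e ->
  exists2 dl : R, 0 < dl & forall x y, `|x - x0| < dl -> `|y - y0| < dl ->
    normc (G x y - G x0 y0 - d * ((x - x0) +i* (y - y0))%C) <= e * (`|x - x0| + `|y - y0|).

Lemma cldiff_Re G x y d : cldiff G x y d ->
  ldiff (fun x y => complex.Re (G x y)) x y (complex.Re d) (- complex.Im d).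
Proof.
move=> H e /H[dl dl0 K]; exists dl => // s t hs ht.
apply: le_trans (K s t hs ht); apply: le_trans (abs_Re_le _).
rewrite le_eqVlt; apply/orP; left; apply/eqP.
by congr `|_|; case: (G s t) (G x y) (d) => [a b] [a' b'] [c c'] /=; ring.
Qed.

Lemma cldiff_Im G x y d : cldiff G x y d ->
  ldiff (fun x y => complex.Im (G x y)) x y (complex.Im d) (complex.Re d).
Proof.
move=> H e /H[dl dl0 K]; exists dl => // s t hs ht.
apply: le_trans (K s t hs ht); apply: le_trans (abs_Im_le _).
rewrite le_eqVlt; apply/orP; left; apply/eqP.
by congr `|_|; case: (G s t) (G x y) (d) => [a b] [a' b'] [c c'] /=; ring.
Qed.

Lemma ldiffN (P : R -> R -> R) x y p1 p2 : ldiff P x y p1 p2 ->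
  ldiff (fun x y => - P x y) x y (- p1) (- p2).
Proof.
move=> H e /H[dl dl0 K]; exists dl => // s t hs ht.
apply: le_trans (K s t hs ht); rewrite -normrN le_eqVlt; apply/orP; left; apply/eqP.
by congr `|_|; ring.
Qed.

Lemma cexp_diff0 (e : R) : 0 < e -> exists2 dl, 0 < dl & forall s t, `|s| < dl -> `|t| < dl ->
  normc (cexp s t - 1 - (s +i* t)%C) <= e * (`|s| + `|t|).
Proof.
move=> e0; pose e1 := e / 8; have e10 : 0 < e1 by rewrite divr_gt0.
have [d1 d10 H1] := is_derive_approx (is_derive_expR (0 : R)) e10.
have [d2 d20 H2] := is_derive_approx (is_derive_cos (0 : R)) e10.
have [d3 d30 H3] := is_derive_approx (is_derive_sin (0 : R)) e10.
have p1 : 0 < 1 + e1 by rewrite addr_gt0.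
(* Besides the three derivatives at 0, this makes |exp s - 1| at most e / 2 and at most 1, hence exp
   s <= 2. *)
exists (Num.min (Num.min d1 (Num.min d2 d3)) (Num.min (e / 2 / (1 + e1)) (1 / (1 + e1)))).
  by rewrite !lt_min d10 d20 d30 !divr_gt0.
move=> s t; rewrite !lt_min => /andP[/and3P[s1 _ _] /andP[s4 s5]] /andP[/and3P[_ t2 t3] _].
have {H1} := H1 s s1; rewrite add0r expR0 mul1r => H1.
have {H2} := H2 t t2; rewrite add0r cos0 sin0 oppr0 mul0r subr0 => H2.
have {H3} := H3 t t3; rewrite add0r sin0 cos0 mul1r subr0 => H3.
have K1 : `|expR s - 1| <= (1 + e1) * `|s|.
  by rewrite -(subrK s (expR s - 1)) (le_trans (ler_normD _ _))// mulrDl mul1r addrC lerD2l.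
have K2 : `|expR s - 1| <= e / 2.
  by apply: le_trans K1 _; rewrite -ler_pdivlMl// mulrC ltW.
have K3 : expR s <= 2.
  have : `|expR s - 1| <= 1 by apply: le_trans K1 _; rewrite -ler_pdivlMl// mulrC ltW.
  by rewrite ler_norml => /andP[]; lra.
have -> : cexp s t - 1 - (s +i* t)%C = (expR s - 1 - s)%:C%C +
    ((expR s)%:C%C * (expi t - 1 - (0 +i* t)%C) + (expR s - 1)%:C%C * (0 +i* t)%C).
  by apply/eqP; rewrite eq_complex /=; apply/andP; split; apply/eqP; ring.
apply: le_trans (le_normcD _ _) _.
rewrite [leRHS]mulrDr; apply: lerD.
  by rewrite normcC; apply: le_trans H1 _; rewrite ler_wpM2r// /e1; lra.
apply: le_trans (le_normcD _ _) _; rewrite [e in leRHS]splitr [leRHS]mulrDl; apply: lerD; last first.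
  rewrite normcM normcC ler_pM ?normc_ge0//.
  by rewrite normcE_sqrt /cabs2 /= expr0n add0r sqrtr_sqr.
rewrite normcM normcC ger0_norm ?expR_ge0//.
have K4 : normc (expi t - 1 - (0 +i* t)%C) <= e / 4 * `|t|.
  apply: le_trans (normc_le_abs _) _; rewrite /= subr0 subr0.
  by apply: le_trans (lerD H2 H3) _; rewrite -mulrDl ler_wpM2r// /e1; lra.
apply: le_trans (ler_pM _ _ K3 K4) _; rewrite ?expR_ge0 ?normc_ge0//.
by rewrite mulrA ler_wpM2r//; lra.
Qed.

(** The law exp(w + h) = exp(w) exp(h) carries the estimate at the origin to every point. *)
Lemma cldiff_cexp x y : cldiff cexp x y (cexp x y).
Proof.
move=> e e0; have e1 : 0 < e / expR x by rewrite divr_gt0// expR_gt0.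
have [dl dl0 H] := cexp_diff0 e1; exists dl => // s t hs ht.
rewrite -{1}(subrK x s) -{1}(subrK y t) [s - x + x]addrC [t - y + y]addrC cexpD.
rewrite -{2}(mulr1 (cexp x y)) -!mulrBr normcM normc_cexp.
by rewrite -ler_pdivlMl ?expR_gt0// mulrA [_^-1 * e]mulrC; exact: H.
Qed.

Lemma cldiff_lip G x0 y0 d : cldiff G x0 y0 d ->
  exists2 dl : R, 0 < dl & forall x y, `|x - x0| < dl -> `|y - y0| < dl ->
    normc (G x y - G x0 y0) <= (normc d + 1) * (`|x - x0| + `|y - y0|).
Proof.
move=> /(_ 1 ltr01)[dl dl0 H]; exists dl => // x y hx hy.
have := H x y hx hy; rewrite mul1r => {}H.
rewrite -(subrK (d * ((x - x0) +i* (y - y0))%C) (G x y - G x0 y0)).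
apply: le_trans (le_normcD _ _) _.
rewrite normcM mulrDl mul1r addrC lerD// ler_wpM2l ?normc_ge0//.
exact: normc_le_abs.
Qed.

Lemma cldiff_comp q G x0 y0 d b : cldiff G x0 y0 d -> cdiff q (G x0 y0) b ->
  cldiff (fun x y => q (G x y)) x0 y0 (b * d).
Proof.
move=> Hf Hg e e0.
have [d1 d10 H1] := cldiff_lip Hf.
have a0 : 0 < normc d + 1 by rewrite ltr_wpDl// normc_ge0.
have b0 : 0 < normc b + 1 by rewrite ltr_wpDl// normc_ge0.
have e1 : 0 < e / 2 / (normc d + 1) by rewrite !divr_gt0.
have e2 : 0 < e / 2 / (normc b + 1) by rewrite !divr_gt0.
have [d2 d20 H2] := Hg _ e1.
have [d3 d30 H3] := Hf _ e2.
exists (Num.min d1 (Num.min d3 (d2 / (normc d + 1) / 2))).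
  by rewrite !lt_min d10 d30 !divr_gt0.
move=> x y; rewrite !lt_min => /and3P[x1 x3 x2] /and3P[y1 y3 y2].
have K1 := H1 _ _ x1 y1.
have K2 : normc (G x y - G x0 y0) < d2.
  apply: le_lt_trans K1 _; rewrite -ltr_pdivlMl// mulrC.
  by rewrite [ltRHS]splitr ltrD.
have {}K2 := H2 _ K2; rewrite (addrC (G x0 y0)) subrK in K2.
have K3 := H3 _ _ x3 y3.
set h := ((x - x0) +i* (y - y0))%C in K3 *.
rewrite (_ : _ - _ - _ = (q (G x y) - q (G x0 y0) - b * (G x y - G x0 y0))
  + b * (G x y - G x0 y0 - d * h)); last by ring.
apply: le_trans (le_normcD _ _) _; rewrite normcM.
rewrite [e]splitr mulrDl lerD//.
  apply: le_trans K2 _; apply: le_trans (ler_wpM2l _ K1) _; first exact: ltW.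
  by rewrite mulrA divfK// gt_eqF.
apply: le_trans (ler_wpM2l _ K3) _; first exact: normc_ge0.
rewrite mulrA ler_wpM2r ?addr_ge0//.
rewrite mulrCA ler_piMr ?divr_ge0 ?ltW//.
by rewrite ltr_pdivrMr// mul1r ltrDl.
Qed.

Definition circ (rho t : R) : R[i] := rho%:C%C * expi t.

Lemma normc_circ rho t : 0 <= rho -> normc (circ rho t) = rho.
Proof. by move=> r0; rewrite normcM normc_expi mulr1 normcC ger0_norm. Qed.

Lemma circ_neq0 rho t : 0 < rho -> circ rho t != 0.
Proof. by move=> r0; rewrite -normc_gt0 normc_circ// ltW. Qed.

Lemma rcc_circ rho : rcc (circ rho).
Proof.
apply: rccM; first exact: rcc_cst.
exact: rcc_expi1.
Qed.

(* In the coordinate [log w] circles become vertical segments, and by periodicity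
   the horizontal sides of the rectangle cancel. *)
Lemma cmean_circ_const q (r1 r2 : R) : 0 < r1 -> r1 <= r2 ->
  (forall w, r1 <= normc w <= r2 -> cdiffx q w) ->
  cmean (fun t => q (circ r1 t)) = cmean (fun t => q (circ r2 t)).
Proof.
move=> r10 r12 H; have r20 : 0 < r2 by apply: lt_le_trans r12.
pose G x y := q (cexp x y).
have ab : ln r1 <= ln r2 by rewrite ler_ln.
have cd : 0 <= 2 * pi :> R by rewrite ltW// twopi_gt0.
have HG x y : ln r1 <= x <= ln r2 -> 0 <= y <= 2 * pi -> exists d, cldiff G x y d.
  move=> /andP[hx1 hx2] _.
  have [|d Hd] := H (cexp x y).
    by rewrite normc_cexp -(lnK r10) -(lnK r20) !ler_expR hx1.
  by exists (d * cexp x y); apply: cldiff_comp => //; exact: cldiff_cexp.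
have per x : G x (2 * pi) = G x 0.
  by have := expi_nat2pi R 1; rewrite mul1r /G /cexp => ->; rewrite expi0.
(* The form G (dx + i dy) has imaginary part Im G dx + Re G dy, used here for the mean of Re G; its
   real part with the sign reversed gives the mean of Im G below. *)
have I1 : iint (fun y => complex.Re (G (ln r2) y)) 0 (2 * pi) =
          iint (fun y => complex.Re (G (ln r1) y)) 0 (2 * pi).
  have := @goursat R (fun x y => complex.Im (G x y)) (fun x y => complex.Re (G x y)) _ _ _ _ ab cd.
  rewrite (eq_iint (g := fun x => complex.Im (G x (2 * pi)))) => [|x _]; last by rewrite per.
  rewrite subrr add0r => K; apply: subr0_eq; apply: K => x y hx hy.
  have [d Hd] := HG x y hx hy.
  by exists (complex.Im d), (complex.Re d), (- complex.Im d); split;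
    [exact: cldiff_Im|exact: cldiff_Re].
have I2 : iint (fun y => complex.Im (G (ln r2) y)) 0 (2 * pi) =
          iint (fun y => complex.Im (G (ln r1) y)) 0 (2 * pi).
  have := @goursat R (fun x y => - complex.Re (G x y)) (fun x y => complex.Im (G x y)) _ _ _ _ ab cd.
  rewrite (eq_iint (g := fun x => - complex.Re (G x (2 * pi)))) => [|x _]; last by rewrite per.
  rewrite subrr add0r => K; apply: subr0_eq; apply: K => x y hx hy.
  have [d Hd] := HG x y hx hy.
  exists (- complex.Re d), (complex.Im d), (complex.Re d); split; last exact: cldiff_Im.
  rewrite -[complex.Im d]opprK; exact: ldiffN (cldiff_Re Hd).
rewrite /cmean; congr ((_ * _) +i* (_ * _))%C.
  rewrite (eq_iint (g := fun y => complex.Re (G (ln r1) y))); last by move=> t _; rewrite /G cexp_ln.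
  by rewrite -I1; apply: eq_iint => t _; rewrite /G cexp_ln.
rewrite (eq_iint (g := fun y => complex.Im (G (ln r1) y))); last by move=> t _; rewrite /G cexp_ln.
by rewrite -I2; apply: eq_iint => t _; rewrite /G cexp_ln.
Qed.

(** Compactness of [0, 2 pi] turns continuity at each point of one circle into uniform closeness on
    neighbouring circles, which the mean inherits. *)
Lemma cmean_circ_continuous q (r0 : R) : 0 < r0 -> (forall t, ccont q (circ r0 t)) ->
  (forall r : R, 0 < r < 1 -> rcc (fun t => q (circ r t))) -> r0 < 1 ->
  forall e : R, 0 < e -> exists2 dl : R, 0 < dl & forall r : R, 0 < r < 1 -> `|r - r0| < dl ->
    normc (cmean (fun t => q (circ r t)) - cmean (fun t => q (circ r0 t))) <= e.
Proof.
move=> r00 cq rq r01 e e0.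
have /compact_near_coveringP cpt := @segment_compact R 0 (2 * pi).
pose P (r t : R) := normc (q (circ r t) - q (circ r0 t)) <= e / 2.
have : \near r0, `[0, 2 * pi] `<=` P r0.
  apply: (cpt R (nbhs r0) P) => t0 _.
  have e4 : 0 < e / 4 by rewrite divr_gt0.
  have [dl dl0 H] := cq t0 _ e4.
  have d4 : 0 < dl / 4 by rewrite divr_gt0.
  have [d1 d10 H1] := @rcc_circ r0 t0 _ d4.
  near=> t r => /=.
  have t1 : `|t - t0| < d1 by rewrite distrC; near: t; apply/nbhs_ballP; exists d1.
  have rr : `|r - r0| < dl / 4 by rewrite distrC; near: r; apply/nbhs_ballP; exists (dl / 4).
  have K1 := H1 _ t1.
  have K2 : normc (q (circ r0 t) - q (circ r0 t0)) <= e / 4.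
    by apply: H; apply: le_lt_trans K1 _; lra.
  have K3 : normc (q (circ r t) - q (circ r0 t0)) <= e / 4.
    apply: H; rewrite -(subrK (circ r0 t) (circ r t)) -addrA.
    apply: le_lt_trans (le_normcD _ _) _.
    rewrite -mulrBl normcM normc_expi mulr1 -rmorphB normcC; lra.
  rewrite /P (_ : _ - _ = (q (circ r t) - q (circ r0 t0)) - (q (circ r0 t) - q (circ r0 t0))); last by ring.
  by apply: le_trans (le_normcD _ _) _; rewrite normcN; lra.
move=> /nbhs_ballP[dl /= dl0 H]; exists dl => // r hr rr.
have r0I : 0 < r0 < 1 by rewrite r00.
rewrite -cmeanB; [|exact: rq|exact: rq].
have -> : e = 2 * (e / 2) by lra.
apply: cmean_bound; first by apply: rccB; exact: rq.
by move=> t ht; apply: (H r); [rewrite /ball /= distrC|rewrite /= in_itv].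
Unshelve. all: end_near. Qed.

Lemma ccontM f g w : ccont f w -> ccont g w -> ccont (fun w => f w * g w) w.
Proof.
move=> hf hg e e0.
have a0 : 0 < normc (f w) + 1 by rewrite ltr_wpDl// normc_ge0.
have b0 : 0 < normc (g w) + 1 by rewrite ltr_wpDl// normc_ge0.
have e1 : 0 < Num.min 1 (e / 2 / (normc (g w) + 1)) by rewrite lt_min ltr01 !divr_gt0.
have e2 : 0 < e / 2 / (normc (f w) + 1) by rewrite !divr_gt0.
have [d1 d10 H1] := hf _ e1; have [d2 d20 H2] := hg _ e2.
exists (Num.min d1 d2); first by rewrite lt_min d10.
move=> v; rewrite lt_min => /andP[/H1 + /H2 K2].
rewrite le_min => /andP[K0 K1].
have K3 : normc (f v) <= normc (f w) + 1 by have := ler_normcB (f v) (f w); lra.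
rewrite (_ : _ - _ = f v * (g v - g w) + (f v - f w) * g w); last by ring.
apply: le_trans (le_normcD _ _) _; rewrite !normcM [e]splitr; apply: lerD.
  apply: le_trans (ler_pM _ _ K3 K2) _; rewrite ?normc_ge0//.
  by rewrite mulrC divfK// gt_eqF.
apply: le_trans (ler_wpM2r _ K1) _; first exact: normc_ge0.
by rewrite mulrAC ler_pdivrMr// ler_pM2l ?divr_gt0// lerDl.
Qed.

Lemma ccont_id (w : R[i]) : ccont id w.
Proof. exact: cdiff_ccont (cdiff_id w). Qed.

(* An isolated point of mere continuity does no harm: the mean is constant on each side of
   the circle through [z], continuous across it, and small on small circles. *)
Lemma cmean_circ_eq0 q z : (forall w, normc w < 1 -> ccont q w) ->
  (forall w, normc w < 1 -> w != z -> cdiffx q w) ->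
  forall rho : R, 0 < rho < 1 -> cmean (fun t => q (circ rho t) * circ rho t) = 0.
Proof.
move=> cq dq.
(* In the coordinate log w the form q(w) dw becomes q(w) w d(log w), so [J] is the contour integral
   of q divided by 2 pi i; the factor w also makes it small on small circles. *)
pose p w := q w * w; pose J rho := cmean (fun t => p (circ rho t)).
have cp w : normc w < 1 -> ccont p w.
  by move=> hw; apply: ccontM; [exact: cq|exact: ccont_id].
have dp w : normc w < 1 -> w != z -> cdiffx p w.
  by move=> hw hz; have [d Hd] := dq w hw hz; exists (q w * 1 + w * d);
     apply: cdiffM => //; exact: cdiff_id.
have rp (r : R) : 0 < r < 1 -> rcc (fun t => p (circ r t)).
  move=> /andP[r0 r1]; apply: (rcc_comp (f := p)); last exact: rcc_circ.
  by move=> t; apply: cp; rewrite normc_circ// ltW.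
have small (e : R) : 0 < e -> exists2 dl : R, 0 < dl & forall r : R, 0 < r < dl -> normc (J r) <= e.
  move=> e0; have n0 : normc (0 : R[i]) < 1 by rewrite normc0.
  have [dl dl0 H] := cq 0 n0 1 ltr01.
  have M0 : 0 < normc (q 0) + 1 by rewrite ltr_wpDl// normc_ge0.
  exists (Num.min (Num.min 1 dl) (e / 2 / (normc (q 0) + 1))).
    by rewrite !lt_min ltr01 dl0 !divr_gt0.
  move=> r; rewrite !lt_min => /and3P[r0 /andP[r1 rd] re].
  have -> : e = 2 * (e / 2) by lra.
  apply: cmean_bound; first by apply: rp; rewrite r0.
  move=> t _; rewrite normcM normc_circ ?(ltW r0)//.
  have K : normc (q (circ r t)) <= normc (q 0) + 1.
    have := H (circ r t); rewrite subr0 normc_circ ?(ltW r0)// => /(_ rd).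
    by have := ler_normcB (q (circ r t)) (q 0); lra.
  apply: le_trans (ler_wpM2r (ltW r0) K) _.
  by rewrite mulrC -ler_pdivlMr// ltW.
have const (r1 r2 : R) : 0 < r1 -> r1 <= r2 -> r2 < 1 -> (normc z < r1 \/ r2 < normc z) -> J r1 = J r2.
  move=> r10 r12 r21 hz; apply: cmean_circ_const => // w /andP[w1 w2].
  apply: dp; first exact: le_lt_trans r21.
  by apply/eqP => wz; move: w1 w2; rewrite wz; case: hz; lra.
have normJ0 (r : R) : (forall e : R, 0 < e -> normc (J r) <= e) -> J r = 0.
  move=> H; apply/eqP; rewrite -normc_eq0 eq_le normc_ge0 andbT.
  by apply/ler_addgt0Pl => e e0; rewrite addr0; exact: H.
have below (r : R) : 0 < r < 1 -> (r < normc z \/ z = 0) -> J r = 0.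
  move=> /andP[r0 r1] hz; apply: normJ0 => e e0.
  have [dl dl0 H] := small e e0.
  pose s := Num.min r (dl / 2).
  have s0 : 0 < s by rewrite lt_min r0 divr_gt0.
  have sr : s <= r by rewrite ge_min lexx.
  have sd : s < dl by rewrite gt_min; apply/orP; right; lra.
  rewrite -(const s r)//; first by apply: H; rewrite s0.
  by case: hz => [?|->]; [right|left; rewrite normc0].
have [z0|z0] := eqVneq z 0; first by move=> r hr; apply: below => //; right.
have nz : 0 < normc z by rewrite normc_gt0.
(* The circle through z is approached from inside, where the mean is already known to vanish. *)
have at_z : normc z < 1 -> J (normc z) = 0.
  move=> z1; apply: normJ0 => e e0.
  have [|dl dl0 H] := @cmean_circ_continuous p (normc z) nz _ rp z1 e e0.
    by move=> t; apply: cp; rewrite normc_circ// normc_ge0.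
  pose s := Num.max (normc z / 2) (normc z - dl / 2).
  have s0 : 0 < s by rewrite lt_max; apply/orP; left; lra.
  have sz : s < normc z by rewrite gt_max; apply/andP; split; lra.
  have sd : `|s - normc z| < dl.
    rewrite ltr_norml; apply/andP; split; last by lra.
    have : normc z - dl / 2 <= s by rewrite le_max lexx orbT.
    by lra.
  have s01 : 0 < s < 1 by rewrite s0 (lt_trans sz z1).
  have Js : J s = 0 by apply: below => //; left.
  by have := H s s01 sd; rewrite -/(J s) -/(J (normc z)) Js sub0r normcN.
move=> r /andP[r0 r1].
have [rz|zr|rz] := ltgtP r (normc z).
- by apply: below; [rewrite r0|left].
- apply: (normJ0 r) => e e0.
  have z1 : normc z < 1 by lra.
  have [|dl dl0 H] := @cmean_circ_continuous p (normc z) nz _ rp z1 e e0.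
    by move=> t; apply: cp; rewrite normc_circ// normc_ge0.
  (* Outside the circle through z, the mean at radius r is moved down to a radius close enough to
     |z|. *)
  pose s := Num.min r (normc z + dl / 2).
  have s0 : normc z < s by rewrite lt_min zr; lra.
  have sr : s <= r by rewrite ge_min lexx.
  have sd : `|s - normc z| < dl.
    rewrite ltr_norml; apply/andP; split; first by lra.
    have : s <= normc z + dl / 2 by rewrite ge_min lexx orbT.
    by lra.
  have s01 : 0 < s < 1 by rewrite (lt_trans nz s0) (le_lt_trans sr r1).
  have Js : J s = J r by apply: const => //; [exact: lt_trans s0|left].
  by have := H s s01 sd; rewrite -/(J s) -/(J (normc z)) Js at_z// subr0.
- by rewrite -/(p _) -/(J _) rz at_z// -rz.
Qed.

End PolarGoursat.

(** * Cauchy's formula and Parseval's identity *)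

Section Cauchy.
Variable R : realType.
Implicit Types (f g : R[i] -> R[i]) (z w c h : R[i]) (phi : R -> R[i]) (rho : R).

Definition hol f := forall z, normc z < 1 -> cdiffx f z.

Lemma hol_ccont f z : hol f -> normc z < 1 -> ccont f z.
Proof. by move=> hf /hf[d]; exact: cdiff_ccont. Qed.

Lemma cdiff_local f g z d (r : R) : 0 < r -> (forall w, normc (w - z) < r -> f w = g w) ->
  cdiff g z d -> cdiff f z d.
Proof.
move=> r0 fg dg e e0; have [dl dl0 H] := dg e e0.
exists (Num.min dl r); first by rewrite lt_min dl0.
move=> h; rewrite lt_min => /andP[h1 h2].
by rewrite !fg ?subrr ?normc0// ?(addrC z) ?addrK//; have := H h h1; rewrite (addrC z).
Qed.

Lemma rcc_hol f rho : hol f -> 0 < rho < 1 -> rcc (fun t => f (circ rho t)).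
Proof.
move=> hf /andP[r0 r1]; apply: (rcc_comp (f := f)); last exact: rcc_circ.
by move=> t; apply: hol_ccont => //; rewrite normc_circ// ltW.
Qed.

Lemma circ_sub_gt (rho t : R) z : 0 < rho -> rho - normc z <= normc (circ rho t - z).
Proof. by move=> r0; have := ler_normcB (circ rho t) z; rewrite normc_circ// ltW. Qed.

Lemma circ_sub_neq0 (rho t : R) z : normc z < rho -> circ rho t - z != 0.
Proof.
move=> zr; rewrite -normc_gt0; apply: lt_le_trans (circ_sub_gt t _ _).
  by rewrite subr_gt0.
exact: le_lt_trans (normc_ge0 z) zr.
Qed.

Lemma rcc_circ_sub (rho : R) z : rcc (fun t => circ rho t - z).
Proof. by apply: rccB; [exact: rcc_circ|exact: rcc_cst]. Qed.

Lemma rcc_kernel (rho : R) z n : normc z < rho -> rcc (fun t => ((circ rho t - z) ^+ n)^-1).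
Proof.
move=> zr; apply: rccV; last by apply: rccX; exact: rcc_circ_sub.
by move=> t; rewrite expf_neq0// circ_sub_neq0.
Qed.

Lemma rcc_ckernel (rho : R) z : normc z < rho -> rcc (fun t => circ rho t / (circ rho t - z)).
Proof.
move=> zr; apply: rccM; first exact: rcc_circ.
by apply: rccV; [move=> t; exact: circ_sub_neq0|exact: rcc_circ_sub].
Qed.

Lemma rcc_circ_inv (rho : R) n : 0 < rho -> rcc (fun t => circ rho t ^- n).
Proof.
move=> r0; apply: rccV; last by apply: rccX; exact: rcc_circ.
by move=> t; rewrite expf_neq0// circ_neq0.
Qed.

(** Cauchy's theorem for the difference quotient (f(w) - f(z)) / (w - z): filled in by f'(z) it is
    continuous at z, which is all that [cmean_circ_eq0] asks there. *)
Lemma cauchy_kernel f z rho : hol f -> normc z < rho < 1 ->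
  cmean (fun t => f (circ rho t) * (circ rho t / (circ rho t - z))) =
  f z * cmean (fun t => circ rho t / (circ rho t - z)).
Proof.
move=> hf /andP[zr r1]; have r0 : 0 < rho := le_lt_trans (normc_ge0 z) zr.
have z1 : normc z < 1 by apply: lt_trans r1.
have [d Hd] := hf z z1.
pose q w := if w == z then d else (f w - f z) / (w - z).
have dq w : normc w < 1 -> w != z -> cdiffx q w.
  move=> w1 wz; have [b Hb] := hf w w1.
  have wz0 : w - z != 0 by rewrite subr_eq0.
  have D1 := cdiffD Hb (cdiff_cst (- f z) w).
  have D2 : cdiff (fun v => v - z) w (1 + 0) := cdiffD (cdiff_id w) (cdiff_cst (- z) w).
  have {}D2 := cdiffV (f := fun v => v - z) wz0 D2.
  eexists; apply: cdiff_local (cdiffM D1 D2); first by rewrite -normc_gt0 in wz0; exact: wz0.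
  move=> v vw; rewrite /q ifN//; apply: contraTneq vw => ->.
  by rewrite normcB ltxx.
have cq w : normc w < 1 -> ccont q w.
  move=> w1; have [->|wz] := eqVneq w z; last by have [b] := dq w w1 wz; exact: cdiff_ccont.
  move=> e e0; have [dl dl0 H] := Hd e e0; exists dl => // v vz.
  rewrite /q eqxx; case: eqVneq => [_|vz0]; first by rewrite subrr normc0 ltW.
  have nz : v - z != 0 by rewrite subr_eq0.
  have := H _ vz; rewrite (addrC z) subrK => K.
  rewrite -(ler_pM2r (_ : 0 < normc (v - z))) ?normc_gt0//.
  by rewrite -normcM mulrBl divfK.
have := @cmean_circ_eq0 R q z cq dq rho; rewrite r0 r1 => /(_ isT) E.
apply/eqP; rewrite -subr_eq0 -cmeanZ; last exact: rcc_ckernel.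
rewrite -cmeanB; last 2 first.
- by apply: rccM; [apply: rcc_hol; rewrite ?r0|exact: rcc_ckernel].
- by apply: rccM; [exact: rcc_cst|exact: rcc_ckernel].
apply/eqP; rewrite -[RHS]E; apply: eq_cmean => t _.
have := circ_sub_neq0 t zr; rewrite subr_eq0 /q => /negPf ->.
by rewrite -mulrBl mulrA mulrAC.
Qed.

Lemma geometric_kernel w z N : w != 0 -> w - z != 0 ->
  w / (w - z) = \sum_(k < N) w ^- k * z ^+ k + z ^+ N * (w / (w - z) * w ^- N).
Proof.
move=> w0 wz; elim: N => [|N IH].
  by rewrite big_ord0 add0r expr0 invr1 mulr1 mul1r.
rewrite {1}IH big_ord_recr /= -addrA; congr (_ + _).
rewrite exprSr [in RHS]exprS invfM.
have -> : w / (w - z) = 1 + z / (w - z).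
  by rewrite -{1}(divff wz) -mulrDl subrK.
have E : w ^+ N != 0 by rewrite expf_neq0.
by field; rewrite E w0 wz.
Qed.

Lemma cauchy_geometric phi rho z N : 0 < rho -> normc z < rho -> rcc phi ->
  cmean (fun t => phi t * (circ rho t / (circ rho t - z))) =
  \sum_(k < N) cmean (fun t => phi t * circ rho t ^- k) * z ^+ k +
  z ^+ N * cmean (fun t => phi t * (circ rho t / (circ rho t - z) * circ rho t ^- N)).
Proof.
move=> r0 zr hphi.
have rk k : rcc (fun t => phi t * circ rho t ^- k).
  by apply: rccM => //; exact: rcc_circ_inv.
have rN : rcc (fun t => phi t * (circ rho t / (circ rho t - z) * circ rho t ^- N)).
  by apply: rccM => //; apply: rccM; [exact: rcc_ckernel|exact: rcc_circ_inv].
have rzk k : rcc (fun t => z ^+ k * (phi t * circ rho t ^- k)).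
  by apply: rccM => //; exact: rcc_cst.
have -> : \sum_(k < N) cmean (fun t => phi t * circ rho t ^- k) * z ^+ k =
    cmean (fun t => \sum_(k < N) z ^+ k * (phi t * circ rho t ^- k)).
  rewrite (@cmean_sum R N (fun k t => z ^+ k * (phi t * circ rho t ^- k)))//.
  by apply: eq_bigr => k _; rewrite cmeanZ// mulrC.
rewrite -cmeanZ// -cmeanD; last 2 first.
- exact: (@rcc_sum R N (fun k t => z ^+ k * (phi t * circ rho t ^- k))).
- by apply: rccM => //; exact: rcc_cst.
apply: eq_cmean => t _.
rewrite [in LHS](@geometric_kernel (circ rho t) z N) ?circ_neq0 ?circ_sub_neq0// mulrDr.
congr (_ + _); last by rewrite mulrCA.
by rewrite mulr_sumr; apply: eq_bigr => k _; ring.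
Qed.

(** [phi] is an arbitrary curve: the constant 1 evaluates the mean of the kernel, and the values of
    f on a circle give the Taylor expansion. *)
Lemma cauchy_series phi rho rho1 : 0 <= rho1 < rho -> rcc phi ->
  exists2 M, 0 <= M & forall z N, normc z <= rho1 ->
  normc (cmean (fun t => phi t * (circ rho t / (circ rho t - z))) -
    \sum_(k < N) cmean (fun t => phi t * circ rho t ^- k) * z ^+ k) <= M * (rho1 / rho) ^+ N.
Proof.
move=> /andP[r10 r1r] hphi; have [B B0 HB] := rcc_bounded hphi.
have r0 : 0 < rho := le_lt_trans r10 r1r.
have d0 : 0 < rho - rho1 by rewrite subr_gt0.
(* 2 is the loss in [cmean_bound], [B] bounds the curve, and |w / (w - z)| <= rho / (rho - rho1). *)
exists (2 * (B * (rho / (rho - rho1)))); first by rewrite !mulr_ge0// ?invr_ge0 ltW.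
move=> z N zr; have zr' : normc z < rho := le_lt_trans zr r1r.
rewrite (cauchy_geometric N)// addrAC subrr add0r normcM normcX.
have rN : rcc (fun t => phi t * (circ rho t / (circ rho t - z) * circ rho t ^- N)).
  by apply: rccM => //; apply: rccM; [exact: rcc_ckernel|exact: rcc_circ_inv].
have K : normc (cmean (fun t => phi t * (circ rho t / (circ rho t - z) * circ rho t ^- N)))
    <= 2 * (B * (rho / (rho - rho1) * rho ^- N)).
  apply: cmean_bound => // t ht; rewrite normcM ler_pM ?normc_ge0//; first exact: HB.
  rewrite normcM normcM !normcV normcX normc_circ ?(ltW r0)// ler_pM2r ?invr_gt0 ?exprn_gt0//.
  rewrite ler_pM2l// lef_pV2 ?posrE// ?normc_gt0 ?circ_sub_neq0//.
  by apply: le_trans (circ_sub_gt t z r0); rewrite lerB.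
apply: le_trans (ler_pM _ _ (lerXn2r N _ _ zr) K) _;
  rewrite ?exprn_ge0 ?normc_ge0 ?nnegrE ?normc_ge0//.
rewrite expr_div_n le_eqVlt; apply/orP; left; apply/eqP; ring.
Qed.

(** The exponent N + 1 suits partial sums that contain at least the constant term. *)
Lemma le_geometric_le0 (x M q : R) : 0 <= q < 1 -> (forall N, x <= M * q ^+ N.+1) -> x <= 0.
Proof.
move=> /andP[q0 q1] H.
have cv : (M * q ^+ n) @[n --> \oo] --> (M * 0 : R).
  by apply: cvgM; [exact: cvg_cst|apply: cvg_expr; rewrite ger0_norm].
rewrite mulr0 in cv; rewrite -(cvg_lim _ cv)//.
apply: limr_ge; first by apply/cvg_ex; exists 0.
by near=> n; rewrite -(@prednK n)//; near: n; exists 1%N.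
Unshelve. all: end_near. Qed.

Lemma conjcX z n : conjc (z ^+ n) = conjc z ^+ n.
Proof. exact: rmorphXn. Qed.

(** By orthogonality the series attached to the constant curve 1 reduces to its term of index 0. *)
Lemma cmean_ckernel rho z : normc z < rho ->
  cmean (fun t => circ rho t / (circ rho t - z)) = 1.
Proof.
move=> zr; have r0 : 0 < rho := le_lt_trans (normc_ge0 z) zr.
have [|M M0 H] := @cauchy_series (fun=> 1) rho (normc z) _ (rcc_cst 1).
  by rewrite normc_ge0.
apply/eqP; rewrite -subr_eq0 -normc_eq0 eq_le normc_ge0 andbT.
apply: (@le_geometric_le0 _ M (normc z / rho)).
  by rewrite divr_ge0 ?normc_ge0 ?(ltW r0)//= ltr_pdivrMr// mul1r.
move=> N; apply: le_trans (H z N.+1 (lexx _)); rewrite le_eqVlt; apply/orP; left; apply/eqP.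
congr (normc (_ - _)).
  by apply: eq_cmean => t _; rewrite mul1r.
rewrite big_ord_recl expr0 mulr1 big1 ?addr0 => [|k _].
  by rewrite -[LHS]cmean_cst; apply: eq_cmean => t _; rewrite expr0 invr1 mulr1.
rewrite lift0 (_ : cmean _ = 0) ?mul0r//.
rewrite (@eq_cmean R _ (fun t => (rho%:C%C ^- k.+1) * (expi t ^+ 0 * conjc (expi t ^+ k.+1)))).
  rewrite cmeanZ ?cmean_expi_orth ?mulr0//.
  apply: rccM; last apply: rcc_conj; apply: rccX;
    exact: rcc_expi1.
move=> t _; rewrite mul1r /circ exprMn invfM; congr (_ * _).
by rewrite expr0 mul1r conjcX conj_expi -expiV exprVn.
Qed.

Definition coef f rho k := cmean (fun t => f (circ rho t) * circ rho t ^- k).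

Lemma cauchy_formula f z rho : hol f -> normc z < rho < 1 ->
  f z = cmean (fun t => f (circ rho t) * (circ rho t / (circ rho t - z))).
Proof. by move=> hf hz; rewrite cauchy_kernel// cmean_ckernel ?mulr1//; case/andP: hz. Qed.

(** f(w) / w^k is holomorphic off 0, so [cmean_circ_const] applies to it. *)
Lemma coef_indep f k r1 r2 : hol f -> 0 < r1 < 1 -> 0 < r2 < 1 -> coef f r1 k = coef f r2 k.
Proof.
move=> hf; wlog r12 : r1 r2 / r1 <= r2.
  by move=> W h1 h2; case: (leP r1 r2) => [|/ltW] h; [|symmetry]; exact: W.
move=> /andP[r10 _] /andP[_ r21].
apply: (@cmean_circ_const R (fun w => f w * w ^- k)) => // w /andP[w1 w2].
have w0 : w != 0 by rewrite -normc_gt0 (lt_le_trans r10).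
have [d Hd] := hf w (le_lt_trans w2 r21).
have DX n : cdiffx (fun w => w ^+ n) w.
  elim: n => [|n [e He]]; first by exists 0; exact: cdiff_cst.
  exists (w * e + w ^+ n * 1).
  have := cdiffM (cdiff_id w) He; congr (cdiff _ _ _).
  by apply/funext => v; rewrite exprS.
have [e He] := DX k.
by eexists; apply: cdiffM Hd (cdiffV _ He); rewrite expf_neq0.
Qed.

(** The radius 1/2 is an arbitrary point of (0, 1), justified by [coef_indep]; the Taylor
    coefficient then depends on f and k alone. *)
Definition acoef f k := coef f 2^-1 k.

Lemma half_in01 : 0 < (2^-1 : R) < 1.
Proof. by rewrite invr_gt0 ltr0n invf_lt1 ?ltr0n// ltr1n. Qed.

Lemma hol_pseries f (rho1 : R) : hol f -> 0 <= rho1 < 1 ->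
  exists M q, [/\ 0 <= M, 0 <= q < 1 & forall z N, normc z <= rho1 ->
    normc (f z - \sum_(k < N) acoef f k * z ^+ k) <= M * q ^+ N].
Proof.
move=> hf /andP[r10 r11]; pose rho := (rho1 + 1) / 2.
have rr : rho1 < rho by rewrite /rho; lra.
have rho1' : rho < 1 by rewrite /rho; lra.
have rho0 : 0 < rho by rewrite /rho; lra.
have [||M M0 H] := @cauchy_series (fun t => f (circ rho t)) rho rho1.
- by rewrite r10.
- by apply: rcc_hol; rewrite ?rho0.
exists M, (rho1 / rho); split; first exact: M0.
  by rewrite divr_ge0 ?(ltW rho0)//= ltr_pdivrMr// mul1r.
move=> z N zr.
have hz : normc z < rho < 1 by rewrite (le_lt_trans zr rr).
rewrite (cauchy_formula hf hz).
have Ec k : acoef f k = cmean (fun t => f (circ rho t) * circ rho t ^- k).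
  by apply: (@coef_indep f k _ rho hf half_in01); rewrite rho0.
rewrite (eq_bigr (fun k : 'I_N => cmean (fun t => f (circ rho t) * circ rho t ^- k) * z ^+ k)).
  exact: H.
by move=> k _; rewrite Ec.
Qed.

(** * Differentiation under the circle mean *)

Lemma cdiff_quad f z d (C r : R) : 0 <= C -> 0 < r ->
  (forall h, normc h < r -> normc (f (z + h) - f z - d * h) <= C * normc h ^+ 2) -> cdiff f z d.
Proof.
move=> C0 r0 H e e0; have C1 : 0 < C + 1 by rewrite ltr_wpDl.
exists (Num.min r (e / (C + 1))); first by rewrite lt_min r0 divr_gt0.
move=> h; rewrite lt_min => /andP[h1 h2]; apply: le_trans (H h h1) _.
rewrite expr2 mulrA ler_wpM2r ?normc_ge0//.
apply: le_trans (_ : (C + 1) * normc h <= _); first by rewrite ler_wpM2r ?normc_ge0// lerDl.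
by rewrite -ler_pdivlMl// mulrC ltW.
Qed.

(** An error quadratic in h and uniform in t passes through the mean and leaves a derivative. *)
Lemma cmean_cdiff (K : R[i] -> R -> R[i]) (K' : R -> R[i]) z (C r : R) : 0 <= C -> 0 < r ->
  (forall h, normc h < r -> rcc (K (z + h))) -> rcc K' ->
  (forall h t, normc h < r -> 0 <= t <= 2 * pi ->
     normc (K (z + h) t - K z t - K' t * h) <= C * normc h ^+ 2) ->
  cdiff (fun z => cmean (K z)) z (cmean K').
Proof.
move=> C0 r0 cK cK' H; apply: (@cdiff_quad _ _ _ (2 * C) r) => //; first by rewrite mulr_ge0.
move=> h hr.
have cKz : rcc (K z) by have := cK 0; rewrite normc0 addr0; exact.
have cKh : rcc (fun t => K' t * h) by apply: rccM => //; exact: rcc_cst.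
have -> : cmean K' * h = cmean (fun t => K' t * h).
  by rewrite mulrC -cmeanZ//; apply: eq_cmean => t _; rewrite mulrC.
rewrite -cmeanB//; last exact: cK.
rewrite -cmeanB//; last by apply: rccB => //; exact: cK.
rewrite -mulrA; apply: cmean_bound; last by move=> t; exact: H.
by do 2?apply: rccB => //; exact: cK.
Qed.

Lemma circ_sub_half (rho t : R) z h : normc z < rho -> normc h < (rho - normc z) / 2 ->
  (rho - normc z) / 2 <= normc (circ rho t - z - h).
Proof.
move=> zr hr; have r0 : 0 < rho := le_lt_trans (normc_ge0 z) zr.
have := circ_sub_gt t z r0; have := ler_normcB (circ rho t - z) h; lra.
Qed.

(** Exact second-order remainder of 1 / (A - h); with A = w - z bounded away from 0 it supplies the
    uniform quadratic error. *)
Lemma kernel1_err (A h : R[i]) : A != 0 -> A - h != 0 ->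
  (A - h)^-1 - A^-1 - (A ^+ 2)^-1 * h = h ^+ 2 * ((A - h)^-1 * (A ^+ 2)^-1).
Proof. by move=> A0 Ah; field; rewrite A0 Ah. Qed.

Lemma kernel2_err (A h : R[i]) : A != 0 -> A - h != 0 ->
  ((A - h) ^+ 2)^-1 - (A ^+ 2)^-1 - 2 * (A ^+ 3)^-1 * h =
  h ^+ 2 * ((3 * A - 2 * h) * ((A ^+ 3)^-1 * ((A - h) ^+ 2)^-1)).
Proof. by move=> A0 Ah; field; rewrite A0 Ah. Qed.

Lemma normc_nat n : normc (n%:R : R[i]) = n%:R.
Proof. by rewrite -(rmorph_nat (@real_complex R)) normcC ger0_norm. Qed.

Lemma cmean_kernel1_cdiff phi rho z : rcc phi -> normc z < rho ->
  cdiff (fun z => cmean (fun t => phi t * (circ rho t - z)^-1)) z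
    (cmean (fun t => phi t * ((circ rho t - z) ^+ 2)^-1)).
Proof.
move=> hphi zr; have [B B0 HB] := rcc_bounded hphi.
have r0 : 0 < rho := le_lt_trans (normc_ge0 z) zr.
pose eta := rho - normc z; have eta0 : 0 < eta by rewrite subr_gt0.
have eta2 : 0 < eta / 2 by rewrite divr_gt0.
have zh h : normc h < eta / 2 -> normc (z + h) < rho.
  by move=> hh; have := le_normcD z h; rewrite /eta in hh eta0; lra.
apply: (@cmean_cdiff (fun z t => phi t * (circ rho t - z)^-1) _ _
  (B * ((eta / 2)^-1 * (eta ^+ 2)^-1)) (eta / 2)) => //.
- by rewrite !mulr_ge0 ?invr_ge0 ?exprn_ge0 ?(ltW eta2) ?(ltW eta0).
- move=> h /zh hr; apply: rccM => //.
  by apply: rccV; [move=> t; exact: circ_sub_neq0|exact: rcc_circ_sub].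
- by apply: rccM => //; exact: rcc_kernel.
move=> h t hh ht; have A0 := circ_sub_neq0 t zr.
have E : circ rho t - (z + h) = circ rho t - z - h by rewrite opprD addrA.
have Ah : circ rho t - z - h != 0 by rewrite -E circ_sub_neq0// zh.
rewrite -mulrA -!mulrBr E kernel1_err// normcM normcM normcX mulrCA [leRHS]mulrC.
rewrite ler_wpM2l ?exprn_ge0 ?normc_ge0//.
rewrite ler_pM ?normc_ge0//; first exact: HB.
rewrite normcM !normcV normcX ler_pM ?invr_ge0 ?exprn_ge0 ?normc_ge0//.
  by rewrite lef_pV2 ?posrE ?normc_gt0//; exact: circ_sub_half.
rewrite lef_pV2 ?posrE ?exprn_gt0 ?normc_gt0// lerXn2r ?nnegrE ?(ltW eta0) ?normc_ge0//.
exact: circ_sub_gt.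
Qed.

Lemma cmean_kernel2_cdiff phi rho z : rcc phi -> normc z < rho < 1 ->
  cdiff (fun z => cmean (fun t => phi t * ((circ rho t - z) ^+ 2)^-1)) z
    (cmean (fun t => phi t * (2 * ((circ rho t - z) ^+ 3)^-1))).
Proof.
move=> hphi /andP[zr rho1]; have [B B0 HB] := rcc_bounded hphi.
have r0 : 0 < rho := le_lt_trans (normc_ge0 z) zr.
pose eta := rho - normc z; have eta0 : 0 < eta by rewrite subr_gt0.
have eta2 : 0 < eta / 2 by rewrite divr_gt0.
have zh h : normc h < eta / 2 -> normc (z + h) < rho.
  by move=> hh; have := le_normcD z h; rewrite /eta in hh eta0; lra.
(* 8 bounds |3 A - 2 h|, since |A| <= 2 and |h| <= 1; the other factors come from |A| >= eta and |A
   - h| >= eta / 2. *)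
apply: (@cmean_cdiff (fun z t => phi t * ((circ rho t - z) ^+ 2)^-1) _ _
  (B * (8 * ((eta ^+ 3)^-1 * ((eta / 2) ^+ 2)^-1))) (eta / 2)) => //.
- by rewrite !mulr_ge0 ?invr_ge0 ?exprn_ge0 ?(ltW eta2) ?(ltW eta0).
- by move=> h /zh hr; apply: rccM => //; exact: rcc_kernel.
- apply: rccM => //; apply: rccM; [exact: rcc_cst|exact: rcc_kernel].
move=> h t hh ht; have A0 := circ_sub_neq0 t zr.
have E : circ rho t - (z + h) = circ rho t - z - h by rewrite opprD addrA.
have Ah : circ rho t - z - h != 0 by rewrite -E circ_sub_neq0// zh.
rewrite -mulrA -!mulrBr E kernel2_err// normcM normcM normcX mulrCA [leRHS]mulrC.
rewrite ler_wpM2l ?exprn_ge0 ?normc_ge0//.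
rewrite ler_pM ?normc_ge0//; first exact: HB.
have A2 : normc (circ rho t - z) <= 2.
  apply: le_trans (le_normcD _ _) _; rewrite normcN normc_circ ?(ltW r0)//; lra.
have h1 : normc h <= 1 by rewrite /eta in hh; have := normc_ge0 z; lra.
rewrite normcM ler_pM ?normc_ge0//.
  apply: le_trans (le_normcD _ _) _; rewrite normcN !normcM !normc_nat; lra.
rewrite normcM !normcV !normcX ler_pM ?invr_ge0 ?exprn_ge0 ?normc_ge0//.
  rewrite lef_pV2 ?posrE ?exprn_gt0 ?normc_gt0// lerXn2r ?nnegrE ?(ltW eta0) ?normc_ge0//.
  exact: circ_sub_gt.
rewrite lef_pV2 ?posrE ?exprn_gt0 ?normc_gt0// lerXn2r ?nnegrE ?(ltW eta2) ?normc_ge0//.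
exact: circ_sub_half.
Qed.

Lemma cdiff_unique f z d d' : cdiff f z d -> cdiff f z d' -> d = d'.
Proof. by move=> /(cdiff_derive1 (f := f)) <- /(cdiff_derive1 (f := f)) <-. Qed.

(** The derivative is the Cauchy mean with kernel w / (w - z)^2, and this mean can be differentiated
    once more. Hence a function that is only assumed differentiable has derivatives of all
    orders. *)
Lemma hol_derivative f g : (forall z, normc z < 1 -> cdiff f z (g z)) -> hol g.
Proof.
move=> fg z z1.
have hf : hol f by move=> w /fg ?; exists (g w).
pose rho := (normc z + 1) / 2.
have zr : normc z < rho by rewrite /rho; lra.
have rho1 : rho < 1 by rewrite /rho; lra.
have r0 : 0 < rho := le_lt_trans (normc_ge0 z) zr.
pose phi t := f (circ rho t) * circ rho t.
have cphi : rcc phi.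
  by apply: rccM; [apply: rcc_hol => //; rewrite r0|exact: rcc_circ].
have near_disc v w : normc v < rho -> normc (w - v) < rho - normc v -> normc w < rho.
  by move=> hv hw; have := le_normcD (w - v) v; rewrite subrK; lra.
have gE v : normc v < rho -> g v = cmean (fun t => phi t * ((circ rho t - v) ^+ 2)^-1).
  move=> vr; apply: cdiff_unique (fg v (lt_trans vr rho1)) _.
  have d0 : 0 < rho - normc v by rewrite subr_gt0.
  apply: cdiff_local d0 _ (cmean_kernel1_cdiff cphi vr) => w hw.
  have wr := near_disc v w vr hw.
  rewrite (@cauchy_formula f w rho) ?wr//; apply: eq_cmean => t _.
  by rewrite /phi mulrA.
have d0 : 0 < rho - normc z by rewrite subr_gt0.
have zr1 : normc z < rho < 1 by rewrite zr.
eexists; apply: cdiff_local d0 _ (cmean_kernel2_cdiff cphi zr1).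
by move=> w hw; apply: gE; exact: near_disc hw.
Qed.

(** * Parseval's identity *)

Lemma cmean_poly_sqr (a : nat -> R[i]) N :
  cmean (fun t => (\sum_(k < N) a k * expi t ^+ k) * conjc (\sum_(k < N) a k * expi t ^+ k)) =
  (\sum_(k < N) cabs2 (a k))%:C%C.
Proof.
have rexpi : rcc (fun t => expi t : R[i]).
  exact: rcc_expi1.
have rkl k l : rcc (fun t => expi t ^+ k * conjc (expi t ^+ l) : R[i]).
  by apply: rccM; last apply: rcc_conj; apply: rccX.
have rkl' k l : rcc (fun t => a k * conjc (a l) * (expi t ^+ k * conjc (expi t ^+ l)) : R[i]).
  by apply: rccM => //; exact: rcc_cst.
rewrite (@eq_cmean R _ (fun t => \sum_(k < N) \sum_(l < N)
   a k * conjc (a l) * (expi t ^+ k * conjc (expi t ^+ l)))) => [|t _]; last first.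
  rewrite rmorph_sum /= mulr_suml; apply: eq_bigr => k _.
  by rewrite mulr_sumr; apply: eq_bigr => l _; rewrite rmorphM /=; ring.
rewrite (@cmean_sum R N (fun k t => \sum_(l < N)
   a k * conjc (a l) * (expi t ^+ k * conjc (expi t ^+ l)))) => [|k]; last first.
  exact: (@rcc_sum R N (fun l t => a k * conjc (a l) * (expi t ^+ k * conjc (expi t ^+ l)))).
rewrite rmorph_sum /=; apply: eq_bigr => k _.
rewrite (@cmean_sum R N (fun l t => a k * conjc (a l) * (expi t ^+ k * conjc (expi t ^+ l)))) => [|l //].
rewrite (bigD1 k)//= cmeanZ// cmean_expi_orth eqxx mulr1 big1 ?addr0 => [|l lk].
  by case: (a k) => x y; rewrite /cabs2 /=; apply/eqP; rewrite eq_complex /=; apply/andP; split; apply/eqP; ring.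
have /negPf kl : (k : nat) != l by apply: contraNneq lk => /val_inj ->.
by rewrite cmeanZ// cmean_expi_orth kl mulr0.
Qed.

Definition rmean (psi : R -> R) := (2 * pi)^-1 * iint psi 0 (2 * pi).

Lemma Re_cmean_sqr phi : complex.Re (cmean (fun t => phi t * conjc (phi t))) =
  rmean (fun t => cabs2 (phi t)).
Proof.
rewrite /cmean /rmean /=; congr (_ * _); apply: eq_iint => t _.
by case: (phi t) => a b; rewrite /cabs2 /=; ring.
Qed.

Lemma rcc_cabs2 phi : rcc phi -> continuous (fun t => cabs2 (phi t)).
Proof.
move=> /rccP[h1 h2] t.
rewrite (_ : (fun t => _) = (fun t => complex.Re (phi t) * complex.Re (phi t) +
  complex.Im (phi t) * complex.Im (phi t))); last by apply/funext => u; rewrite /cabs2 !expr2.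
by apply: cvgD; apply: cvgM; [exact: h1|exact: h1|exact: h2|exact: h2].
Qed.

Lemma rcc_orbit f z : hol f -> normc z < 1 -> rcc (fun t => f (z * expi t)).
Proof.
move=> hf z1; apply: (rcc_comp (f := f)) => [t|].
  by apply: hol_ccont => //; rewrite normcM normc_expi mulr1.
apply: rccM; first exact: rcc_cst.
exact: rcc_expi1.
Qed.

(** The circle is parametrised as the rotation orbit of z, which includes z = 0 and matches the
    averaging over rotations of the plane. *)
Lemma parseval f z : hol f -> normc z < 1 ->
  exists M q, [/\ 0 <= M, 0 <= q < 1 & forall N,
    `|rmean (fun t => cabs2 (f (z * expi t))) - \sum_(k < N) cabs2 (acoef f k) * cabs2 z ^+ k|
    <= M * q ^+ N].
Proof.
move=> hf z1.
have [|M [q [M0 /andP[q0 q1] H]]] := @hol_pseries f (normc z) hf _; first by rewrite normc_ge0.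
have cf := rcc_orbit hf z1.
have [B B0 HB] := rcc_bounded cf.
(* For u the value of f and v that of its Taylor polynomial, |u|^2 - |v|^2 is (|u| + |v|) (|u| -
   |v|), with |u| <= B, |v| <= B + M and a difference of at most M q^N. *)
exists (M * (2 * B + M)), q; split; rewrite ?q0 ?mulr_ge0 ?addr_ge0 ?mulr_ge0// => N.
pose p t := \sum_(k < N) (acoef f k * z ^+ k) * expi t ^+ k.
have rexpi : rcc (fun t => expi t : R[i]).
  exact: rcc_expi1.
have cp : rcc p.
  apply: (@rcc_sum R N (fun k t => acoef f k * z ^+ k * expi t ^+ k)) => k.
  by apply: rccM; [exact: rcc_cst|exact: rccX].
have -> : \sum_(k < N) cabs2 (acoef f k) * cabs2 z ^+ k = rmean (fun t => cabs2 (p t)).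
  have E : cmean (fun t => p t * conjc (p t)) = _ :=
    cmean_poly_sqr (fun k => acoef f k * z ^+ k) N.
  rewrite -Re_cmean_sqr E /=; apply: eq_bigr => k _.
  by rewrite cabs2M; congr (_ * _); rewrite !cabs2E normcX -!exprM mulnC.
rewrite /rmean -mulrBr normrM gtr0_norm ?invr_gt0 ?twopi_gt0//.
rewrite ler_pdivrMl ?twopi_gt0// [leRHS]mulrC.
rewrite -iintB; [|exact/continuous_subspaceT/rcc_cabs2|exact/continuous_subspaceT/rcc_cabs2].
have := @iint_near R (fun t => cabs2 (f (z * expi t)) - cabs2 (p t)) 0 (2 * pi) 0
  (M * (2 * B + M) * q ^+ N) (ltW (twopi_gt0 R)).
rewrite mul0r !subr0; apply.
  apply: continuous_subspaceT => t; apply: cvgB; exact: rcc_cabs2.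
move=> t ht; rewrite subr0.
have fB := HB t ht.
have := H (z * expi t) N; rewrite normcM normc_expi mulr1 => /(_ (lexx _)).
rewrite (_ : \sum_(k < N) _ = p t); last first.
  by apply: eq_bigr => k _; rewrite exprMn mulrA.
set u := f _ in fB *; set v := p t => K.
have qN : 0 <= q ^+ N <= 1 by rewrite exprn_ge0//= exprn_ile1// ltW.
have nuv : `|normc u - normc v| <= M * q ^+ N.
  rewrite ler_norml; have := ler_normcB u v; have := ler_normcB v u; rewrite (normcB v u).
  by move=> *; apply/andP; split; lra.
have nv : normc u + normc v <= 2 * B + M.
  have : M * q ^+ N <= M by case/andP: qN => _ ?; rewrite ler_piMr.
  by move: nuv; rewrite ler_norml => /andP[]; lra.
rewrite !cabs2E subr_sqr normrM [X in _ * X]ger0_norm ?addr_ge0 ?normc_ge0//.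
rewrite mulrAC; apply: ler_pM => //; rewrite addr_ge0 ?normc_ge0//.
Qed.

End Cauchy.

(** * Coefficients of dilated quotients *)

Section Multiplier.
Variable R : realType.
Implicit Types (f g : R[i] -> R[i]) (z c a : R[i]).

Lemma hol_mul f g : hol f -> hol g -> hol (fun z => f z * g z).
Proof.
move=> hf hg z z1; have [d Hd] := hf z z1; have [e He] := hg z z1.
by eexists; exact: cdiffM Hd He.
Qed.

Lemma hol_add f g : hol f -> hol g -> hol (fun z => f z + g z).
Proof.
move=> hf hg z z1; have [d Hd] := hf z z1; have [e He] := hg z z1.
by eexists; exact: cdiffD Hd He.
Qed.

Lemma hol_cst c : hol (fun=> c).
Proof. by move=> z _; exists 0; exact: cdiff_cst. Qed.

Lemma hol_id : hol (fun z : R[i] => z).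
Proof. by move=> z _; exists 1; exact: cdiff_id. Qed.

Lemma cdiff_scale a z : cdiff (fun w => a * w) z a.
Proof. by have := cdiffM (cdiff_cst a z) (cdiff_id z); rewrite mulr1 mulr0 addr0. Qed.

Lemma normc_dil (r : R) z : 0 <= r < 1 -> normc z < 1 -> normc (r%:C%C * z) < 1.
Proof.
move=> /andP[r0 r1] z1; rewrite normcM normcC ger0_norm//.
by apply: le_lt_trans z1; rewrite ler_piMl ?normc_ge0// ltW.
Qed.

Lemma hol_dil f (r : R) : 0 <= r < 1 -> hol f -> hol (fun z => f (r%:C%C * z)).
Proof.
move=> r01 hf z z1; have [d Hd] := hf _ (normc_dil r01 z1).
by eexists; exact: (cdiff_comp (f := fun w => r%:C%C * w) (cdiff_scale r%:C%C z) Hd).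
Qed.

Lemma oneB_neq0 c z : normc c <= 1 -> normc z < 1 -> 1 - c * z != 0.
Proof.
move=> c1 z1; rewrite subr_eq0; apply/eqP => E.
have : normc (1 : R[i]) < 1.
  by rewrite E normcM; apply: le_lt_trans z1; rewrite ler_piMl ?normc_ge0.
by rewrite normc1 ltxx.
Qed.

Lemma hol_oneB c : hol (fun z => 1 - c * z).
Proof.
apply: hol_add; first exact: hol_cst.
move=> z _; exists (- c); have := cdiff_scale (- c) z.
by congr cdiff; apply/funext => w; rewrite mulNr.
Qed.

Lemma hol_oneBV c : normc c <= 1 -> hol (fun z => (1 - c * z)^-1).
Proof.
move=> c1 z z1; have [d Hd] := hol_oneB c z1.
by eexists; exact: (cdiffV (f := fun z => 1 - c * z) (oneB_neq0 c1 z1) Hd).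
Qed.

Lemma rcc_coef f k : hol f -> rcc (fun t => f (circ 2^-1 t) * circ 2^-1 t ^- k).
Proof.
by move=> hf; apply: rccM; [exact: rcc_hol (half_in01 R)|apply: rcc_circ_inv; case/andP: (half_in01 R)].
Qed.

Lemma acoefD f g k : hol f -> hol g -> acoef (fun z => f z + g z) k = acoef f k + acoef g k.
Proof.
move=> hf hg; rewrite /acoef /coef -cmeanD; [|exact: rcc_coef|exact: rcc_coef].
by apply: eq_cmean => t _; rewrite mulrDl.
Qed.

Lemma acoefZ f a k : hol f -> acoef (fun z => a * f z) k = a * acoef f k.
Proof.
move=> hf; rewrite /acoef /coef -cmeanZ; last exact: rcc_coef.
by apply: eq_cmean => t _; rewrite mulrA.
Qed.

Lemma acoef_shift f k : acoef (fun z => z * f z) k.+1 = acoef f k.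
Proof.
rewrite /acoef /coef; apply: eq_cmean => t _.
have w0 : circ 2^-1 t != 0 :> R[i] by apply: circ_neq0; case/andP: (half_in01 R).
by rewrite exprS invfM mulrACA mulfV// mul1r.
Qed.

(** The coefficient of index 0 is the mean of w f(w), which is Cauchy's contour integral of f. *)
Lemma acoef_shift0 f : hol f -> acoef (fun z => z * f z) 0 = 0.
Proof.
move=> hf; rewrite /acoef /coef -[RHS](@cmean_circ_eq0 R f 0 _ _ 2^-1 (half_in01 R)).
- by apply: eq_cmean => t _; rewrite expr0 invr1 mulr1 mulrC.
- by move=> w w1; exact: hol_ccont.
- by move=> w w1 _; exact: hf.
Qed.

Lemma acoef_oneB f a : hol f ->
  acoef (fun z => (1 - a * z) * f z) 0 = acoef f 0 /\
  forall k, acoef (fun z => (1 - a * z) * f z) k.+1 = acoef f k.+1 - a * acoef f k.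
Proof.
move=> hf; have hzf : hol (fun z => z * f z) := hol_mul hol_id hf.
have E : (fun z => (1 - a * z) * f z) = (fun z => f z + (- a) * (z * f z)).
  by apply/funext => z; rewrite mulrBl mul1r mulNr mulrA.
have hazf : hol (fun z => - a * (z * f z)) := hol_mul (hol_cst (- a)) hzf.
split=> [|k]; rewrite E acoefD// acoefZ//.
  by rewrite acoef_shift0// mulr0 addr0.
by rewrite acoef_shift mulNr.
Qed.

Lemma exprVMn (x y : R[i]) k : x != 0 -> y ^- k = x ^+ k * (x * y) ^- k.
Proof. by move=> x0; rewrite exprMn invfM mulrA mulfV ?mul1r// expf_neq0. Qed.

(** Dilation moves the circle of radius 1/2 to radius r/2, and for r > 0 the coefficient does not
    depend on the radius. *)
Lemma acoef_dil f (r : R) k : 0 < r < 1 -> hol f ->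
  acoef (fun z => f (r%:C%C * z)) k = r%:C%C ^+ k * acoef f k.
Proof.
move=> /andP[r0 r1] hf.
have rh : 0 < r * 2^-1 < 1.
  have /andP[_ h1] := half_in01 R.
  by rewrite mulr_gt0//= (lt_trans _ h1)// gtr_pMl.
have E t : r%:C%C * circ 2^-1 t = circ (r * 2^-1) t.
  by rewrite /circ mulrA -rmorphM.
rewrite /acoef (coef_indep k hf (half_in01 R) rh) /coef -cmeanZ.
  apply: eq_cmean => t _; rewrite -E [RHS]mulrCA; congr (_ * _); apply: exprVMn.
  by rewrite -normc_gt0 normcC normr_gt0 gt_eqF.
apply: rccM; first exact: rcc_hol.
by apply: rcc_circ_inv; case/andP: rh.
Qed.

(** The function k of the overview, with [f] in the role of h and [c] in that of conj(zeta). *)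
Definition dilate_div f (r : R) c := fun z => (1 - r%:C%C * c * z) / (1 - c * z) * f (r%:C%C * z).

Lemma hol_dilate_div f (r : R) c : 0 <= r < 1 -> normc c <= 1 -> hol f -> hol (dilate_div f r c).
Proof.
move=> r01 c1 hf; apply: hol_mul; last exact: hol_dil.
by apply: hol_mul; [exact: hol_oneB|exact: hol_oneBV].
Qed.

Lemma acoef_local f g : (forall z, normc z < 1 -> f z = g z) -> acoef f =1 acoef g.
Proof.
move=> fg k; apply: eq_cmean => t _; rewrite fg// normc_circ; last exact: ltW.
by case/andP: (half_in01 R).
Qed.

(** Comparing coefficients in (1 - c z) k(z) = (1 - r c z) f(r z) gives a one-step recursion and
    avoids multiplying power series. *)
Lemma acoef_dilate_div f (r : R) c : 0 < r < 1 -> normc c <= 1 -> hol f ->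
  acoef (dilate_div f r c) 0 = acoef f 0 /\
  forall k, acoef (dilate_div f r c) k.+1 = c * acoef (dilate_div f r c) k +
     r%:C%C ^+ k.+1 * acoef f k.+1 - r%:C%C ^+ k.+1 * c * acoef f k.
Proof.
move=> r01 c1 hf; have r01' : 0 <= r < 1 by case/andP: r01 => /ltW -> ->.
have hk := hol_dilate_div r01' c1 hf.
have hr := hol_dil r01' hf.
have [k0 kS] := acoef_oneB c hk.
have [h0 hS] := acoef_oneB (r%:C%C * c) hr.
have E : acoef (fun z => (1 - c * z) * dilate_div f r c z) =1
         acoef (fun z => (1 - r%:C%C * c * z) * f (r%:C%C * z)).
  apply: acoef_local => z z1; rewrite /dilate_div mulrA; congr (_ * _).
  by rewrite mulrCA mulfV ?mulr1// oneB_neq0.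
split; first by rewrite -k0 E h0 acoef_dil// expr0 mul1r.
move=> k; have := E k.+1; rewrite kS hS !acoef_dil// => /eqP.
rewrite subr_eq => /eqP ->; rewrite exprS; ring.
Qed.

(** One step of Cauchy-Schwarz for a weighted sum: [y] is the weight gathered so far, [B] the
    weighted sum of squares, and a term [s] of weight [x] is added. *)
Lemma weighted_cauchy_schwarz (x y B : R) (A s : R[i]) : 0 <= x -> 0 <= y -> 0 <= B ->
  cabs2 A <= y * B -> cabs2 (A + x%:C%C * s) <= (y + x) * (B + x * cabs2 s).
Proof.
move=> x0 y0 B0; rewrite !cabs2E.
set a := normc A; set b := normc s => H.
have a0 : 0 <= a := normc_ge0 _; have b0 : 0 <= b := normc_ge0 _.
have K : normc (A + x%:C%C * s) <= a + x * b.
  by apply: le_trans (le_normcD _ _) _; rewrite normcM normcC ger0_norm.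
(* The mixed term is bounded after squaring, so that y = 0 causes no division. *)
have amgm : 2 * (a * b) <= y * b ^+ 2 + B.
  rewrite -(@ler_pXn2r _ 2)// ?nnegrE ?addr_ge0 ?mulr_ge0 ?exprn_ge0//.
  rewrite -subr_ge0.
  have -> : (y * b ^+ 2 + B) ^+ 2 - (2 * (a * b)) ^+ 2 =
    (y * b ^+ 2 - B) ^+ 2 + 4 * b ^+ 2 * (y * B - a ^+ 2) by ring.
  by rewrite addr_ge0 ?sqr_ge0 ?mulr_ge0 ?subr_ge0 ?sqr_ge0.
apply: le_trans (_ : (a + x * b) ^+ 2 <= _).
  by rewrite ler_pXn2r ?nnegrE ?normc_ge0 ?addr_ge0 ?mulr_ge0.
rewrite -subr_ge0.
have -> : (y + x) * (B + x * b ^+ 2) - (a + x * b) ^+ 2 =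
   (y * B - a ^+ 2) + x * (y * b ^+ 2 + B - 2 * (a * b)) by ring.
by rewrite addr_ge0 ?mulr_ge0 ?subr_ge0.
Qed.

(* The recursion says that [t m] is the combination of [s 0, ..., s m], up to unimodular factors,
   with weights [(1 - r) r^k] for [k < m] and [r^m], whose sum is 1. *)
Lemma convex_coef_le (s t : nat -> R[i]) (r : R) c : 0 < r < 1 -> normc c <= 1 ->
  t 0%N = s 0%N ->
  (forall k, t k.+1 = c * t k + r%:C%C ^+ k.+1 * s k.+1 - r%:C%C ^+ k.+1 * c * s k) ->
  forall m, cabs2 (t m) <=
    r ^+ m * cabs2 (s m) + (1 - r) * \sum_(k < m) r ^+ k * cabs2 (s k).
Proof.
move=> /andP[r0 r1] c1 t0 tS m.
pose B m := (1 - r) * \sum_(k < m) r ^+ k * cabs2 (s k).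
have B0 k : 0 <= B k.
  rewrite mulr_ge0 ?subr_ge0 ?(ltW r1)// sumr_ge0// => i _.
  by rewrite mulr_ge0 ?cabs2_ge0 ?exprn_ge0 ?(ltW r0).
have rX k : r%:C%C ^+ k = (r ^+ k)%:C%C :> R[i] by rewrite rmorphXn.
have rle k : r ^+ k <= 1 by rewrite exprn_ile1// ltW.
(* Without its last term r^k s_k, t_k is a combination of total weight 1 - r^k, the sum of (1 - r)
   r^j over j < k. *)
have inv k : cabs2 (t k - (r ^+ k)%:C%C * s k) <= (1 - r ^+ k) * B k.
  elim: k => [|k IH].
    by rewrite expr0 mul1r t0 subrr subrr mul0r /cabs2 /= expr0n addr0.
  (* The recursion multiplies by c and turns the last weight r^k into (1 - r) r^k; the new last term
     is the one subtracted. *)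
  have -> : t k.+1 - (r ^+ k.+1)%:C%C * s k.+1 =
      c * ((t k - (r ^+ k)%:C%C * s k) + ((1 - r) * r ^+ k)%:C%C * s k).
    by rewrite tS !rX exprS !rmorphM rmorphB /= rmorph1; ring.
  have x0 : 0 <= (1 - r) * r ^+ k by rewrite mulr_ge0 ?subr_ge0 ?exprn_ge0 ?ltW.
  have y0 : 0 <= 1 - r ^+ k by rewrite subr_ge0.
  have := weighted_cauchy_schwarz (s k) x0 y0 (B0 k) IH.
  rewrite cabs2M => K.
  apply: le_trans (_ : cabs2 (t k - (r ^+ k)%:C%C * s k + ((1 - r) * r ^+ k)%:C%C * s k) <= _).
    by rewrite ler_piMl ?cabs2_ge0// cabs2E expr_le1 ?normc_ge0.
  apply: le_trans K _; rewrite le_eqVlt; apply/orP; left; apply/eqP.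
  by rewrite /B big_ord_recr /= exprS; ring.
have x0 : 0 <= r ^+ m by rewrite exprn_ge0 ?ltW.
have y0 : 0 <= 1 - r ^+ m by rewrite subr_ge0.
have := weighted_cauchy_schwarz (s m) x0 y0 (B0 m) (inv m).
by rewrite !subrK mul1r [leRHS]addrC.
Qed.

(** Exchanging the sums produces the tails x^(k+1) + x^(k+2) + ... = x^(k+1) / (1 - x). The identity
    [E] records exactly what the truncation at N drops, and this is nonnegative. *)
Lemma partial_sums_le (b : nat -> R) (x : R) N : 0 <= x < 1 -> (forall k, 0 <= b k) ->
  \sum_(m < N) (\sum_(k < m) b k) * x ^+ m <= \sum_(k < N) b k * (x ^+ k.+1 / (1 - x)).
Proof.
move=> /andP[x0 x1] b0; have d0 : 0 < 1 - x by rewrite subr_gt0.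
have E n : \sum_(m < n) (\sum_(k < m) b k) * x ^+ m + (\sum_(k < n) b k) * x ^+ n / (1 - x) =
    \sum_(k < n) b k * (x ^+ k.+1 / (1 - x)).
  elim: n => [|n IH]; first by rewrite !big_ord0 !mul0r addr0.
  rewrite [RHS]big_ord_recr /= -IH !big_ord_recr /= exprS.
  by field; rewrite gt_eqF.
rewrite -E lerDl !mulr_ge0 ?invr_ge0 ?exprn_ge0 ?(ltW d0)//.
by apply: sumr_ge0 => k _.
Qed.

Lemma dilate_div_partial f (r : R) c (x : R) N : 0 < r < 1 -> normc c <= 1 -> hol f -> 0 <= x < 1 ->
  \sum_(m < N) cabs2 (acoef (dilate_div f r c) m) * x ^+ m <=
  \sum_(k < N) r ^+ k * cabs2 (acoef f k) * (x ^+ k + (1 - r) * (x ^+ k.+1 / (1 - x))).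
Proof.
move=> r01 c1 hf /andP[x0 x1]; have [t0 tS] := acoef_dilate_div r01 c1 hf.
have H := convex_coef_le r01 c1 t0 tS.
have /andP[r0 r1] := r01.
apply: le_trans (_ : \sum_(m < N) (r ^+ m * cabs2 (acoef f m) * x ^+ m +
   (1 - r) * ((\sum_(k < m) r ^+ k * cabs2 (acoef f k)) * x ^+ m)) <= _).
  by apply: ler_sum => m _; rewrite mulrA -mulrDl ler_wpM2r ?exprn_ge0.
rewrite big_split /= -mulr_sumr.
have b0 k : 0 <= r ^+ k * cabs2 (acoef f k).
  by rewrite mulr_ge0 ?cabs2_ge0 ?exprn_ge0// ltW.
have x01 : 0 <= x < 1 by rewrite x0.
have d0 : 0 <= 1 - r by rewrite subr_ge0 ltW.
have P := ler_wpM2l d0 (partial_sums_le N x01 b0).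
apply: le_trans (lerD (lexx _) P) _.
rewrite mulr_sumr -big_split /=; apply: ler_sum => k _.
by rewrite [leRHS]mulrDr lerD2l mulrCA.
Qed.

(** Replacing n by 1 only enlarges the left side. The bound is then the value at k = 0, since
    consecutive terms decrease by r^k (1 - r)^2 (k + 2). *)
Lemma weight_bound (r : R) k n : 0 < r < 1 -> (0 < n)%N ->
  r ^+ k * (1 + (1 - r) * (k.+1%:R / n%:R)) <= 2 - r.
Proof.
move=> /andP[r0 r1] n0.
apply: le_trans (_ : r ^+ k * (1 + (1 - r) * k.+1%:R) <= _).
  rewrite ler_wpM2l ?exprn_ge0 ?(ltW r0)// lerD2l ler_wpM2l ?subr_ge0 ?(ltW r1)//.
  by rewrite ler_pdivrMr ?ltr0n// ler_peMr// ler1n.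
elim: k => [|k IH]; first by rewrite expr0 mul1r mulr1; lra.
apply: le_trans IH; rewrite exprSr -mulrA ler_wpM2l ?exprn_ge0 ?(ltW r0)//.
rewrite -subr_ge0 -[k.+2%:R]natr1.
have -> : 1 + (1 - r) * k.+1%:R - r * (1 + (1 - r) * (k.+1%:R + 1)) =
   (1 - r) ^+ 2 * (k.+1%:R + 1) by ring.
by rewrite mulr_ge0 ?sqr_ge0 ?addr_ge0.
Qed.

Lemma geometric_cvg (u : nat -> R) (l M q : R) : 0 <= M -> 0 <= q < 1 ->
  (forall n, `|l - u n| <= M * q ^+ n) -> u n @[n --> \oo] --> l.
Proof.
move=> M0 /andP[q0 q1] H.
have cv : (M * q ^+ n) @[n --> \oo] --> (M * 0 : R).
  by apply: cvgM; [exact: cvg_cst|apply: cvg_expr; rewrite ger0_norm].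
rewrite mulr0 in cv; apply/cvgrPdist_le => e e0.
move/cvgrPdist_le : cv => /(_ e e0); apply: filterS => n.
rewrite sub0r normrN ger0_norm ?mulr_ge0 ?exprn_ge0//.
exact: le_trans (H n).
Qed.

Lemma parseval_cvg f z : hol f -> normc z < 1 ->
  (\sum_(k < N) cabs2 (acoef f k) * cabs2 z ^+ k) @[N --> \oo] -->
    rmean (fun t => cabs2 (f (z * expi t))).
Proof.
by move=> hf z1; have [M [q [M0 q01 H]]] := parseval hf z1; exact: geometric_cvg M0 q01 H.
Qed.

Lemma parseval_eseries f z : hol f -> normc z < 1 ->
  (\sum_(k <oo) (cabs2 (acoef f k) * cabs2 z ^+ k)%:E =
   (rmean (fun t => cabs2 (f (z * expi t))))%:E)%E.
Proof.
move=> hf z1; apply: cvg_lim => //.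
rewrite (_ : (fun n => _) = EFin \o (fun N => \sum_(k < N) cabs2 (acoef f k) * cabs2 z ^+ k)).
  by apply: cvg_EFin; [exact: nearW|exact: parseval_cvg].
by apply/funext => n /=; rewrite sumEFin big_mkord.
Qed.

(** The limit of [dilate_div_partial] at x = |z|^2, in extended reals in view of the exchange of sum
    and integral. *)
Lemma dilate_div_mean_le f (r : R) c z : 0 < r < 1 -> normc c <= 1 -> hol f -> normc z < 1 ->
  ((rmean (fun t => cabs2 (dilate_div f r c (z * expi t))))%:E <=
   \sum_(k <oo) (r ^+ k * cabs2 (acoef f k) *
      (cabs2 z ^+ k + (1 - r) * (cabs2 z ^+ k.+1 / (1 - cabs2 z))))%:E)%E.
Proof.
move=> r01 c1 hf z1; have /andP[r0 r1] := r01.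
have hk : hol (dilate_div f r c) by apply: hol_dilate_div => //; rewrite ltW.
rewrite -parseval_eseries//.
have x01 : 0 <= cabs2 z < 1 by rewrite cabs2_ge0 cabs2E expr_lt1 ?normc_ge0.
have /andP[x0 x1] := x01.
apply: lee_lim.
- by apply: is_cvg_nneseries => n _ _; rewrite lee_fin mulr_ge0 ?cabs2_ge0 ?exprn_ge0.
- apply: is_cvg_nneseries => n _ _; rewrite lee_fin !mulr_ge0 ?cabs2_ge0 ?exprn_ge0 ?(ltW r0)//.
  by rewrite addr_ge0 ?mulr_ge0 ?invr_ge0 ?exprn_ge0 ?subr_ge0 ?(ltW r1) ?(ltW x1).
- by apply: nearW => n; rewrite !sumEFin lee_fin !big_mkord; exact: dilate_div_partial.
Qed.

Lemma hol_derive1n f n : hol f ->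
  hol (derive1n n (f : R[i]^o -> R[i]^o)) /\
  forall z, normc z < 1 -> cdiff (derive1n n (f : R[i]^o -> R[i]^o)) z
    (derive1n n.+1 (f : R[i]^o -> R[i]^o) z).
Proof.
move=> hf.
have step g : hol g -> forall z, normc z < 1 -> cdiff g z (derive1 (g : R[i]^o -> R[i]^o) z).
  by move=> hg z z1; have [d Hd] := hg z z1; rewrite (cdiff_derive1 (f := g) Hd).
have hn : hol (derive1n n (f : R[i]^o -> R[i]^o)).
  elim: n => [|n IH] //.
  by rewrite derive1nS; exact: hol_derivative (step _ IH).
by split => // z z1; rewrite derive1nS; exact: step.
Qed.

(** The induction hypothesis is an identity on the disc alone, so it is differentiated through
    [cdiff_local]. *)
Lemma derive1n_dil f (r : R) n z : hol f -> 0 <= r < 1 -> normc z < 1 ->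
  derive1n n ((fun w => f (r%:C%C * w)) : R[i]^o -> R[i]^o) z =
  r%:C%C ^+ n * derive1n n (f : R[i]^o -> R[i]^o) (r%:C%C * z).
Proof.
move=> hf r01; elim: n z => [|n IH] z z1; first by rewrite expr0 mul1r.
rewrite derive1nS; apply: cdiff_derive1.
have [_ /(_ _ (normc_dil r01 z1)) Hd] := hol_derive1n n hf.
have d0 : 0 < 1 - normc z by rewrite subr_gt0.
apply: (cdiff_local (g := fun w => r%:C%C ^+ n * derive1n n (f : R[i]^o -> R[i]^o) (r%:C%C * w)) d0).
  by move=> w hw; apply: IH; have := le_normcD (w - z) z; rewrite subrK; lra.
have := cdiffM (cdiff_cst (r%:C%C ^+ n) z)
  (cdiff_comp (f := fun w => r%:C%C * w) (cdiff_scale r%:C%C z) Hd).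
by rewrite mulr0 addr0 exprSr -mulrA [r%:C%C * _ in X in _ -> X]mulrC.
Qed.

End Multiplier.

(** * Rotation invariance of plane Lebesgue measure *)

Section PlaneMeasure.
Variable R : realType.
Local Notation RT := (measurableTypeR R).
Local Notation leb := (@lebesgue_measure R).
Local Notation leb2 := (leb \x leb)%E.
Local Open Scope ereal_scope.

(* An alias, because the sigma-finite structure inferred on a product is that of
   subprobabilities. *)
Definition plane_measure : set (RT * RT) -> \bar R := leb2.

HB.instance Definition _ := Measure.on plane_measure.

Lemma sigma_finite_plane_measure : sigma_finite setT plane_measure.
Proof.
have /sigma_finiteP[F [TF ndF Foo]] := sigma_finiteT leb.
exists (fun n => F n `*` F n).
  apply/seteqP; split => [[x y] _|//].
  have : [set: RT] x by []. have : [set: RT] y by []. rewrite TF => -[k _ Fy] [l _ Fx].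
  exists (maxn k l) => //; split => /=.
    by move: x Fx; exact/subsetPset/ndF/leq_maxr.
  by move: y Fy; exact/subsetPset/ndF/leq_maxl.
move=> k; have [mF Fk] := Foo k; split; first exact: measurableX.
by rewrite /plane_measure product_measure1E// lte_mul_pinfty// ge0_fin_numE.
Qed.

HB.instance Definition _ :=
  Measure_isSigmaFinite.Build _ _ _ plane_measure sigma_finite_plane_measure.

Lemma plane_tonelli d (T : measurableType d) (m : {sigma_finite_measure set T -> \bar R})
    (G : (RT * RT) * T -> \bar R) : measurable_fun setT G -> (forall q, 0 <= G q) ->
  \int[leb2]_p \int[m]_t G (p, t) = \int[m]_t \int[leb2]_p G (p, t).
Proof. by move=> mG G0; exact: (@fubini_tonelli _ _ _ _ _ plane_measure m G mG G0). Qed.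

Lemma measurable_translation (a : R) : measurable_fun [set: RT] ((fun x => x + a)%R : RT -> RT).
Proof. by apply: measurable_funD; [exact: measurable_id|exact: measurable_cst]. Qed.

(** Uniqueness of the measure that gives half-open intervals their length. *)
Lemma lebesgue_measure_translation (a : R) (A : set RT) : measurable A ->
  pushforward leb ((fun x => x + a)%R : RT -> RT) A = leb A.
Proof.
move=> mA; apply/esym/lebesgue_measure_unique => //=.
  exact: measurable_translation.
move=> _ _ [[u v]] _ <-; rewrite /pushforward /=.
rewrite (_ : _ @^-1` _ = `](u - a)%R, (v - a)%R]%classic).
  by rewrite !lebesgue_measure_itv/= !lte_fin ltrD2r -!EFinB opprB addrA subrK.
by apply/seteqP; split => x /=; rewrite !in_itv /= ltrBlDr lerBrDr.
Qed.

Lemma ge0_integral_translation (F : RT -> \bar R) (a : R) : measurable_fun setT F ->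
  (forall x, 0 <= F x) -> \int[leb]_x F (x + a)%R = \int[leb]_x F x.
Proof.
move=> mF F0.
have := @ge0_integral_pushforward _ _ RT RT R _ (measurable_translation a) leb setT F
  measurableT mF (fun y _ => F0 y).
rewrite preimage_setT => <-.
apply: eq_measure_integral; first exact: measurable_translation.
by move=> ? A mA _; exact: lebesgue_measure_translation.
Qed.

Definition shear1 (a : R) (p : RT * RT) : RT * RT := (p.1 + a * p.2, p.2)%R.
Definition shear2 (a : R) (p : RT * RT) : RT * RT := (p.1, p.2 + a * p.1)%R.

(** Stated for integrals of nonnegative functions rather than for sets, so that it composes and
    combines with Tonelli directly. *)
Definition leb2_preserving (T : RT * RT -> RT * RT) :=
  measurable_fun setT T /\
  forall F : RT * RT -> \bar R, measurable_fun setT F -> (forall p, 0 <= F p) ->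
  \int[leb2]_p F (T p) = \int[leb2]_p F p.

Lemma leb2_preserving_comp S T : leb2_preserving S -> leb2_preserving T ->
  leb2_preserving (S \o T).
Proof.
move=> [mS hS] [mT hT]; split; first exact: measurableT_comp mS mT.
move=> F mF F0; rewrite -(hS F mF F0).
by apply: (hT (F \o S)) => [|p]; [exact: measurableT_comp mF mS|exact: F0].
Qed.

(** On each horizontal line the shear is a translation, so integrating in x first reduces to
    invariance on the line. *)
Lemma leb2_preserving_shear1 a : leb2_preserving (shear1 a).
Proof.
have mS : measurable_fun setT (shear1 a).
  apply: measurable_fun_pair => /=; last exact: measurable_snd.
  apply: measurable_funD; first exact: measurable_fst.
  by apply: measurable_funM; [exact: measurable_cst|exact: measurable_snd].
split=> // F mF F0.
have mFS : measurable_fun setT (F \o shear1 a) by exact: measurableT_comp mF mS.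
rewrite (fubini_tonelli2 (F \o shear1 a) mFS (fun p => F0 _)) (fubini_tonelli2 F mF F0).
apply: eq_integral => y _.
rewrite /fubini_G /shear1 /=.
apply: (@ge0_integral_translation (fun x => F (x, y))) => //.
by apply: measurableT_comp mF _; exact: pair2_measurable.
Qed.

Lemma leb2_preserving_shear2 a : leb2_preserving (shear2 a).
Proof.
have mS : measurable_fun setT (shear2 a).
  apply: measurable_fun_pair => /=; first exact: measurable_fst.
  apply: measurable_funD; first exact: measurable_snd.
  by apply: measurable_funM; [exact: measurable_cst|exact: measurable_fst].
split=> // F mF F0.
have mFS : measurable_fun setT (F \o shear2 a) by exact: measurableT_comp mF mS.
rewrite (fubini_tonelli1 (F \o shear2 a) mFS (fun p => F0 _)) (fubini_tonelli1 F mF F0).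
apply: eq_integral => x _.
rewrite /fubini_F /shear2 /=.
apply: (@ge0_integral_translation (fun y => F (x, y))) => //.
by apply: measurableT_comp mF _; exact: pair1_measurable.
Qed.

Definition rot (c s : R) (p : RT * RT) : RT * RT :=
  (c * p.1 - s * p.2, s * p.1 + c * p.2)%R.

(* A rotation is a product of three shears as soon as its sine does not vanish. *)
Lemma leb2_preserving_rot c s : (c ^+ 2 + s ^+ 2 = 1)%R -> leb2_preserving (rot c s).
Proof.
have nz c' s' : (s' != 0 -> c' ^+ 2 + s' ^+ 2 = 1)%R -> s' != 0%R -> leb2_preserving (rot c' s').
  move=> /[swap] s0 /(_ s0) cs.
  have := leb2_preserving_comp (leb2_preserving_shear1 ((c' - 1) / s'))
    (leb2_preserving_comp (leb2_preserving_shear2 s') (leb2_preserving_shear1 ((c' - 1) / s'))).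
  congr leb2_preserving; apply/funext => -[x y]; rewrite /rot /= /shear1 /shear2 /=.
  congr pair; last by field.
  apply/eqP; rewrite -subr_eq0; apply/eqP.
  transitivity ((c' ^+ 2 + s' ^+ 2 - 1) / s' * y)%R; first by field.
  by rewrite cs subrr !mul0r.
have [->|s0] := eqVneq s 0%R; last by move=> cs; exact: nz.
rewrite expr0n addr0 => /eqP; rewrite sqrf_eq1 => /orP[] /eqP ->.
  split=> [|F mF F0].
    have := @measurable_id _ (RT * RT)%type setT; congr measurable_fun.
    by apply/funext => -[x y]; rewrite /rot /= !mul1r !mul0r subr0 add0r.
  by apply: eq_integral => -[x y] _; rewrite /rot /= !mul1r !mul0r subr0 add0r.
(* The half-turn has sine 0; it is obtained as the square of the quarter-turn. *)
have h : leb2_preserving (rot 0 1).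
  by apply: nz; rewrite ?oner_eq0// expr0n add0r expr1n.
have := leb2_preserving_comp h h; congr leb2_preserving; apply/funext => -[x y].
by rewrite /rot /=; congr pair; ring.
Qed.

Lemma measurable_cos : measurable_fun [set: RT] (cos : RT -> R).
Proof. by apply: continuous_measurable_fun; exact: continuous_cos. Qed.

Lemma measurable_sin : measurable_fun [set: RT] (sin : RT -> R).
Proof. by apply: continuous_measurable_fun; exact: continuous_sin. Qed.

(** Tonelli exchanges the angle and the plane; each rotated integral equals the original one, and
    the angles have total length 2 pi. *)
Lemma ge0_integral_rot_average (F : RT * RT -> \bar R) : measurable_fun setT F ->
  (forall p, 0 <= F p) ->
  \int[leb2]_p F p = \int[leb2]_p (((2 * pi)^-1)%:E *
     \int[leb]_(t in `[0%R, (2 * pi)%R]) F (rot (cos t) (sin t) p)).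
Proof.
move=> mF F0; have tp := twopi_gt0 R.
pose I : set RT := `[0%R, (2 * pi)%R]%classic.
pose G (q : (RT * RT) * RT) : \bar R :=
  F (rot (cos q.2) (sin q.2) q.1) * (\1_I q.2)%:E.
have mrot : measurable_fun setT (fun q : (RT * RT) * RT => rot (cos q.2) (sin q.2) q.1).
  have m1 : measurable_fun setT (fun q : (RT * RT) * RT => q.1.1).
    by apply: measurableT_comp; [exact: measurable_fst|exact: measurable_fst].
  have m2 : measurable_fun setT (fun q : (RT * RT) * RT => q.1.2).
    by apply: measurableT_comp; [exact: measurable_snd|exact: measurable_fst].
  have mc : measurable_fun setT (fun q : (RT * RT) * RT => cos q.2).
    by apply: measurableT_comp; [exact: measurable_cos|exact: measurable_snd].
  have ms : measurable_fun setT (fun q : (RT * RT) * RT => sin q.2).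
    by apply: measurableT_comp; [exact: measurable_sin|exact: measurable_snd].
  apply: measurable_fun_pair.
    by apply: measurable_funB; apply: measurable_funM.
  by apply: measurable_funD; apply: measurable_funM.
have mI : measurable_fun setT (fun q : (RT * RT) * RT => (\1_I q.2)%:E : \bar R).
  apply/measurable_EFinP; apply: (measurableT_comp (f := (\1_I : RT -> R))); last exact: measurable_snd.
  by apply: measurable_indic; exact: measurable_itv.
have mG : measurable_fun setT G.
  by apply: emeasurable_funM => //; exact: (measurableT_comp mF mrot).
have G0 q : 0 <= G q by rewrite mule_ge0// lee_fin.
have E p : \int[leb]_(t in I) F (rot (cos t) (sin t) p) = \int[leb]_t G (p, t).
  rewrite integral_mkcond; apply: eq_integral => t _.
  rewrite /G /= patchE indicE; case: ifPn => _; by rewrite ?mule1 ?mule0.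
have mE : measurable_fun setT (fun p => \int[leb]_t G (p, t)).
  by have := @measurable_fun_fubini_tonelli_F _ _ _ _ _ leb G mG G0.
under [RHS]eq_integral do rewrite E.
rewrite ge0_integralZl//; last 2 first.
- by move=> p _; apply: integral_ge0.
- by rewrite lee_fin invr_ge0 ltW.
rewrite (@plane_tonelli _ RT leb G mG G0).
rewrite (_ : \int[leb]_y _ = \int[leb]_(t in I) \int[leb2]_p F p); last first.
  rewrite [RHS]integral_mkcond; apply: eq_integral => t _.
  rewrite /G /= patchE indicE; case: ifPn => _; last first.
    by rewrite integral0_eq// => p _; rewrite mule0.
  under eq_integral do rewrite mule1.
  by have [_ ->] := leb2_preserving_rot (cos2Dsin2 t).
rewrite integral_cst//; last exact: measurable_itv.
have lI : leb I = (2 * pi)%:E.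
  have := lebesgue_measure_itv (R := R) `[0%R, (2 * pi)%R]; rewrite /= lte_fin tp oppr0 adde0; exact.
rewrite [X in _ = _ * (_ * X)]lI.
rewrite muleCA -EFinM mulVf ?mule1// gt_eqF//.
Qed.

End PlaneMeasure.

(** * Radial integrals over the disc *)

Section DiscIntegrals.
Variable R : realType.
Local Notation RT := (measurableTypeR R).
Local Notation leb := (@lebesgue_measure R).
Local Notation leb2 := (leb \x leb)%E.
Local Notation disc := (@unit_disc2 R).
Implicit Types (f g : R[i] -> R[i]) (p : RT * RT).

Definition sqn (p : RT * RT) : R := p.1 ^+ 2 + p.2 ^+ 2.

Lemma cabs2_toC p : cabs2 (toC p) = sqn p.
Proof. by []. Qed.

Lemma unit_disc2E p : disc p = (sqn p < 1) :> Prop.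
Proof. by []. Qed.

Lemma sqn_ge0 p : 0 <= sqn p.
Proof. by rewrite addr_ge0 ?sqr_ge0. Qed.

Lemma normc_toC_lt1 p : disc p -> normc (toC p) < 1.
Proof. by move=> hp; apply/unit_discE. Qed.

Lemma measurable_sqn : measurable_fun setT sqn.
Proof.
by apply: measurable_funD; apply: measurable_funX; [exact: measurable_fst|exact: measurable_snd].
Qed.

Lemma measurable_disc : measurable (disc : set (RT * RT)).
Proof.
have mt : measurable [set true] by [].
have := measurable_fun_ltr measurable_sqn (measurable_cst (1 : R)) measurableT mt.
by rewrite setTI; congr measurable; apply/seteqP; split.
Qed.

Let mdisc := measurable_disc.

Definition cmeas (phi : RT * RT -> R[i]) :=
  measurable_fun setT (fun p => complex.Re (phi p)) /\
  measurable_fun setT (fun p => complex.Im (phi p)).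

Lemma cmeas_cst c : cmeas (fun=> c).
Proof. by split; exact: measurable_cst. Qed.

Lemma cmeasD (phi psi : RT * RT -> R[i]) : cmeas phi -> cmeas psi -> cmeas (fun p => phi p + psi p).
Proof.
move=> [h1 h2] [k1 k2]; split.
  have := measurable_funD h1 k1; congr measurable_fun; apply/funext => p /=.
  by case: (phi p) (psi p) => a b [c d].
have := measurable_funD h2 k2; congr measurable_fun; apply/funext => p /=.
by case: (phi p) (psi p) => a b [c d].
Qed.

Lemma cmeasM (phi psi : RT * RT -> R[i]) : cmeas phi -> cmeas psi -> cmeas (fun p => phi p * psi p).
Proof.
move=> [h1 h2] [k1 k2]; split.
  have := measurable_funB (measurable_funM h1 k1) (measurable_funM h2 k2).
  by congr measurable_fun; apply/funext => p /=; case: (phi p) (psi p) => a b [c d].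
have := measurable_funD (measurable_funM h1 k2) (measurable_funM h2 k1).
by congr measurable_fun; apply/funext => p /=; case: (phi p) (psi p) => a b [c d].
Qed.

Lemma cmeas_poly (a : nat -> R[i]) N : cmeas (fun p => \sum_(k < N) a k * toC p ^+ k).
Proof.
have mC : cmeas (fun p => toC p) by split; [exact: measurable_fst|exact: measurable_snd].
have mX k : cmeas (fun p => toC p ^+ k).
  elim: k => [|k IH].
    by have := cmeas_cst 1; congr cmeas; apply/funext => p; rewrite expr0.
  by have := cmeasM mC IH; congr cmeas; apply/funext => p; rewrite exprS.
elim: N => [|N IH].
  by have := cmeas_cst 0; congr cmeas; apply/funext => p; rewrite big_ord0.
have := cmeasD IH (cmeasM (cmeas_cst (a N)) (mX N)).
by congr cmeas; apply/funext => p; rewrite big_ord_recr.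
Qed.

(** Measurability comes from the Taylor polynomials, which converge at every point of the disc. *)
Lemma measurable_hol_cabs2 g : hol g ->
  measurable_fun (disc : set (RT * RT)) (fun p => cabs2 (g (toC p))).
Proof.
move=> hg.
have mS N := cmeas_poly (acoef g) N.
apply: measurable_funD; apply: measurable_funX.
  apply: (measurable_fun_cvg (h := fun N p => complex.Re (\sum_(k < N) acoef g k * toC p ^+ k))).
    by move=> N; apply: measurable_funTS; exact: (mS N).1.
  move=> p hp; have [|M [q [M0 q01 H]]] := @hol_pseries R g (normc (toC p)) hg.
    by rewrite normc_ge0 normc_toC_lt1.
  apply: (geometric_cvg M0 q01) => N; apply: le_trans (H (toC p) N (lexx _)).
  by apply: le_trans (abs_Re_le _); case: (g _) (\sum_(_ < _) _) => a b [c d].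
apply: (measurable_fun_cvg (h := fun N p => complex.Im (\sum_(k < N) acoef g k * toC p ^+ k))).
  by move=> N; apply: measurable_funTS; exact: (mS N).2.
move=> p hp; have [|M [q [M0 q01 H]]] := @hol_pseries R g (normc (toC p)) hg.
  by rewrite normc_ge0 normc_toC_lt1.
apply: (geometric_cvg M0 q01) => N; apply: le_trans (H (toC p) N (lexx _)).
by apply: le_trans (abs_Im_le _); case: (g _) (\sum_(_ < _) _) => a b [c d].
Qed.

Lemma measurable_oneB_sqn n (D : set (RT * RT)) : measurable_fun D (fun p => (1 - sqn p) ^+ n).
Proof.
apply: measurable_funTS; apply: measurable_funX.
by apply: measurable_funB; [exact: measurable_cst|exact: measurable_sqn].
Qed.

Lemma measurable_radial k n (D : set (RT * RT)) :
  measurable_fun D (fun p => sqn p ^+ k * (1 - sqn p) ^+ n).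
Proof.
apply: measurable_funM; last exact: measurable_oneB_sqn.
by apply: measurable_funX; apply: measurable_funTS; exact: measurable_sqn.
Qed.

Definition circle_mean g p : R := rmean (fun t => cabs2 (g (toC p * expi t))).

Lemma circle_mean_ge0 g p : hol g -> disc p -> 0 <= circle_mean g p.
Proof.
move=> hg hp; rewrite /circle_mean /rmean mulr_ge0// ?invr_ge0 ?(ltW (twopi_gt0 R))//.
by rewrite /iint; apply: Rintegral_ge0 => t _; exact: cabs2_ge0.
Qed.

Lemma measurable_circle_mean g : hol g -> measurable_fun (disc : set (RT * RT)) (circle_mean g).
Proof.
move=> hg; apply: (measurable_fun_cvg (h := fun N p => \sum_(k < N) cabs2 (acoef g k) * sqn p ^+ k)).
  move=> N; apply: measurable_sum => k; apply: measurable_funM; first exact: measurable_cst.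
  by apply: measurable_funX; apply: measurable_funTS; exact: measurable_sqn.
by move=> p hp; apply: parseval_cvg => //; exact: normc_toC_lt1.
Qed.

Lemma toC_rot p t : toC (rot (cos t) (sin t) p) = toC p * expi t.
Proof.
case: p => x y; rewrite /toC /rot /expi; apply/eqP; rewrite eq_complex /=.
by apply/andP; split; apply/eqP; ring.
Qed.

Lemma sqn_rot p t : sqn (rot (cos t) (sin t) p) = sqn p.
Proof. by rewrite -!cabs2_toC toC_rot cabs2M cabs2_expi mulr1. Qed.

Lemma integral_iint (h : R -> R) (a b : R) : {within `[a, b], continuous h} ->
  (\int[leb]_(t in `[a, b]) (h t)%:E = (iint h a b)%:E)%E.
Proof.
move=> ch; rewrite /iint /Rintegral fineK//; apply: integrable_fin_num => //.
exact: within_itv_integrable.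
Qed.

Local Open Scope ereal_scope.

(** The disc and the weight are rotation invariant, so averaging only affects the factor |g|^2. *)
Lemma integral_disc_average g n : hol g ->
  \int[leb2]_(p in disc) (cabs2 (g (toC p)) * (1 - sqn p) ^+ n)%:E =
  \int[leb2]_(p in disc) (circle_mean g p * (1 - sqn p) ^+ n)%:E.
Proof.
move=> hg; rewrite integral_mkcond [RHS]integral_mkcond.
set F := _ \_ _.
have w0 p : disc p -> (0 <= (1 - sqn p) ^+ n)%R by move=> hp; rewrite exprn_ge0// subr_ge0 ltW.
have mF : measurable_fun setT F.
  apply/(measurable_restrict _ mdisc measurableT); rewrite setTI.
  apply/measurable_EFinP; apply: measurable_funM; first exact: measurable_hol_cabs2.
  exact: measurable_oneB_sqn.
have F0 p : 0 <= F p.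
  rewrite /F patchE; case: ifPn => // /set_mem hp.
  by rewrite lee_fin mulr_ge0 ?cabs2_ge0// w0.
rewrite (ge0_integral_rot_average mF F0); apply: eq_integral => p _.
rewrite patchE; case: ifPn => [/set_mem hp|hp]; last first.
  rewrite (_ : \int[leb]_(t in _) _ = 0) ?mule0//.
  apply: integral0_eq => t _; rewrite /F patchE ifN//.
  apply: contra hp => /set_mem hp; apply/mem_set; move: hp.
  by rewrite !unit_disc2E sqn_rot.
have cg : continuous (fun t => cabs2 (g (toC p * expi t)%R) : R).
  by apply: rcc_cabs2; apply: rcc_orbit => //; exact: normc_toC_lt1.
rewrite (_ : \int[leb]_(t in _) _ =
   \int[leb]_(t in `[0%R, (2 * pi)%R]) ((1 - sqn p) ^+ n * cabs2 (g (toC p * expi t)))%:E); last first.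
  apply: eq_integral => t _; rewrite /F patchE mem_set.
    by rewrite toC_rot sqn_rot mulrC.
  by rewrite unit_disc2E sqn_rot.
rewrite integral_iint.
  rewrite iintZ; last exact: continuous_subspaceT.
  by rewrite -[LHS]EFinM /circle_mean /rmean; congr EFin; ring.
by apply: continuous_subspaceT => t; apply: cvgM; [exact: cvg_cst|exact: cg].
Qed.

(** Splitting the derivative as f1 - f2 expresses the vanishing of its integral without a
    subtraction, a form fit for nonnegative extended reals. *)
Lemma ftc_balance (F f1 f2 : R -> R) (a : R) : (0 < a)%R -> continuous f1 -> continuous f2 ->
  (forall x, is_derive x (1%R : R) F (f1 x - f2 x)%R) -> F a = F (- a)%R ->
  \int[leb]_(x in `](- a)%R, a[) (f1 x)%:E = \int[leb]_(x in `](- a)%R, a[) (f2 x)%:E.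
Proof.
move=> a0 c1 c2 dF Fa.
have open_closed (h : R -> R) : continuous h ->
    \int[leb]_(x in `](- a)%R, a[) (h x)%:E = (iint h (- a)%R a)%:E.
  move=> ch; rewrite -integral_iint; last exact: continuous_subspaceT.
  have mh (E : set R) : measurable_fun E (EFin \o h).
    by apply/measurable_EFinP; apply: measurable_funTS; exact: continuous_measurable_fun.
  by rewrite integral_itv_obnd_cbnd// integral_itv_bndo_bndc.
rewrite !open_closed//; congr EFin; apply/eqP; rewrite -subr_eq0; apply/eqP.
rewrite -iintB; [|exact: continuous_subspaceT|exact: continuous_subspaceT].
have cf : continuous (fun x => f1 x - f2 x)%R by move=> x; apply: cvgB; [exact: c1|exact: c2].
have aa : (- a < a)%R by rewrite gtrN.
rewrite /iint /Rintegral (@continuous_FTC2 R _ F) ?aa//.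
- by rewrite Fa -EFinB subrr.
- exact: continuous_subspaceT.
- have cF x : {for x, continuous F}.
    by apply: differentiable_continuous; apply/derivable1_diffP; have [] := dF x.
  split; first by move=> x _; have [] := dF x.
  + by apply: cvg_at_right_filter; exact: cF.
  + by apply: cvg_at_left_filter; exact: cF.
- by move=> x _; rewrite derive1E; have [_ ->] := dF x.
Qed.

(** With u = x^2 + y^2, [flux1] minus [flux2] is the x-derivative of x u^k (1 - u)^(n+1), grouped by
    sign. For k = 0 the exponent [k.-1] is harmless because of the factor k. *)
Definition flux1 k n (p : RT * RT) : R :=
  (sqn p ^+ k * (1 - sqn p) ^+ n.+1 + p.1 ^+ 2 * (2 * k%:R * (sqn p ^+ k.-1 * (1 - sqn p) ^+ n.+1)))%R.
Definition flux2 k n (p : RT * RT) : R :=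
  (p.1 ^+ 2 * (2 * n.+1%:R * (sqn p ^+ k * (1 - sqn p) ^+ n)))%R.

Lemma continuous_exprn (h : R -> R) n : continuous h -> continuous (fun x => h x ^+ n)%R.
Proof.
move=> ch; elim: n => [|n IH] x; first by apply: cvg_cst.
rewrite (_ : (fun x => h x ^+ n.+1)%R = (fun x => h x * h x ^+ n)%R); last by apply/funext => z; rewrite exprS.
by apply: cvgM; [exact: ch|exact: IH].
Qed.

(* The x-flux of the vector field [phi(|p|^2) p], with [phi u = u^k (1-u)^(n+1)]: on a horizontal
   chord of the disc it is an exact derivative vanishing at both ends. *)
Lemma flux_section k n (y a : R) : (0 < a)%R -> (a ^+ 2 + y ^+ 2 = 1)%R ->
  \int[leb]_(x in `](- a)%R, a[) (flux1 k n (x, y))%:E =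
  \int[leb]_(x in `](- a)%R, a[) (flux2 k n (x, y))%:E.
Proof.
move=> a0 ay.
pose u (x : R) := (x ^+ 2 + y ^+ 2)%R.
have cid : continuous (fun x : R => x) by move=> x; exact: cvg_id.
have cx2 : continuous (fun x : R => x ^+ 2)%R by exact: continuous_exprn.
have cu : continuous u by move=> x; apply: cvgD; [exact: cx2|exact: cvg_cst].
have cv : continuous (fun x => 1 - u x)%R by move=> x; apply: cvgB; [exact: cvg_cst|exact: cu].
have cuv i j : continuous (fun x => u x ^+ i * (1 - u x) ^+ j)%R.
  by move=> x; apply: cvgM; [exact: continuous_exprn cu _|exact: continuous_exprn cv _].
have cxuv (c : R) i j : continuous (fun x : R => x ^+ 2 * (c * (u x ^+ i * (1 - u x) ^+ j)))%R.
  by move=> x; apply: cvgM; [exact: cx2|apply: cvgM; [exact: cvg_cst|exact: cuv]].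
apply: (@ftc_balance (fun x => x * (u x ^+ k * (1 - u x) ^+ n.+1))%R) => //.
- by move=> x; rewrite /flux1 /sqn /=; apply: cvgD; [exact: cuv|exact: cxuv].
- exact: cxuv.
- move=> x.
  have du : is_derive x (1%R : R) u (2 * x)%R.
    have D : is_derive x (1%R : R) u _ :=
      is_deriveD (is_deriveX 2 (is_derive_id x (1%R : R))) (is_derive_cst (y ^+ 2)%R x (1%R : R)).
    by apply: (is_derive_eq D); rewrite -![_ *: _]/(_ * _)%R /=; ring.
  have dv : is_derive x (1%R : R) (fun x => 1 - u x)%R (- (2 * x))%R.
    by have := is_deriveB (is_derive_cst (1%R : R) x (1%R : R)) du; rewrite sub0r.
  have duk : is_derive x (1%R : R) (fun x => u x ^+ k)%R (k%:R * u x ^+ k.-1 * (2 * x))%R.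
    by have := is_deriveX k du; rewrite exprfctE => D; apply: is_derive_eq D _.
  have dvn : is_derive x (1%R : R) (fun x => (1 - u x) ^+ n.+1)%R
      (n.+1%:R * (1 - u x) ^+ n * - (2 * x))%R.
    by have := is_deriveX n.+1 dv; rewrite exprfctE => D; apply: is_derive_eq D _.
  have := is_deriveM (is_derive_id x (1%R : R)) (is_deriveM duk dvn).
  rewrite -![_ *: _]/(_ * _)%R => D; apply: is_derive_eq D _.
  rewrite /flux1 /flux2 /sqn mulrfctE /= -/(u x).
  by move: (u x ^+ k.-1)%R => v; ring.
- by rewrite /u sqrrN ay subrr expr0n /= !mulr0.
Qed.

Lemma flux_ge0 k n p : disc p -> (0 <= flux1 k n p)%R /\ (0 <= flux2 k n p)%R.
Proof.
move=> hp; have w0 j : (0 <= (1 - sqn p) ^+ j)%R by rewrite exprn_ge0// subr_ge0 ltW.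
have s0 j : (0 <= sqn p ^+ j)%R by rewrite exprn_ge0// sqn_ge0.
have x0 (c : R) i j : (0 <= c)%R -> (0 <= p.1 ^+ 2 * (c * (sqn p ^+ i * (1 - sqn p) ^+ j)))%R.
  by move=> c0; apply: mulr_ge0 (sqr_ge0 _) (mulr_ge0 c0 (mulr_ge0 (s0 _) (w0 _))).
split; last by apply: x0; rewrite mulr_ge0.
by apply: addr_ge0; [exact: mulr_ge0 (s0 _) (w0 _)|apply: x0; rewrite mulr_ge0].
Qed.

Lemma measurable_flux k n (D : set (RT * RT)) :
  measurable_fun D (flux1 k n) /\ measurable_fun D (flux2 k n).
Proof.
have mx2 : measurable_fun D (fun p : RT * RT => p.1 ^+ 2)%R.
  by apply: measurable_funTS; apply: measurable_funX; exact: measurable_fst.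
split; last first.
  by apply: measurable_funM => //; apply: measurable_funM; [exact: measurable_cst|exact: measurable_radial].
apply: measurable_funD; first exact: measurable_radial.
by apply: measurable_funM => //; apply: measurable_funM; [exact: measurable_cst|exact: measurable_radial].
Qed.

Lemma measurable_patch_disc (h : RT * RT -> R) : measurable_fun (disc : set (RT * RT)) h ->
  measurable_fun setT ((EFin \o h) \_ disc).
Proof.
move=> mh; apply/(measurable_restrict _ mdisc measurableT); rewrite setTI.
exact/measurable_EFinP.
Qed.

Lemma patch_disc_ge0 (h : RT * RT -> R) : (forall p, disc p -> (0 <= h p)%R) ->
  forall p, 0 <= ((EFin \o h) \_ disc) p.
Proof. by move=> h0 p; rewrite patchE; case: ifPn => // /set_mem /h0; rewrite lee_fin. Qed.

Lemma disc_tonelli (h : RT * RT -> R) : measurable_fun (disc : set (RT * RT)) h ->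
  (forall p, disc p -> (0 <= h p)%R) ->
  \int[leb2]_(p in disc) (h p)%:E = \int[leb]_y \int[leb]_x ((EFin \o h) \_ disc) (x, y).
Proof.
move=> mh h0; rewrite integral_mkcond.
exact: (@fubini_tonelli2 _ _ RT RT R leb leb ((EFin \o h) \_ disc)
  (measurable_patch_disc mh) (patch_disc_ge0 h0)).
Qed.

(** The disc is cut into horizontal chords, and [flux_section] holds on each of them. *)
Lemma disc_flux_balance k n :
  \int[leb2]_(p in disc) (flux1 k n p)%:E = \int[leb2]_(p in disc) (flux2 k n p)%:E.
Proof.
have [m1 m2] := measurable_flux k n disc.
rewrite (disc_tonelli m1 (fun p hp => (flux_ge0 k n hp).1)).
rewrite (disc_tonelli m2 (fun p hp => (flux_ge0 k n hp).2)).
apply: eq_integral => y _.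
(* Lines that miss the disc contribute zero to both sides. *)
have [y1|y1] := ltP (y ^+ 2)%R 1%R; last first.
  have out x : (x, y) \notin (disc : set (RT * RT)).
    by apply/negP => /set_mem; rewrite /unit_disc2 /=; have := sqr_ge0 x; lra.
  by apply: eq_integral => x _; rewrite !patchE ifN ?ifN.
pose a := Num.sqrt (1 - y ^+ 2).
have a0 : (0 < a)%R by rewrite sqrtr_gt0 subr_gt0.
have a2 : (a ^+ 2 + y ^+ 2 = 1)%R by rewrite sqr_sqrtr ?subrK// subr_ge0 ltW.
have sec (x : R) : ((x, y) \in (disc : set (RT * RT))) = (x \in (`](- a)%R, a[%classic : set R)).
  apply/idP/idP => /set_mem hx; apply/mem_set; move: hx; rewrite /unit_disc2 /= in_itv /=.
    rewrite -a2 ltrD2r -real_ltr_norml ?num_real// -[(x ^+ 2)%R]real_normK ?num_real//.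
    by rewrite ltr_pXn2r// nnegrE ltW.
  rewrite -real_ltr_norml ?num_real// -a2 ltrD2r -[(x ^+ 2)%R]real_normK ?num_real// => h.
  by rewrite ltr_pXn2r// nnegrE ltW.
have E (h : RT * RT -> R) : \int[leb]_x ((EFin \o h) \_ disc) (x, y) =
    \int[leb]_(x in `](- a)%R, a[) (h (x, y))%:E.
  by rewrite [RHS]integral_mkcond; apply: eq_integral => x _; rewrite !patchE sec.
by rewrite !E; exact: flux_section.
Qed.

Lemma quarter_turn : leb2_preserving (rot (0 : R)%R 1%R).
Proof. by apply: leb2_preserving_rot; rewrite expr0n add0r expr1n. Qed.

Lemma disc_integral_rot (h : RT * RT -> R) : measurable_fun (disc : set (RT * RT)) h ->
  (forall p, disc p -> (0 <= h p)%R) ->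
  \int[leb2]_(p in disc) (h p)%:E = \int[leb2]_(p in disc) (h (rot 0 1 p))%:E.
Proof.
move=> mh h0; rewrite integral_mkcond [RHS]integral_mkcond.
have [_ /(_ _ (measurable_patch_disc mh) (patch_disc_ge0 h0)) <-] := quarter_turn.
apply: eq_integral => p _; rewrite !patchE.
rewrite (_ : (rot 0 1 p \in disc) = (p \in disc))//.
by apply/idP/idP => /set_mem hx; apply/mem_set; move: hx;
  rewrite /unit_disc2 /= !mul0r !mul1r sub0r addr0 sqrrN addrC.
Qed.

Definition disc_moment k n := \int[leb2]_(p in disc) (sqn p ^+ k * (1 - sqn p) ^+ n)%:E.

Lemma radial_ge0 k n p : disc p -> (0 <= sqn p ^+ k * (1 - sqn p) ^+ n)%R.
Proof. by move=> hp; rewrite mulr_ge0// exprn_ge0 ?sqn_ge0// subr_ge0 ltW. Qed.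

Lemma disc_moment_ge0 k n : 0 <= disc_moment k n.
Proof. by apply: integral_ge0 => p hp; rewrite lee_fin radial_ge0. Qed.

Lemma disc_momentZ k n (c : R) : (0 <= c)%R ->
  \int[leb2]_(p in disc) (c * (sqn p ^+ k * (1 - sqn p) ^+ n))%:E = c%:E * disc_moment k n.
Proof.
move=> c0; under eq_integral do rewrite EFinM.
rewrite ge0_integralZl//.
- by apply/measurable_EFinP; exact: measurable_radial.
- by move=> p hp; rewrite lee_fin radial_ge0.
Qed.

(** The divergence theorem for the field phi(|p|^2) p: the flux balance in x is added to its
    quarter-turn image, the balance in y. Then x^2 + y^2 recombines into u, leaving 2 (k+1) u^k
    (1-u)^(n+1) against 2 (n+1) u^(k+1) (1-u)^n. *)
Lemma disc_moment_rec k n :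
  k.+1%:R%:E * disc_moment k n.+1 = n.+1%:R%:E * disc_moment k.+1 n.
Proof.
have [m1 m2] := measurable_flux k n disc.
have r1 := disc_integral_rot m1 (fun p hp => (flux_ge0 k n hp).1).
have r2 := disc_integral_rot m2 (fun p hp => (flux_ge0 k n hp).2).
have B := disc_flux_balance k n.
have sq_rot p : sqn (rot 0 1 p) = sqn p.
  by rewrite /sqn /rot /= !mul0r !mul1r sub0r addr0 sqrrN addrC.
have x2 p : (p.1 ^+ 2 = sqn p - p.2 ^+ 2)%R by rewrite /sqn addrK.
have disc_rot p : disc p -> disc (rot 0 1 p).
  by rewrite !unit_disc2E sq_rot.
have mr (h : RT * RT -> R) : measurable_fun setT h -> measurable_fun (disc : set (RT * RT)) (fun p => h (rot 0 1 p)).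
  move=> mh; apply: measurable_funTS; apply: measurableT_comp mh _.
  exact: quarter_turn.1.
have [M1 M2] := measurable_flux k n setT.
have S1 : \int[leb2]_(p in disc) (flux1 k n p)%:E + \int[leb2]_(p in disc) (flux1 k n (rot 0 1 p))%:E =
    (2 * k.+1%:R)%:E * disc_moment k n.+1.
  rewrite -ge0_integralD//; last 4 first.
  - by move=> p hp; rewrite lee_fin (flux_ge0 k n hp).1.
  - exact/measurable_EFinP.
  - by move=> p hp; rewrite lee_fin (flux_ge0 k n (disc_rot _ hp)).1.
  - by apply/measurable_EFinP; exact: mr.
  rewrite -disc_momentZ ?mulr_ge0//; apply: eq_integral => p _.
  rewrite -EFinD /flux1 sq_rot; congr EFin.
  rewrite (_ : (rot 0 1 p).1 = - p.2)%R; last by rewrite /rot /= mul0r mul1r sub0r.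
  rewrite sqrrN -natr1 x2; case: (k) => [|j] /=; first by ring.
  by rewrite (exprS (sqn p) j); ring.
have S2 : \int[leb2]_(p in disc) (flux2 k n p)%:E + \int[leb2]_(p in disc) (flux2 k n (rot 0 1 p))%:E =
    (2 * n.+1%:R)%:E * disc_moment k.+1 n.
  rewrite -ge0_integralD//; last 4 first.
  - by move=> p hp; rewrite lee_fin (flux_ge0 k n hp).2.
  - exact/measurable_EFinP.
  - by move=> p hp; rewrite lee_fin (flux_ge0 k n (disc_rot _ hp)).2.
  - by apply/measurable_EFinP; exact: mr.
  rewrite -disc_momentZ ?mulr_ge0//; apply: eq_integral => p _.
  rewrite -EFinD /flux2 sq_rot; congr EFin.
  rewrite (_ : (rot 0 1 p).1 = - p.2)%R; last by rewrite /rot /= mul0r mul1r sub0r.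
  by rewrite sqrrN x2 (exprS (sqn p) k); ring.
(* The common factor 2 is removed by multiplication, since the moments are extended reals. *)
have half (X : \bar R) : X = (2^-1)%:E * (2%:E * X).
  by rewrite muleA -EFinM mulVf// mul1e.
rewrite -r1 B {2}r2 S2 !EFinM -!muleA in S1.
by rewrite [LHS]half [RHS]half S1.
Qed.

End DiscIntegrals.

(** * The weighted inequality *)

Section WeightedDisc.
Variable R : realType.
Local Notation RT := (measurableTypeR R).
Local Notation leb := (@lebesgue_measure R).
Local Notation leb2 := (leb \x leb)%E.
Local Notation disc := (@unit_disc2 R).
Local Open Scope ereal_scope.

Let mdisc := @measurable_disc R.

Let oneB_gt0 p : disc p -> (0 < 1 - sqn p)%R.
Proof. by move=> hp; rewrite subr_gt0. Qed.

(** The estimate for a single point of the circle, with n = m + 1. Averaging expresses both sides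
    through the |s_k|^2 and the moments; the bound holds term by term in k, and the series is folded
    back into an integral. *)
Lemma disc_dilate_div_le f (r : R) c m : (0 < r < 1)%R -> (normc c <= 1)%R -> hol f ->
  \int[leb2]_(p in disc) (cabs2 (dilate_div f r c (toC p)) * (1 - sqn p) ^+ m.+1)%:E <=
  (2 - r)%:E * \int[leb2]_(p in disc) (cabs2 (f (toC p)) * (1 - sqn p) ^+ m.+1)%:E.
Proof.
move=> r01 c1 hf; have /andP[r0 r1] := r01.
have hk : hol (dilate_div f r c) by apply: hol_dilate_div => //; rewrite ltW.
have a0 k : (0 <= cabs2 (acoef f k))%R by exact: cabs2_ge0.
have b0 k : (0 <= r ^+ k * cabs2 (acoef f k))%R by rewrite mulr_ge0// exprn_ge0// ltW.
have r1' : (0 <= 1 - r)%R by rewrite subr_ge0 ltW.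
(* The k-th term once the factor 1 / (1 - |z|^2) of the tail has lowered the exponent m + 1 to m. *)
pose G k p : R := (r ^+ k * cabs2 (acoef f k) *
  (sqn p ^+ k * (1 - sqn p) ^+ m.+1 + (1 - r) * (sqn p ^+ k.+1 * (1 - sqn p) ^+ m)))%R.
have G0 k p : disc p -> (0 <= G k p)%R.
  move=> hp; apply: mulr_ge0 => //; apply: addr_ge0; first exact: radial_ge0.
  by apply: mulr_ge0 => //; exact: radial_ge0.
have mG k : measurable_fun (disc : set (RT * RT)) (G k).
  apply: measurable_funM; first exact: measurable_cst.
  apply: measurable_funD; first exact: measurable_radial.
  by apply: measurable_funM; [exact: measurable_cst|exact: measurable_radial].
rewrite !integral_disc_average//.
apply: (@le_trans _ _ (\int[leb2]_(p in disc) \sum_(k <oo) (G k p)%:E)).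
  apply: ge0_le_integral => //.
  - by move=> p hp; rewrite lee_fin mulr_ge0 ?circle_mean_ge0// exprn_ge0// ltW// oneB_gt0.
  - apply/measurable_EFinP; apply: measurable_funM; last exact: measurable_oneB_sqn.
    exact: measurable_circle_mean.
  - apply: ge0_emeasurable_sum => [k p hp _|k _]; first by rewrite lee_fin G0.
    by apply/measurable_EFinP.
  move=> p hp; have d0 := oneB_gt0 hp.
  have z1 := normc_toC_lt1 hp.
  have W0 : (0 <= (1 - sqn p) ^+ m.+1)%R by rewrite exprn_ge0// ltW.
  rewrite mulrC EFinM.
  apply: le_trans (lee_wpmul2l _ (dilate_div_mean_le r01 c1 hf z1)) _; first by rewrite lee_fin.
  rewrite -nneseriesZl; last first.
    move=> k _; rewrite lee_fin cabs2_toC; apply: mulr_ge0 => //; apply: addr_ge0.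
      by rewrite exprn_ge0// sqn_ge0.
    by rewrite mulr_ge0// divr_ge0 ?exprn_ge0 ?sqn_ge0// ltW.
  rewrite le_eqVlt; apply/orP; left; apply/eqP; apply: eq_eseriesr => k _.
  rewrite -EFinM cabs2_toC /G; congr EFin; rewrite [((1 - sqn p) ^+ m.+1)%R]exprS.
  by field; rewrite gt_eqF.
have mEG k : measurable_fun (disc : set (RT * RT)) (fun p => (G k p)%:E) by exact/measurable_EFinP.
have EG0 k p : disc p -> 0 <= (G k p)%:E by move=> hp; rewrite lee_fin G0.
rewrite (integral_nneseries leb2 mdisc mEG EG0).
have intG k : \int[leb2]_(p in disc) (G k p)%:E <=
    ((2 - r) * cabs2 (acoef f k))%:E * disc_moment R k m.+1.
  have -> : \int[leb2]_(p in disc) (G k p)%:E = (r ^+ k * cabs2 (acoef f k))%:E *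
      (disc_moment R k m.+1 + (1 - r)%:E * disc_moment R k.+1 m).
    rewrite -disc_momentZ// /disc_moment -ge0_integralD//; last 4 first.
    - by move=> p hp; rewrite lee_fin radial_ge0.
    - by apply/measurable_EFinP; exact: measurable_radial.
    - by move=> p hp; rewrite lee_fin mulr_ge0// radial_ge0.
    - apply/measurable_EFinP; apply: measurable_funM; first exact: measurable_cst.
      exact: measurable_radial.
    rewrite -ge0_integralZl//.
    - apply: emeasurable_funD; apply/measurable_EFinP; first exact: measurable_radial.
      by apply: measurable_funM; [exact: measurable_cst|exact: measurable_radial].
    - move=> p hp; apply: adde_ge0; rewrite lee_fin; first exact: radial_ge0.
      by rewrite mulr_ge0// radial_ge0.
    - by rewrite lee_fin.
  (* The moment recursion restores the exponent m + 1; its ratio is the (k + 1) / n of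
     [weight_bound]. *)
  have -> : disc_moment R k.+1 m = (k.+1%:R / m.+1%:R)%:E * disc_moment R k m.+1.
    rewrite [(_ / _)%R]mulrC EFinM -muleA disc_moment_rec muleA -EFinM.
    by rewrite mulVf ?pnatr_eq0// mul1e.
  rewrite muleA -EFinM -[X in X + _]mul1e -ge0_muleDl ?lee_fin//; last first.
    by rewrite mulr_ge0// divr_ge0.
  rewrite muleA -EFinD -EFinM; apply: lee_wpmul2r; first exact: disc_moment_ge0.
  by rewrite lee_fin mulrAC ler_wpM2r// weight_bound.
apply: (@le_trans _ _ (\sum_(k <oo) ((2 - r) * cabs2 (acoef f k))%:E * disc_moment R k m.+1)).
  apply: lee_nneseries => [k _ _|k _]; last exact: intG.
  by apply: integral_ge0 => p hp; rewrite lee_fin G0.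
(* The way back: the series of moments weighted by |s_k|^2 is the integral of the circle mean of
   f. *)
under eq_eseriesr do rewrite EFinM -muleA.
rewrite nneseriesZl; last first.
  by move=> k _; rewrite mule_ge0 ?lee_fin// disc_moment_ge0.
apply: lee_wpmul2l; first by rewrite lee_fin subr_ge0 (le_trans (ltW r1))// ler1n.
under eq_eseriesr do rewrite -disc_momentZ//.
rewrite -integral_nneseries//; last 2 first.
- move=> k; apply/measurable_EFinP; apply: measurable_funM; first exact: measurable_cst.
  exact: measurable_radial.
- by move=> k p hp; rewrite lee_fin mulr_ge0// radial_ge0.
rewrite le_eqVlt; apply/orP; left; apply/eqP; apply: eq_integral => p /set_mem hp.
rewrite mulrC EFinM /circle_mean -parseval_eseries//; last exact: normc_toC_lt1.
have W0 : (0 <= (1 - sqn p) ^+ m.+1)%R by rewrite exprn_ge0// ltW// oneB_gt0.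
rewrite -nneseriesZl; last first.
  by move=> k _; rewrite lee_fin mulr_ge0// exprn_ge0// sqn_ge0.
by apply: eq_eseriesr => k _; rewrite -EFinM cabs2_toC; congr EFin; ring.
Qed.

(** * The Poisson kernel and Tonelli's theorem *)

Definition cauchy_div (g : R[i] -> R[i]) (t : R) := fun z => (g z * (1 - conjc (expi t) * z)^-1)%R.

Let normc_zeta (t : R) : (normc (conjc (expi t)) <= 1)%R.
Proof. by rewrite normc_conj normc_expi. Qed.

Lemma hol_cauchy_div g t : hol g -> hol (cauchy_div g t).
Proof. by move=> hg; apply: hol_mul => //; exact: hol_oneBV. Qed.

Lemma disc_cauchy_div_dil_le g (r : R) t n m : hol g -> (0 <= r < 1)%R ->
  \int[leb2]_(p in disc) (cabs2 (cauchy_div (fun z => r%:C%C ^+ n.+1 * g (r%:C%C * z))%R t (toC p)) *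
     (1 - sqn p) ^+ m.+1)%:E <=
  (r ^+ (2 * n.+1) * (2 - r))%:E *
  \int[leb2]_(p in disc) (cabs2 (cauchy_div g t (toC p)) * (1 - sqn p) ^+ m.+1)%:E.
Proof.
(* The dilated coefficients are computed for r > 0 only. At r = 0 both sides vanish, the right one
   even for an infinite integral because 0 times infinity is 0. *)
move=> hg /andP[r0 r1]; have [rz|rnz] := eqVneq r 0%R.
  have -> : (r ^+ (2 * n.+1) * (2 - r) = 0)%R by rewrite rz mulnS exprS !mul0r.
  rewrite mul0e rz integral0_eq// => p _.
  by rewrite /cauchy_div exprS !mul0r /cabs2 /= expr0n /= addr0 mul0r.
have r01 : (0 < r < 1)%R by rewrite lt0r rnz r0.
have rX0 : (0 <= r ^+ (2 * n.+1))%R by rewrite exprn_ge0.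
have hh := hol_cauchy_div t hg.
have hk : hol (dilate_div (cauchy_div g t) r (conjc (expi t))).
  by apply: hol_dilate_div => //; rewrite r0.
(* The denominator 1 - conj(zeta) r z of h(r z) cancels against the numerator in [dilate_div]. *)
have E p : disc p -> cabs2 (cauchy_div (fun z => r%:C%C ^+ n.+1 * g (r%:C%C * z))%R t (toC p)) =
    (r ^+ (2 * n.+1) * cabs2 (dilate_div (cauchy_div g t) r (conjc (expi t)) (toC p)))%R.
  move=> hp; have z1 := normc_toC_lt1 hp.
  have -> : (r ^+ (2 * n.+1) = cabs2 (r%:C%C ^+ n.+1))%R.
    by rewrite cabs2E normcX normcC ger0_norm// -exprM mulnC.
  rewrite -cabs2M /dilate_div /cauchy_div -mulrA; congr (cabs2 (_ * _)%R).
  have rz1 : (normc (r%:C%C * toC p) < 1)%R by apply: normc_dil => //; rewrite r0.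
  have nz := oneB_neq0 (normc_zeta t) rz1.
  have BC : (1 - conjc (expi t) * (r%:C%C * toC p) = 1 - r%:C%C * conjc (expi t) * toC p)%R by ring.
  rewrite BC in nz *; rewrite [RHS]mulrACA [X in (_ = _ * X)%R]mulrC.
  by rewrite [RHS]mulrACA mulfV// mul1r mulrC.
apply: (@le_trans _ _ (\int[leb2]_(p in disc) ((r ^+ (2 * n.+1))%:E *
   (cabs2 (dilate_div (cauchy_div g t) r (conjc (expi t)) (toC p)) * (1 - sqn p) ^+ m.+1)%:E))).
  rewrite le_eqVlt; apply/orP; left; apply/eqP; apply: eq_integral => p /set_mem hp.
  by rewrite E// -EFinM mulrA.
rewrite ge0_integralZl//; last 2 first.
- apply/measurable_EFinP; apply: measurable_funM; first exact: measurable_hol_cabs2.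
  exact: measurable_oneB_sqn.
- by move=> p hp; rewrite lee_fin mulr_ge0 ?cabs2_ge0// exprn_ge0// ltW// oneB_gt0.
rewrite EFinM -muleA; apply: lee_wpmul2l; first by rewrite lee_fin.
exact: disc_dilate_div_le.
Qed.

(** The real power -1 agrees with the inverse even at 0, where both are 0. *)
Lemma measurable_funV_ge0 d (T : measurableType d) (h : T -> R) : measurable_fun setT h ->
  (forall x, (0 <= h x)%R) -> measurable_fun setT (fun x => (h x)^-1)%R.
Proof.
move=> mh h0; rewrite (_ : (fun x => _) = (fun x => powR (h x) (-1))).
  by apply: (measurableT_comp (f := fun x : R => powR x (-1))) mh; exact: measurable_powR.
by apply/funext => x; rewrite powR_inv1.
Qed.

Variable mu : {finite_measure set R -> \bar R}.

Let arc : set R := `[0%R, (2 * pi)%R[%classic.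

(** The numerator 1 - |z|^2 of the Poisson kernel is absorbed into the weight, raising its exponent
    to m + 1. The cut-offs to the disc and to one turn are built in so that Tonelli applies on the
    whole product. *)
Definition poisson_density (g : R[i] -> R[i]) m (q : (RT * RT) * R) : \bar R :=
  ((EFin \o (fun p => cabs2 (g (toC p)) * (1 - sqn p) ^+ m.+1)%R) \_ disc) q.1 *
  (((cabs2 (toC q.1 - expi q.2))^-1)%:E * (\1_arc q.2)%:E).

Lemma poisson_density_ge0 g m q : 0 <= poisson_density g m q.
Proof.
rewrite /poisson_density !mule_ge0 ?lee_fin ?invr_ge0 ?cabs2_ge0//.
apply: patch_disc_ge0 => p hp.
by rewrite mulr_ge0 ?cabs2_ge0// exprn_ge0// ltW// oneB_gt0.
Qed.

Lemma measurable_poisson_kernel :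
  measurable_fun setT (fun q : (RT * RT) * R => (cabs2 (toC q.1 - expi q.2))^-1)%R.
Proof.
apply: measurable_funV_ge0; last by move=> q; exact: cabs2_ge0.
have m1 : measurable_fun setT (fun q : (RT * RT) * R => q.1.1).
  by apply: measurableT_comp; [exact: measurable_fst|exact: measurable_fst].
have m2 : measurable_fun setT (fun q : (RT * RT) * R => q.1.2).
  by apply: measurableT_comp; [exact: measurable_snd|exact: measurable_fst].
have mc : measurable_fun setT (fun q : (RT * RT) * R => cos q.2).
  by apply: measurableT_comp; [exact: measurable_cos|exact: measurable_snd].
have ms : measurable_fun setT (fun q : (RT * RT) * R => sin q.2).
  by apply: measurableT_comp; [exact: measurable_sin|exact: measurable_snd].
by apply: measurable_funD; apply: measurable_funX; apply: measurable_funB.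
Qed.

Lemma measurable_poisson_density g m : hol g -> measurable_fun setT (poisson_density g m).
Proof.
move=> hg; apply: emeasurable_funM.
  apply: (measurableT_comp (f := (EFin \o (fun p => cabs2 (g (toC p)) * (1 - sqn p) ^+ m.+1)%R) \_ disc));
    last exact: measurable_fst.
  apply: measurable_patch_disc; apply: measurable_funM; first exact: measurable_hol_cabs2.
  exact: measurable_oneB_sqn.
apply: emeasurable_funM; first by apply/measurable_EFinP; exact: measurable_poisson_kernel.
apply/measurable_EFinP; apply: (measurableT_comp (f := (\1_arc : R -> R))); last exact: measurable_snd.
by apply: measurable_indic; exact: measurable_itv.
Qed.

(** For |zeta| = 1 one has |z - zeta| = |1 - conj(zeta) z|, which turns the kernel into the squared
    modulus of a holomorphic function. *)
Lemma poisson_density_arc g m t : t \in arc ->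
  \int[leb2]_p poisson_density g m (p, t) =
  \int[leb2]_(p in disc) (cabs2 (cauchy_div g t (toC p)) * (1 - sqn p) ^+ m.+1)%:E.
Proof.
move=> ht; rewrite [RHS]integral_mkcond; apply: eq_integral => p _.
rewrite /poisson_density /= indicE ht mule1 !patchE; case: ifPn => _; last by rewrite mul0e.
rewrite -EFinM; congr EFin; rewrite /cauchy_div cabs2M mulrAC; congr (_ * _ * _)%R.
have -> : (toC p - expi t = - expi t * (1 - conjc (expi t) * toC p))%R.
  rewrite mulrBr mulr1 mulrA mulNr conj_expi -expiD subrr expi0 mulN1r opprK addrC.
  by [].
rewrite cabs2M (_ : cabs2 (- expi t)%R = 1%R); last by rewrite cabs2E normcN normc_expi expr1n.
by rewrite mul1r !cabs2E normcV exprVn.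
Qed.

Lemma poisson_tonelli g m : hol g ->
  \int[leb2]_(p in disc) ((cabs2 (g (toC p)))%:E * poisson mu (toC p) * ((1 - cabs2 (toC p)) ^+ m)%:E) =
  \int[mu]_t \int[leb2]_p poisson_density g m (p, t).
Proof.
move=> hg; rewrite -(plane_tonelli mu (measurable_poisson_density m hg) (poisson_density_ge0 g m)).
rewrite integral_mkcond; apply: eq_integral => p _; rewrite patchE.
case: ifPn => [/set_mem hp|hp]; last first.
  by rewrite integral0_eq// => t _; rewrite /poisson_density /= patchE ifN// mul0e.
have W0 j : (0 <= (1 - sqn p) ^+ j)%R by rewrite exprn_ge0// ltW// oneB_gt0.
have mk : measurable_fun arc (fun t => ((1 - cabs2 (toC p)) / cabs2 (toC p - expi t))%:E).
  apply/measurable_EFinP; apply: measurable_funTS; apply: measurable_funM; first exact: measurable_cst.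
  by have := measurableT_comp measurable_poisson_kernel (pair1_measurable p).
have k0 t : 0 <= ((1 - cabs2 (toC p)) / cabs2 (toC p - expi t))%:E.
  by rewrite lee_fin divr_ge0 ?cabs2_ge0// ltW// oneB_gt0.
rewrite muleAC -EFinM /poisson -ge0_integralZl//; last first.
  by rewrite lee_fin mulr_ge0 ?cabs2_ge0// W0.
rewrite [LHS]integral_mkcond; apply: eq_integral => t _.
rewrite /poisson_density /= !patchE indicE (mem_set hp) -/arc.
case: ifPn => _; last by rewrite !mule0.
by rewrite mule1 -!EFinM cabs2_toC exprS; congr EFin; ring.
Qed.

(** For each angle this is the estimate at one point of the circle, with a constant independent of
    the angle; off the parametrising interval the density is zero. *)
Lemma poisson_integral_dil_le g (r : R) n m : hol g -> (0 <= r < 1)%R ->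
  \int[mu]_t \int[leb2]_p poisson_density (fun z => r%:C%C ^+ n.+1 * g (r%:C%C * z))%R m (p, t) <=
  (r ^+ (2 * n.+1) * (2 - r))%:E * \int[mu]_t \int[leb2]_p poisson_density g m (p, t).
Proof.
move=> hg r01; have /andP[r0 r1] := r01.
have hr : hol (fun z => r%:C%C ^+ n.+1 * g (r%:C%C * z))%R.
  by apply: hol_mul; [exact: hol_cst|exact: hol_dil].
have mI g' : hol g' -> measurable_fun setT (fun t => \int[leb2]_p poisson_density g' m (p, t)).
  move=> hg'; exact: (@measurable_fun_fubini_tonelli_G _ _ _ _ _ (@plane_measure R) _
    (measurable_poisson_density m hg') (poisson_density_ge0 g' m)).
have I0 g' t : 0 <= \int[leb2]_p poisson_density g' m (p, t).
  by apply: integral_ge0 => p _; exact: poisson_density_ge0.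
have c0 : 0 <= (r ^+ (2 * n.+1) * (2 - r))%:E.
  by rewrite lee_fin mulr_ge0 ?exprn_ge0// subr_ge0 (le_trans (ltW r1))// ler1n.
rewrite -ge0_integralZl//; last exact: mI.
apply: ge0_le_integral => //; first exact: mI.
  by apply: emeasurable_funM; [exact: measurable_cst|exact: mI].
move=> t _; have [ht|ht] := boolP (t \in arc).
  by rewrite !poisson_density_arc//; exact: disc_cauchy_div_dil_le.
rewrite integral0_eq; first by rewrite mule_ge0.
by move=> p _; rewrite /poisson_density /= indicE (negPf ht) !mule0.
Qed.

Lemma dilation_constant_le (r : R) n : (0 <= r < 1)%R ->
  (r ^+ (2 * n.+1) * (2 - r) <=
   (4 ^+ n * (2 - r) * r ^+ (2 * n.+1)) / (1 + r) ^+ (2 * n.+1 - 2))%R.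
Proof.
move=> /andP[r0 r1]; have p0 : (0 < 1 + r)%R by rewrite ltr_wpDr.
rewrite (_ : (2 * n.+1 - 2 = 2 * n)%N); last by rewrite mulnS addKn.
rewrite ler_pdivlMr ?exprn_gt0// mulrC.
have K : ((1 + r) ^+ (2 * n) <= 4 ^+ n)%R.
  rewrite exprM lerXn2r ?nnegrE ?exprn_ge0 ?(ltW p0)//.
  by have -> : (4 = 2 ^+ 2 :> R)%R by [rewrite -natrX]; rewrite lerXn2r ?nnegrE ?(ltW p0)//; lra.
rewrite -mulrA [(r ^+ _ * _)%R]mulrC ler_wpM2r// mulr_ge0 ?exprn_ge0// subr_ge0.
by rewrite (le_trans (ltW r1))// ler1n.
Qed.

End WeightedDisc.

Lemma lee_wpmul2_scale (R : realType) (a b K I1 I2 : \bar R) : (0 <= a)%E -> (0 <= b)%E ->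
  (I1 <= K * I2)%E -> (a * (b * I1) <= K * (a * (b * I2)))%E.
Proof.
move=> a0 b0 H; rewrite [leRHS]muleCA [(K * _)%E]muleCA.
by apply: lee_wpmul2l => //; apply: lee_wpmul2l.
Qed.

(** Only values of the derivative inside the disc enter, so it may be replaced by a holomorphic [g]
    that agrees with it there. *)
Lemma Dmun_poisson_density (R : realType) (mu : {finite_measure set R -> \bar R}) m
    (f g : R[i] -> R[i]) : hol g ->
  (forall z, normc z < 1 -> derive1n m.+1 (f : R[i]^o -> R[i]^o) z = g z) ->
  Dmun mu m.+1 f = ((((m.+1)`! * (m.+1.-1)`!)%:R^-1)%:E * ((pi^-1)%:E *
    \int[mu]_t \int[(@lebesgue_measure R \x @lebesgue_measure R)]_p poisson_density g m (p, t)))%E.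
Proof.
move=> hg fg; rewrite -poisson_tonelli//; congr (_ * (_ * _))%E.
by apply: eq_integral => p /set_mem hp; rewrite fg//; exact: normc_toC_lt1.
Qed.

Unset Implicit Arguments.

Theorem theorem2p6 (R : realType) (n : nat) (mu : {finite_measure set R -> \bar R})
  (f : R[i] -> R[i]) (r : R) :
  (1 <= n)%N -> holomorphic_on_disc f -> 0 <= r < 1 ->
  (Dmun mu n (fun z => f ((r%:C)%C * z)%R) <=
   ((4 ^+ n.-1 * (2 - r) * r ^+ (2 * n)) / (1 + r) ^+ (2 * n - 2))%:E * Dmun mu n f)%E.
Proof.
case: n => [//|m] _ hf0 r01.
have hf : hol f.
  move=> z z1; exists ('D_1 (f : R[i]^o -> R[i]^o) z); apply: derivable_cdiff.
  by apply: hf0; apply/unit_discE.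
pose g := derive1n m.+1 (f : R[i]^o -> R[i]^o).
have hg : hol g by have [] := hol_derive1n m.+1 hf.
have hr : hol (fun z => r%:C%C ^+ m.+1 * g (r%:C%C * z)).
  by apply: hol_mul; [exact: hol_cst|exact: hol_dil].
have pi0 : (0 <= (pi^-1)%:E :> \bar R)%E by rewrite lee_fin invr_ge0 pi_ge0.
have fact0 : (0 <= (((m.+1)`! * (m.+1.-1)`!)%:R^-1)%:E :> \bar R)%E by rewrite lee_fin invr_ge0.
have K0 := dilation_constant_le m r01.
(* The chain rule contributes r^n, whose squared modulus is the factor r^(2n) of the constant. *)
have Er z : normc z < 1 -> derive1n m.+1 ((fun z => f (r%:C%C * z)) : R[i]^o -> R[i]^o) z =
    r%:C%C ^+ m.+1 * g (r%:C%C * z) by move=> z1; exact: derive1n_dil.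
rewrite (Dmun_poisson_density mu hr Er) (Dmun_poisson_density mu hg (fun z _ => erefl)).
apply: (lee_wpmul2_scale fact0 pi0).
(* The order of differentiation and the exponent of the weight, independent until now, are both set
   by m. *)
apply: le_trans (poisson_integral_dil_le mu m m hg r01) _.
apply: lee_wpmul2r; last by rewrite lee_fin.
by apply: integral_ge0 => t _; apply: integral_ge0 => p _; exact: poisson_density_ge0.
Qed.
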